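(* Let $x_1,x_2$ be two distinct points of $\mathbb{S}^2$. Then $\Gamma_2(B_2(\mathbb{S}^2\setminus\{x_1,x_2\}))$ is a free group of infinite rank with basis $\{z_i\}_{i\in\mathbb{Z}}$, where $z_i=\gamma_{2,1}^i\gamma_{2,2}\gamma_{2,1}^{-(i+1)}$ for all $i\in\mathbb{Z}$.
   Context: For a surface $M$, $F_m(M)=\{(y_1,\ldots,y_m)\in M^m: y_i\neq y_j\text{ if }i\neq j\}$, and $B_m(M)=\pi_1(F_m(M)/S_m)$ is the $m$-string braid group of $M$. $\Gamma_2(G)=[G,G]$. The group $B_2(\mathbb{S}^2\setminus\{x_1,x_2\})$ has generators $\gamma_{i,j}$ ($1\leq i,j\leq 2$) and $\sigma$, subject to the relations $\gamma_{1,2}\gamma_{2,2}\sigma^2=1$, $\gamma_{1,1}\gamma_{2,1}\sigma^2=1$, and $\sigma\gamma_{i,1}\sigma^{-1}=\gamma_{i,2}$ for $i=1,2$. Geometrically, $\gamma_{i,j}$ is a loop based at the $j$th basepoint encircling the puncture $x_i$, and $\sigma$ is the standard half-twist exchanging the two basepoints. *)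

(* Defs.v *)
From HB Require Import structures.
From mathcomp Require Import all_boot all_order all_algebra all_fingroup.
From mathcomp Require Import generic_quotient.
From mathcomp Require Import all_classical all_reals all_analysis homotopy.
From mathcomp Require Import ring lra.
Import Order.TTheory GRing.Theory Num.Theory.
Import numFieldNormedType.Exports.
Set Implicit Arguments.
Unset Strict Implicit.
Unset Printing Implicit Defensive.
Local Open Scope classical_set_scope.
Local Open Scope ring_scope.
Local Open Scope quotient_scope.

Definition unit_itv (R : realType) : Type := set_type (`[0, 1]%classic : set R).

HB.instance Definition _ (R : realType) := Topological.on (unit_itv R).

Section unit_interval.
Variable R : realType.
Implicit Types t : R.

Fact clamp_subproof t : Num.max 0 (Num.min 1 t) \in (`[0, 1]%classic : set R).
Proof.
by rewrite inE/= in_itv/= le_max lexx ge_max ler01 ge_min lexx.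
Qed.

Definition clamp t : unit_itv R :=
  exist (fun x => x \in (`[0, 1]%classic : set R)) _ (clamp_subproof t).

Lemma clampE t : 0 <= t <= 1 -> set_val (clamp t) = t.
Proof.
by move=> /andP[t0 t1]; rewrite set_valE/= min_r // max_r.
Qed.

Lemma itvP (s : unit_itv R) : 0 <= set_val s <= 1.
Proof. by have := set_mem (valP s); rewrite /= in_itv. Qed.

Lemma clampK (s : unit_itv R) : clamp (set_val s) = s.
Proof. by apply: val_inj; exact: clampE (itvP s). Qed.

Fact clamp01_neq : clamp 0 != clamp 1.
Proof.
apply/eqP => /(congr1 (@set_val _ _)); rewrite !clampE ?lexx ?ler01 //.
by move/eqP; rewrite eq_sym oner_eq0.
Qed.

HB.instance Definition _ := isBiPointed.Build (unit_itv R) clamp01_neq.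

Lemma clamp_ge1 t : 1 <= t -> clamp t = one.
Proof.
move=> t1; apply: val_inj => /=.
by rewrite !min_l // lexx.
Qed.

Lemma clamp_le0 t : t <= 0 -> clamp t = zero.
Proof.
move=> t0; apply: val_inj => /=.
by rewrite min_r ?(le_trans t0) // max_l // min_r // max_l.
Qed.

Lemma set_val_continuous : continuous (set_val : unit_itv R -> R).
Proof. exact: initial_continuous. Qed.

Lemma clamp_continuous : continuous clamp.
Proof.
apply: continuous_comp_initial => t.
rewrite /comp/= /continuous_at.
apply: (@continuous_max _ _ (fun=> 0) (fun t => Num.min 1 t)).
  exact: cvg_cst.
by apply: (@continuous_min _ _ (fun=> 1) id); [exact: cvg_cst|exact: cvg_id].
Qed.

End unit_interval.

Section gluing.
Variables (R : realType) (D X : topologicalType).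
Implicit Types (u : D -> R) (f g : D -> X).

Lemma pair_continuous (Y : topologicalType) (f : D -> X) (g : D -> Y) :
  continuous f -> continuous g -> continuous (fun d => (f d, g d)).
Proof. by move=> cf cg d; apply: cvg_pair; [exact: cf|exact: cg]. Qed.

Lemma clamp_comp_continuous u : continuous u -> continuous (fun d => clamp (u d)).
Proof.
move=> cu d; apply: (@continuous_comp _ _ _ u (@clamp R)); first exact: cu.
exact: clamp_continuous.
Qed.

Lemma scale_continuous u (a : R) :
  continuous u -> continuous (fun d => a * u d).
Proof. by move=> cu d; apply: cvgM; [exact: cvg_cst|exact: cu]. Qed.

Lemma shift_continuous u (a : R) :
  continuous u -> continuous (fun d => u d - a).
Proof. by move=> cu d; apply: cvgB; [exact: cu|exact: cvg_cst]. Qed.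

Lemma flip_continuous u (a : R) :
  continuous u -> continuous (fun d => a - u d).
Proof. by move=> cu d; apply: cvgB; [exact: cvg_cst|exact: cu]. Qed.

Lemma glue_continuous u (c : R) f g :
  continuous u -> continuous f -> continuous g ->
  (forall d, u d = c -> f d = g d) ->
  continuous (fun d => if u d <= c then f d else g d).
Proof.
move=> cu cf cg fg d A /=.
case: (ltgtP (u d) c) => [udc|udc|udc] nA.
- have : \forall e \near d, u e < c by exact: (cvgr_lt (u d) (cu d)).
  have : \forall e \near d, A (f e) by apply: cf.
  by apply: filterS2 => e Afe /ltW /= ->.
- have : \forall e \near d, c < u e by exact: (cvgr_gt (u d) (cu d)).
  have : \forall e \near d, A (g e) by apply: cg.
  by apply: filterS2 => e Afe /=; rewrite leNgt => ->.
- have : \forall e \near d, A (f e) by apply: cf.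
  have : \forall e \near d, A (g e) by apply: cg; rewrite -fg.
  by apply: filterS2 => e Age Afe; rewrite /=; case: ifP.
Qed.

End gluing.

Section homotopy.
Variables (R : realType) (X : topologicalType).
Local Notation I := (unit_itv R).

Definition homotopic (x y : X) (p q : {path I from x to y}) : Prop :=
  exists H : I * I -> X,
    [/\ continuous H,
        forall t, H (t, zero) = p t,
        forall t, H (t, one) = q t,
        forall s, H (zero, s) = x &
        forall s, H (one, s) = y].

Section equivalence.
Variables x y : X.
Implicit Types p q r : {path I from x to y}.

Lemma homotopic_refl p : homotopic p p.
Proof.
exists (fun d => p d.1); split => //= [|s|s].
- by move=> d; apply: continuous_comp; [exact: cvg_fst|exact: cts_fun].
- exact: path_zero.
- exact: path_one.
Qed.

Lemma homotopic_sym p q : homotopic p q -> homotopic q p.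
Proof.
move=> [H [cH H0 H1 Hx Hy]].
exists (fun d => H (d.1, clamp (1 - set_val d.2))); split => //= [|t|t].
- move=> d; apply: continuous_comp; last exact: cH.
  apply: pair_continuous; first by move=> ?; exact: cvg_fst.
  apply: clamp_comp_continuous => e; apply: cvgB; first exact: cvg_cst.
  by apply: continuous_comp; [exact: cvg_snd|exact: set_val_continuous].
- by rewrite clampE ?lexx ?ler01 // subr0 -/one H1.
- by rewrite clampE ?lexx ?ler01 // subrr -/zero H0.
Qed.

Lemma homotopic_trans p q r : homotopic p q -> homotopic q r -> homotopic p r.
Proof.
move=> [H [cH H0 H1 Hx Hy]] [K [cK K0 K1 Kx Ky]].
have c2 : continuous (fun d : I * I => set_val d.2).
  by move=> d; apply: continuous_comp; [exact: cvg_snd|exact: set_val_continuous].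
exists (fun d => if set_val d.2 <= 2^-1 then H (d.1, clamp (2 * set_val d.2))
  else K (d.1, clamp (2 * set_val d.2 - 1))); split => //= [|t|t|s|s].
- apply: glue_continuous => //=.
  + move=> d; apply: continuous_comp; last exact: cH.
    apply: pair_continuous; first by move=> ?; exact: cvg_fst.
    apply: clamp_comp_continuous => e; apply: cvgM; first exact: cvg_cst.
    exact: c2.
  + move=> d; apply: continuous_comp; last exact: cK.
    apply: pair_continuous; first by move=> ?; exact: cvg_fst.
    apply: clamp_comp_continuous => e; apply: cvgB; last exact: cvg_cst.
    by apply: cvgM; first exact: cvg_cst; exact: c2.
  + move=> d ->; rewrite divff ?pnatr_eq0 // subrr -/zero -/one.
    by rewrite H1 -K0.
- rewrite clampE ?lexx ?ler01 // invr_ge0 ler0n mulr0 -/zero; exact: H0.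
- rewrite clampE ?lexx ?ler01 // mulr1.
  rewrite ifN; last by rewrite -ltNge invf_lt1 ?ltr1n.
  by rewrite (_ : 2 - 1 = 1) ?K1 //; ring.
- by case: ifP.
- by case: ifP.
Qed.

Definition homotopicb p q := `[< homotopic p q >].

Fact homotopicb_refl : reflexive homotopicb.
Proof. by move=> p; apply/asboolP; exact: homotopic_refl. Qed.

Fact homotopicb_sym : symmetric homotopicb.
Proof. by move=> p q; apply/asbool_equiv_eq; split; exact: homotopic_sym. Qed.

Fact homotopicb_trans : transitive homotopicb.
Proof.
move=> q p r /asboolP pq /asboolP qr.
by apply/asboolP; exact: homotopic_trans qr.
Qed.

Canonical homotopic_equiv :=
  EquivRel homotopicb homotopicb_refl homotopicb_sym homotopicb_trans.

End equivalence.

Lemma path_comp_continuous (D : topologicalType) (x y : X)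
    (p : {path I from x to y}) (h : D -> I) :
  continuous h -> continuous (fun d => p (h d)).
Proof.
move=> ch d; apply: (@continuous_comp _ _ _ h p); first exact: ch.
exact: cts_fun.
Qed.

Lemma homotopic_reparam (x y : X) (p q r : {path I from x to y})
    (phi psi : R -> R) : continuous phi -> continuous psi ->
  phi 0 <= 0 -> psi 0 <= 0 -> 1 <= phi 1 -> 1 <= psi 1 ->
  (forall t, q t = p (clamp (phi (set_val t)))) ->
  (forall t, r t = p (clamp (psi (set_val t)))) ->
  homotopic q r.
Proof.
move=> cphi cpsi phi0 psi0 phi1 psi1 qE rE.
have c1 : continuous (fun d : I * I => set_val d.1).
  by move=> d; apply: continuous_comp; [exact: cvg_fst|exact: set_val_continuous].
have c2 : continuous (fun d : I * I => set_val d.2).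
  by move=> d; apply: continuous_comp; [exact: cvg_snd|exact: set_val_continuous].
exists (fun d => p (clamp ((1 - set_val d.2) * phi (set_val d.1) +
                          set_val d.2 * psi (set_val d.1)))).
split => /= [|t|t|s|s].
- apply/path_comp_continuous/clamp_comp_continuous => e; apply: cvgD; apply: cvgM.
  + by apply: cvgB; [exact: cvg_cst|exact: c2].
  + apply: (@continuous_comp _ _ _ (fun d : I * I => set_val d.1) phi).
      exact: c1.
    exact: cphi.
  + exact: c2.
  + apply: (@continuous_comp _ _ _ (fun d : I * I => set_val d.1) psi).
      exact: c1.
    exact: cpsi.
- by rewrite clampE ?lexx ?ler01 // subr0 mul1r mul0r addr0 qE.
- by rewrite clampE ?lexx ?ler01 // subrr mul0r mul1r add0r rE.
- rewrite clampE ?lexx ?ler01 // clamp_le0 ?path_zero //.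
  by have /andP[? ?] := itvP s; nra.
- rewrite clampE ?lexx ?ler01 // clamp_ge1 ?path_one //.
  by have /andP[? ?] := itvP s; nra.
Qed.

Section operations.
Variables x y z : X.

Section concatenation.
Variables (p : {path I from x to y}) (q : {path I from y to z}).

Definition concat_fun (t : I) : X :=
  if set_val t <= 2^-1 then p (clamp (2 * set_val t))
  else q (clamp (2 * set_val t - 1)).

Fact concat_continuous : continuous concat_fun.
Proof.
have c2 : continuous (fun t : I => 2 * set_val t : R).
  exact/scale_continuous/set_val_continuous.
apply: glue_continuous.
- exact: set_val_continuous.
- exact/path_comp_continuous/clamp_comp_continuous.
- exact/path_comp_continuous/clamp_comp_continuous/shift_continuous.
- move=> t ->; rewrite divff ?pnatr_eq0 // subrr -/zero -/one.
  by rewrite path_zero path_one.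
Qed.

Fact concat_zero : concat_fun zero = x.
Proof.
rewrite /concat_fun clampE ?lexx ?ler01 // invr_ge0 ler0n mulr0 -/zero.
exact: path_zero.
Qed.

Fact concat_one : concat_fun one = z.
Proof.
rewrite /concat_fun clampE ?lexx ?ler01 // mulr1.
rewrite ifN; last by rewrite -ltNge invf_lt1 ?ltr1n.
by rewrite (_ : 2 - 1 = 1) ?path_one //; ring.
Qed.

Definition concat : {path I from x to z} :=
  mk_path concat_continuous concat_zero concat_one.

End concatenation.

Section reversal.
Variable p : {path I from x to y}.

Definition reverse_fun (t : I) : X := p (clamp (1 - set_val t)).

Fact reverse_continuous : continuous reverse_fun.
Proof.
apply/path_comp_continuous/clamp_comp_continuous/flip_continuous.
exact: set_val_continuous.
Qed.

Fact reverse_zero : reverse_fun zero = y.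
Proof.
by rewrite /reverse_fun clampE ?lexx ?ler01 // subr0 -/one path_one.
Qed.

Fact reverse_one : reverse_fun one = x.
Proof.
by rewrite /reverse_fun clampE ?lexx ?ler01 // subrr -/zero path_zero.
Qed.

Definition reverse : {path I from y to x} :=
  mk_path reverse_continuous reverse_zero reverse_one.

End reversal.
End operations.

Lemma concat_homotopic (x y z : X) (p p' : {path I from x to y})
    (q q' : {path I from y to z}) :
  homotopic p p' -> homotopic q q' -> homotopic (concat p q) (concat p' q').
Proof.
move=> [H [cH H0 H1 Hx Hy]] [K [cK K0 K1 Kx Ky]].
have c1 : continuous (fun d : I * I => set_val d.1).
  by move=> d; apply: continuous_comp; [exact: cvg_fst|exact: set_val_continuous].
exists (fun d => if set_val d.1 <= 2^-1 then H (clamp (2 * set_val d.1), d.2)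
  else K (clamp (2 * set_val d.1 - 1), d.2)); split => //= [|t|t|s|s].
- apply: glue_continuous => //=.
  + move=> d; apply: continuous_comp; last exact: cH.
    apply: pair_continuous; last by move=> ?; exact: cvg_snd.
    apply: clamp_comp_continuous => e; apply: cvgM; first exact: cvg_cst.
    exact: c1.
  + move=> d; apply: continuous_comp; last exact: cK.
    apply: pair_continuous; last by move=> ?; exact: cvg_snd.
    apply: clamp_comp_continuous => e; apply: cvgB; last exact: cvg_cst.
    by apply: cvgM; first exact: cvg_cst; exact: c1.
  + move=> d ->; rewrite divff ?pnatr_eq0 // subrr -/zero -/one.
    by rewrite Hy Kx.
- by rewrite H0 K0.
- by rewrite H1 K1.
- rewrite clampE ?lexx ?ler01 // invr_ge0 ler0n mulr0 -/zero; exact: Hx.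
- rewrite clampE ?lexx ?ler01 // mulr1.
  rewrite ifN; last by rewrite -ltNge invf_lt1 ?ltr1n.
  by rewrite (_ : 2 - 1 = 1) -/one ?Ky //; ring.
Qed.

Lemma reverse_homotopic (x y : X) (p p' : {path I from x to y}) :
  homotopic p p' -> homotopic (reverse p) (reverse p').
Proof.
move=> [H [cH H0 H1 Hx Hy]].
exists (fun d => H (clamp (1 - set_val d.1), d.2)); split => //= [|t|t|s|s].
- move=> d; apply: continuous_comp; last exact: cH.
  apply: pair_continuous; last by move=> ?; exact: cvg_snd.
  apply: clamp_comp_continuous => e; apply: cvgB; first exact: cvg_cst.
  by apply: continuous_comp; [exact: cvg_fst|exact: set_val_continuous].
- exact: H0.
- exact: H1.
- by rewrite clampE ?lexx ?ler01 // subr0 -/one Hy.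
- by rewrite clampE ?lexx ?ler01 // subrr -/zero Hx.
Qed.

End homotopy.

Section fundamental_group.
Variables (R : realType) (X : topologicalType).
Local Notation I := (unit_itv R).

Definition const_path (x : X) : {path I from x to x} := cst x.

Lemma concatE (x y z : X) (p : {path I from x to y}) (q : {path I from y to z})
    (s : R) : 0 <= s <= 1 ->
  concat p q (clamp s) =
    if s <= 2^-1 then p (clamp (2 * s)) else q (clamp (2 * s - 1)).
Proof. by move=> s01; rewrite /= /mk_path /concat_fun clampE. Qed.

Lemma concatA_homotopic (w x y z : X) (p : {path I from w to x})
    (q : {path I from x to y}) (r : {path I from y to z}) :
  homotopic (concat p (concat q r)) (concat (concat p q) r).
Proof.
pose phi (t : R) : R := Num.min (2 * t) (Num.min (t - - 4^-1) (2^-1 * t - - 2^-1)).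
have cid : continuous (fun t : R => t) by move=> t; exact: cvg_id.
have cphi : continuous phi.
  move=> t; apply: continuous_min; first exact: scale_continuous.
  apply: continuous_min; first exact: shift_continuous.
  by apply: shift_continuous; exact: scale_continuous.
apply: (@homotopic_reparam _ _ _ _ (concat p (concat q r)) _ _ id phi) => //.
- by rewrite /phi; rewrite ge_min mulr0 lexx.
- by rewrite /phi !le_min; repeat (apply/andP; split); lra.
- by move=> t; rewrite clampK.
move=> t; rewrite -[t in LHS]clampK; have := itvP t.
move: (set_val t) => {}t /andP[t0 t1].
rewrite concatE ?t0 //.
case: (leP t 2^-1) => t2; last first.
  have -> : phi t = 2^-1 * t - - 2^-1.
    rewrite /phi !minElt; case: (ltP (t - - 4^-1)) => ?; case: ltP => ?; lra.
  rewrite concatE; last by apply/andP; split; lra.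
  rewrite ifN; last by rewrite -ltNge; lra.
  rewrite concatE; last by apply/andP; split; lra.
  rewrite ifN; last by rewrite -ltNge; lra.
  by congr (r (clamp _)); lra.
rewrite concatE; last by apply/andP; split; lra.
case: (leP (2 * t) 2^-1) => t4.
  have -> : phi t = 2 * t.
    rewrite /phi !minElt; case: (ltP (t - - 4^-1)) => ?; case: ltP => ?; lra.
  rewrite concatE ?ifT //; last by apply/andP; split; lra.
have -> : phi t = t - - 4^-1.
  rewrite /phi !minElt; case: (ltP (t - - 4^-1)) => ?; case: ltP => ?; lra.
rewrite concatE; last by apply/andP; split; lra.
rewrite ifN; last by rewrite -ltNge; lra.
rewrite concatE; last by apply/andP; split; lra.
rewrite ifT; last by lra.
by congr (q (clamp _)); lra.
Qed.

Lemma concat1p_homotopic (x y : X) (p : {path I from x to y}) :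
  homotopic (concat (const_path x) p) p.
Proof.
have cid : continuous (fun t : R => t) by move=> t; exact: cvg_id.
apply: (@homotopic_reparam _ _ _ _ p _ _ (fun t => 2 * t - 1) id) => //; try lra.
- by apply: shift_continuous; exact: scale_continuous.
- move=> t; rewrite -[t in LHS]clampK concatE ?itvP //.
  by case: ifP => // t2; rewrite (@clamp_le0 _ (_ - 1)) ?path_zero //; lra.
- by move=> t; rewrite clampK.
Qed.

Lemma concatp1_homotopic (x y : X) (p : {path I from x to y}) :
  homotopic (concat p (const_path y)) p.
Proof.
have cid : continuous (fun t : R => t) by move=> t; exact: cvg_id.
apply: (@homotopic_reparam _ _ _ _ p _ _ (fun t => 2 * t) id) => //; try lra.
- exact: scale_continuous.
- move=> t; rewrite -[t in LHS]clampK concatE ?itvP //.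
  by case: leP => // t2; rewrite [in RHS]clamp_ge1 ?path_one //; lra.
- by move=> t; rewrite clampK.
Qed.

Lemma concatVp_homotopic (x y : X) (p : {path I from x to y}) :
  homotopic (concat (reverse p) p) (const_path y).
Proof.
exists (fun d => p (clamp (set_val d.2 + `|1 - 2 * set_val d.1|))).
have c1 : continuous (fun d : I * I => set_val d.1).
  by move=> d; apply: continuous_comp; [exact: cvg_fst|exact: set_val_continuous].
have c2 : continuous (fun d : I * I => set_val d.2).
  by move=> d; apply: continuous_comp; [exact: cvg_snd|exact: set_val_continuous].
split => /= [|t|t|s|s].
- apply/path_comp_continuous/clamp_comp_continuous => d.
  apply: cvgD; first exact: c2.
  have c12 : continuous (fun d : I * I => 1 - 2 * set_val d.1 : R).
    exact/flip_continuous/scale_continuous.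
  by apply: cvg_norm; exact: c12.
- rewrite clampE ?lexx ?ler01 // add0r.
  rewrite -[t in RHS]clampK; have := itvP t.
  move: (set_val t) => {}t /andP[t0 t1].
  rewrite -/(concat _ _) concatE ?t0 //; case: leP => t2.
    rewrite /= /mk_path /reverse_fun clampE; last by apply/andP; split; lra.
    by rewrite ger0_norm //; lra.
  by rewrite ler0_norm ?opprB //; lra.
- rewrite clampE ?lexx ?ler01 // clamp_ge1 ?path_one //.
  by have := normr_ge0 (1 - 2 * set_val t); lra.
- rewrite clampE ?lexx ?ler01 // mulr0 subr0 normr1 clamp_ge1 ?path_one //.
  by have /andP[? ?] := itvP s; lra.
- rewrite clampE ?lexx ?ler01 // mulr1 clamp_ge1 ?path_one //.
  by rewrite ler0_norm; have /andP[? ?] := itvP s; lra.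
Qed.

Lemma reverseK (x y : X) (p : {path I from x to y}) : reverse (reverse p) = p.
Proof.
apply/path_eqP => t; rewrite /= /mk_path /reverse_fun /= /mk_path /reverse_fun.
have /andP[t0 t1] := itvP t.
rewrite clampE; last by apply/andP; split; lra.
by rewrite (_ : 1 - (1 - set_val t) = set_val t) ?clampK //; lra.
Qed.

Variable x : X.

(* The product of two classes is the class of the concatenation that runs
   through the left factor first. *)
Definition pi1 : Type := {eq_quot (@homotopic_equiv R X x x)}.

HB.instance Definition _ := Choice.on pi1.
HB.instance Definition _ := Quotient.on pi1.

Implicit Types p q : {path I from x to x}.

Lemma pi1_eqP p q : \pi_pi1 p = \pi_pi1 q <-> homotopic p q.
Proof. by split => [/eqmodP/asboolP //|pq]; apply/eqmodP/asboolP. Qed.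

Definition pi1_one : pi1 := \pi_pi1 (const_path x).
Definition pi1_mul (a b : pi1) : pi1 := \pi_pi1 (concat (repr a) (repr b)).
Definition pi1_inv (a : pi1) : pi1 := \pi_pi1 (reverse (repr a)).

Lemma repr_homotopic p : homotopic (repr (\pi_pi1 p)) p.
Proof. by apply/pi1_eqP; rewrite reprK. Qed.

Lemma pi1_mulE p q : pi1_mul (\pi_pi1 p) (\pi_pi1 q) = \pi_pi1 (concat p q).
Proof. by apply/pi1_eqP; apply: concat_homotopic; exact: repr_homotopic. Qed.

Lemma pi1_invE p : pi1_inv (\pi_pi1 p) = \pi_pi1 (reverse p).
Proof. by apply/pi1_eqP; apply: reverse_homotopic; exact: repr_homotopic. Qed.

Fact pi1_mulA : associative pi1_mul.
Proof.
elim/quotP => p _; elim/quotP => q _; elim/quotP => r _.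
rewrite (pi1_mulE q r) (pi1_mulE p q) !pi1_mulE; apply/pi1_eqP.
exact: concatA_homotopic.
Qed.

Fact pi1_mul1g : left_id pi1_one pi1_mul.
Proof.
by elim/quotP => p _; rewrite pi1_mulE; apply/pi1_eqP; exact: concat1p_homotopic.
Qed.

Fact pi1_mulg1 : right_id pi1_one pi1_mul.
Proof.
by elim/quotP => p _; rewrite pi1_mulE; apply/pi1_eqP; exact: concatp1_homotopic.
Qed.

Fact pi1_mulVg : left_inverse pi1_one pi1_inv pi1_mul.
Proof.
elim/quotP => p _; rewrite pi1_invE pi1_mulE.
apply/pi1_eqP; exact: concatVp_homotopic.
Qed.

Fact pi1_mulgV : right_inverse pi1_one pi1_inv pi1_mul.
Proof.
elim/quotP => p _; rewrite pi1_invE pi1_mulE -[p in concat p _]reverseK.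
apply/pi1_eqP; exact: concatVp_homotopic.
Qed.

HB.instance Definition _ := isGroup.Build pi1
  pi1_mulA pi1_mul1g pi1_mulg1 pi1_mulVg pi1_mulgV.

End fundamental_group.

Section configuration_spaces.
Variables (m : nat) (M : topologicalType).

Definition conf : Type := set_type [set y : {ptws 'I_m -> M} | injective y].

HB.instance Definition _ := Topological.on conf.

Implicit Types y z : conf.

Definition conf_rel y z : bool :=
  `[< exists s : 'S_m, forall i, set_val z i = set_val y (s i) >].

Fact conf_rel_refl : reflexive conf_rel.
Proof. by move=> y; apply/asboolP; exists 1%g => i; rewrite perm1. Qed.

Fact conf_rel_sym : symmetric conf_rel.
Proof.
move=> y z; apply/asbool_equiv_eq; split=> -[s yz];
by exists s^-1%g => i; rewrite yz permKV.
Qed.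

Fact conf_rel_trans : transitive conf_rel.
Proof.
move=> z y w /asboolP[s yz] /asboolP[t zw]; apply/asboolP.
by exists (t * s)%g => i; rewrite zw yz permM.
Qed.

Canonical conf_equiv :=
  EquivRel conf_rel conf_rel_refl conf_rel_sym conf_rel_trans.

Definition uconf : Type := {eq_quot conf_equiv}.

HB.instance Definition _ :=
  Topological.copy uconf (quotient_topology {eq_quot conf_equiv}).
HB.instance Definition _ := Quotient.on uconf.

Lemma pi_uconf_continuous : continuous (\pi_uconf : conf -> uconf).
Proof. exact: pi_continuous. Qed.

Lemma conf_continuous (D : topologicalType) (f : D -> conf) :
  (forall i, continuous (fun d => set_val (f d) i)) -> continuous f.
Proof.
move=> cf; apply: continuous_comp_initial => d; apply/cvg_sup => i.
exact: (@continuous_comp_initial {ptws 'I_m -> M} D M (fun g => g i)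
  (fun d => set_val (f d)) (cf i)).
Qed.

End configuration_spaces.

(* [braid_group R y] is pi_1(F_m(M)/S_m) based at the orbit of the
   configuration [y]; [R] is the field containing the parameter interval. *)
Notation braid_group R y := (pi1 R (\pi_(uconf _ _) y)).

Section groups.
Variable G : groupType.

Definition subgroup (H : set G) : Prop :=
  H 1%g /\ forall a b, H a -> H b -> H (a * b^-1)%g.

Definition Gamma2 : set G :=
  smallest subgroup [set c | exists a b : G, c = commg a b].

Definition expgz (a : G) (n : int) : G :=
  match n with Posz k => natexp a k | Negz k => (natexp a k.+1)^-1%g end.

(* [H] is free on the family [b]: the universal property, stated with maps
   defined on all of [G] of which only the restriction to [H] matters. *)
Definition free_basis (H : set G) (J : Type) (b : J -> G) : Prop :=
  [/\ subgroup H, forall j, H (b j) &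
  forall (K : groupType) (f : J -> K),
  exists phi : G -> K,
    [/\ forall u v, H u -> H v -> phi (u * v)%g = (phi u * phi v)%g,
        forall j, phi (b j) = f j &
        forall psi : G -> K,
          (forall u v, H u -> H v -> psi (u * v)%g = (psi u * psi v)%g) ->
          (forall j, psi (b j) = f j) ->
          forall u, H u -> psi u = phi u]].

End groups.

Arguments Gamma2 : clear implicits.

Section sphere.
Variable R : realType.
Implicit Types (u v : 'rV[R]_3) (w : R * R).

Definition dot u v : R := \sum_i u 0 i * v 0 i.

Definition sphere2 : set 'rV[R]_3 := [set v | dot v v = 1].

Definition punctured_sphere (x1 x2 : 'rV[R]_3) : Type :=
  set_type (sphere2 `\` [set x1; x2]).

HB.instance Definition _ x1 x2 := Topological.on (punctured_sphere x1 x2).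

Definition orthonormal3 (e1 e2 e3 : 'rV[R]_3) : Prop :=
  [/\ dot e1 e1 = 1, dot e2 e2 = 1 & dot e3 e3 = 1] /\
  [/\ dot e1 e2 = 0, dot e1 e3 = 0 & dot e2 e3 = 0].

Lemma dotC u v : dot u v = dot v u.
Proof. by apply: eq_bigr => i _; rewrite mulrC. Qed.

Lemma dotDl u u' v : dot (u + u') v = dot u v + dot u' v.
Proof. by rewrite -big_split; apply: eq_bigr => i _; rewrite mxE mulrDl. Qed.

Lemma dotZl a u v : dot (a *: u) v = a * dot u v.
Proof. by rewrite mulr_sumr; apply: eq_bigr => i _; rewrite mxE mulrA. Qed.

Section chart.
Variables x1 x2 e1 e2 : 'rV[R]_3.

(* Stereographic projection of the sphere from [x1] onto the plane spanned by
   [e1] and [e2]; it sends [x1] to infinity. *)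
Definition stereo v : R * R :=
  (dot v e1 / (1 - dot v x1), dot v e2 / (1 - dot v x1)).

Definition stereo_inv w : 'rV[R]_3 :=
  (w.1 ^+ 2 + w.2 ^+ 2 + 1)^-1 *:
    ((2 * w.1) *: e1 + (2 * w.2) *: e2 + (w.1 ^+ 2 + w.2 ^+ 2 - 1) *: x1).

Hypothesis on : orthonormal3 e1 e2 x1.

Let nrm_gt0 w : 0 < w.1 ^+ 2 + w.2 ^+ 2 + 1.
Proof. by rewrite ltr_wpDl // addr_ge0 // sqr_ge0. Qed.

Lemma stereo_invE w :
  let n := w.1 ^+ 2 + w.2 ^+ 2 + 1 in
  [/\ dot (stereo_inv w) e1 = 2 * w.1 / n,
      dot (stereo_inv w) e2 = 2 * w.2 / n &
      dot (stereo_inv w) x1 = (n - 2) / n].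
Proof.
case: on => -[e11 e22 x11] [e12 e1x e2x] n.
rewrite /stereo_inv !(dotZl, dotDl) -/n e11 e22 x11 e12 e1x e2x.
rewrite (dotC e2 e1) e12 (dotC x1) e1x (dotC x1) e2x.
by split; rewrite /n; field; rewrite -/n; apply: lt0r_neq0; exact: nrm_gt0.
Qed.

Lemma stereo_invK w : stereo (stereo_inv w) = w.
Proof.
rewrite /stereo; have [-> -> ->] := stereo_invE w.
have n0 := lt0r_neq0 (nrm_gt0 w).
have -> : forall n : R, n != 0 -> 1 - (n - 2) / n = 2 / n.
- by move=> n n0'; field.
- by case: w n0 => a b /= n0; congr pair; field.
- exact: n0.
Qed.

Lemma stereo_inv_sphere w : sphere2 (stereo_inv w).
Proof.
have [d1 d2 dx] := stereo_invE w.
have n0 := lt0r_neq0 (nrm_gt0 w).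
rewrite /sphere2/= {1}/stereo_inv !(dotZl, dotDl).
rewrite !(dotC _ (stereo_inv w)) d1 d2 dx.
by field.
Qed.

Lemma stereo_inv_neq1 w : stereo_inv w <> x1.
Proof.
move=> E; have [_ _] := stereo_invE w; rewrite E.
case: on => -[_ _ ->] _ /eqP.
have n0 := lt0r_neq0 (nrm_gt0 w).
by rewrite eq_sym -subr_eq0 -[X in _ - X](divff n0) -mulrBl mulf_eq0 invr_eq0
  (negbTE n0) orbF => /eqP; lra.
Qed.

Fact chart_subproof w : w <> 0 ->
  stereo_inv (stereo x2 + w) \in sphere2 `\` [set x1; x2].
Proof.
move=> w0; apply/mem_set; split; first exact: stereo_inv_sphere.
case=> [|E]; first exact: stereo_inv_neq1.
apply: w0; apply: (@addrI _ (stereo x2)); rewrite addr0.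
by rewrite -[LHS]stereo_invK E.
Qed.

(* Identifies the plane minus the origin with the sphere minus [x1] and [x2]:
   the origin corresponds to [x2] and infinity to [x1]. *)
Definition chart w (w0 : w <> 0) : punctured_sphere x1 x2 :=
  exist (fun v => v \in sphere2 `\` [set x1; x2]) _ (chart_subproof w0).

Lemma chart_inj w w' (w0 : w <> 0) (w0' : w' <> 0) :
  chart w0 = chart w0' -> w = w'.
Proof.
move=> /(congr1 (fun v : punctured_sphere x1 x2 => stereo (set_val v))).
by rewrite !set_valE /= !stereo_invK => /addrI.
Qed.

End chart.

Lemma stereo_inv_continuous x1 e1 e2 (D : topologicalType) (f g : D -> R) :
  continuous f -> continuous g ->
  continuous (fun d => stereo_inv x1 e1 e2 (f d, g d)).
Proof.
move=> cf cg d; rewrite /stereo_inv /=.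
have cn : {for d, continuous (fun d => f d ^+ 2 + g d ^+ 2)}.
  by apply: cvgD; apply: cvgM; (exact: cf || exact: cg).
apply: cvgZ.
  apply: cvgV.
    by rewrite lt0r_neq0 // ltr_wpDl // addr_ge0 // sqr_ge0.
  by apply: cvgD; [exact: cn|exact: cvg_cst].
apply: cvgD; first apply: cvgD.
- by apply: cvgZl; apply: cvgM; [exact: cvg_cst|exact: cf].
- by apply: cvgZl; apply: cvgM; [exact: cvg_cst|exact: cg].
- by apply: cvgZl; apply: cvgB; [exact: cn|exact: cvg_cst].
Qed.

End sphere.

Section braids.
Variables (R : realType) (x1 x2 e1 e2 : 'rV[R]_3).
Hypothesis on : orthonormal3 e1 e2 x1.
Local Notation I := (unit_itv R).
Local Notation M := (punctured_sphere x1 x2).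

Section chart_configurations.
Variables (m : nat) (w : 'I_m -> R * R).
Hypotheses (w0 : forall k, w k <> 0) (w_inj : injective w).

Fact chart_conf_subproof :
  (fun k => chart x2 on (@w0 k)) \in [set y : {ptws 'I_m -> M} | injective y].
Proof. by apply/mem_set => k l /chart_inj /w_inj. Qed.

Definition chart_conf : conf m M :=
  exist (fun y => y \in [set y : {ptws 'I_m -> M} | injective y])
    _ chart_conf_subproof.

End chart_configurations.

Lemma chart_conf_eq m (w w' : 'I_m -> R * R) w0 w0' w_inj w_inj' :
  w =1 w' -> @chart_conf m w w0 w_inj = @chart_conf m w' w0' w_inj'.
Proof.
move=> ww'; apply: val_inj; apply/funext => k; apply: val_inj => /=.
by rewrite ww'.
Qed.

Lemma chart_conf_continuous m (w : R -> 'I_m -> R * R) w0 w_inj :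
  (forall k, continuous (fun t => (w t k).1)) ->
  (forall k, continuous (fun t => (w t k).2)) ->
  continuous (fun t => @chart_conf m (w t) (@w0 t) (@w_inj t)).
Proof.
move=> c1 c2; apply: conf_continuous => k; apply: continuous_comp_initial.
pose p := stereo x1 e1 e2 x2.
have -> : set_val \o (fun t => set_val (chart_conf (@w0 t) (@w_inj t)) k) =
    fun t => stereo_inv x1 e1 e2 (p.1 + (w t k).1, p.2 + (w t k).2) by [].
by apply: stereo_inv_continuous => t; apply: cvgD;
  [exact: cvg_cst|exact: c1|exact: cvg_cst|exact: c2].
Qed.

(* The two base points, in the coordinates of [chart]. *)
Definition base_pt (k : 'I_2) : R * R := (2, if k == 0 then - 1 else 1).

(* The point at angle [a], starting from [w], on the circle of centre w / 4
   and radius (3 / 4)|w|. When [w] is one of the base points, this circle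
   encloses the origin but not the other base point. *)
Definition circle (w : R * R) (a : R) : R * R :=
  ((w.1 + 3 * (cos a * w.1 - sin a * w.2)) / 4,
   (w.2 + 3 * (sin a * w.1 + cos a * w.2)) / 4).

Definition strands (j : 'I_2) (t : R) (k : 'I_2) : R * R :=
  if k == j then circle (base_pt j) (pi *+ 2 * t) else base_pt k.

Lemma base_pt_neq0 k : base_pt k <> 0.
Proof. by move=> /(congr1 fst) /eqP; rewrite pnatr_eq0. Qed.

Lemma base_pt_inj : injective base_pt.
Proof.
move=> [[|[|//]] ki] [[|[|//]] li] /(congr1 snd) /= kl; apply: val_inj => //=;
  by exfalso; lra.
Qed.

Let cs1 (a : R) : cos a ^+ 2 + sin a ^+ 2 = 1.
Proof. exact: cos2Dsin2. Qed.

Lemma strands_neq0 j t k : strands j t k <> 0.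
Proof.
rewrite /strands; case: eqP => _; last exact: base_pt_neq0.
rewrite /circle /base_pt /=; have := cs1 (pi *+ 2 * t).
move: (cos _) (sin _) => c s cs E.
move: (congr1 fst E) (congr1 snd E) => /=.
by case: ifP => _ h1 h2; nra.
Qed.

Lemma strands_inj j t : injective (strands j t).
Proof.
have H : forall k, k != j -> circle (base_pt j) (pi *+ 2 * t) <> base_pt k.
  move: j => [[|[|//]] ji] [[|[|//]] ki] //= _;
  rewrite /circle /base_pt /=; have := cs1 (pi *+ 2 * t);
  by move: (cos _) (sin _) => c s cs E;
  move: (congr1 fst E) (congr1 snd E) => /= h1 h2; nra.
move=> k l; rewrite /strands; case: eqP => [->|/eqP kj]; case: eqP => [->|/eqP lj] //.
- by move=> E; case: (H l).
- by move=> E; case: (H k).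
- exact: base_pt_inj.
Qed.

Lemma strands0 j : strands j 0 =1 base_pt.
Proof.
move=> k; rewrite /strands; case: eqP => [->|//].
rewrite mulr0 /circle cos0 sin0; case: (base_pt j) => a b /=.
by congr pair; field.
Qed.

Lemma strands1 j : strands j 1 =1 base_pt.
Proof.
move=> k; rewrite /strands; case: eqP => [->|//].
rewrite mulr1 /circle cos2pi sin2pi; case: (base_pt j) => a b /=.
by congr pair; field.
Qed.

Lemma strands_continuous j k :
  continuous (fun t => (strands j t k).1) /\
  continuous (fun t => (strands j t k).2).
Proof.
have ca : continuous (fun t : R => pi *+ 2 * t).
  by apply: scale_continuous => t; exact: cvg_id.
have cc : continuous (fun t : R => cos (pi *+ 2 * t)).
  move=> t; apply: (@continuous_comp _ _ _ _ (@cos R)); first exact: ca.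
  exact: continuous_cos.
have cs : continuous (fun t : R => sin (pi *+ 2 * t)).
  move=> t; apply: (@continuous_comp _ _ _ _ (@sin R)); first exact: ca.
  exact: continuous_sin.
rewrite /strands; case: eqP => [_|_]; last by split=> t; exact: cvg_cst.
rewrite /circle /=; split=> t; apply: cvgM; try exact: cvg_cst.
- apply: cvgD; first exact: cvg_cst.
  apply: cvgM; first exact: cvg_cst.
  by apply: cvgB; apply: cvgM; try exact: cvg_cst; [exact: cc|exact: cs].
- apply: cvgD; first exact: cvg_cst.
  apply: cvgM; first exact: cvg_cst.
  by apply: cvgD; apply: cvgM; try exact: cvg_cst; [exact: cs|exact: cc].
Qed.

Definition base_conf : conf 2 M := chart_conf (@base_pt_neq0) base_pt_inj.

Section gamma.
Variable j : 'I_2.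

Definition gamma_fun (t : I) : uconf 2 M :=
  \pi_(uconf 2 M)
    (chart_conf (@strands_neq0 j (set_val t)) (@strands_inj j (set_val t))).

Fact gamma_continuous : continuous gamma_fun.
Proof.
have cg : continuous (fun t : R =>
    chart_conf (@strands_neq0 j t) (@strands_inj j t)).
  apply: chart_conf_continuous => k; first by have [] := strands_continuous j k.
  by have [] := strands_continuous j k.
move=> t; rewrite /gamma_fun.
apply: (@continuous_comp _ _ _ (fun t : I => chart_conf
    (@strands_neq0 j (set_val t)) (@strands_inj j (set_val t)))
  (\pi_(uconf 2 M))).
  apply: (@continuous_comp _ _ _ set_val (fun t : R =>
    chart_conf (@strands_neq0 j t) (@strands_inj j t))).
    exact: set_val_continuous.
  exact: cg.
exact: pi_uconf_continuous.
Qed.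

Fact gamma_zero : gamma_fun zero = \pi_(uconf 2 M) base_conf.
Proof.
rewrite /gamma_fun; congr (\pi_(uconf 2 M) _); apply: chart_conf_eq.
by rewrite clampE ?lexx ?ler01 //; exact: strands0.
Qed.

Fact gamma_one : gamma_fun one = \pi_(uconf 2 M) base_conf.
Proof.
rewrite /gamma_fun; congr (\pi_(uconf 2 M) _); apply: chart_conf_eq.
by rewrite clampE ?lexx ?ler01 //; exact: strands1.
Qed.

(* The generator gamma_{2,j+1}: the string starting at the base point [j] runs
   once around [x2] and the other string is constant. If sigma is the half-twist
   in which the two strings turn counterclockwise (in the chart) by half a turn
   around the midpoint of the segment joining the base points, then
   sigma gamma_{2,1} sigma^-1 = gamma_{2,2}. *)
Definition gamma_x2 : braid_group R base_conf :=
  \pi_(braid_group R base_conf) (mk_path gamma_continuous gamma_zero gamma_one).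

End gamma.
End braids.

(* Main.v *)
From HB Require Import structures.
Require Import Defs.
From mathcomp Require Import all_boot all_order all_algebra all_fingroup.
From mathcomp Require Import generic_quotient.
From mathcomp Require Import all_classical all_reals all_analysis homotopy.
From mathcomp Require Import ring lra zify.
Import Order.TTheory GRing.Theory Num.Theory.
Import numFieldNormedType.Exports.
Import Defs.
Set Implicit Arguments.
Unset Strict Implicit.
Unset Printing Implicit Defensive.
Local Open Scope classical_set_scope.
Local Open Scope ring_scope.
Local Open Scope quotient_scope.

(** Record the configuration {a, b} by d = a - b and u = (a + b) / (a - b).
    This exhibits the configuration space of two points of C \ {0} as the
    quotient of C^* x (C \ {1, -1}) by (d, u) ~ (-d, -u). Since Gamma_2 is
    killed by the winding number of the discriminant d^2, its elements lift to
    loops along which d is null-homotopic, and Gamma_2 embeds into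
    pi_1(C \ {1, -1}). The loops u of gamma_{2,1} and gamma_{2,2} are simple
    loops around -1 and 1, i.e. a basis y, x of that free group. The winding
    number of the product ab also kills Gamma_2 and sends x and y, which are
    conjugate in the braid group, to the same nonzero number; so Gamma_2 is the
    kernel of the exponent sum, and the z_i = y^i x y^-(i+1) are its Schreier
    basis for the transversal of powers of y.

    Freeness is proved through monodromy. A family of maps c(p, q) of a set S,
    multiplicative for p, q close to each other, transports S along paths; the
    holonomy of a loop only depends on its homotopy class. For C \ {1, -1} the
    family records how the real axis is crossed. With S the group pi_1 itself
    this shows that x and y generate; with S = K x Z it realises any prescribed
    values of the z_i in a group K. The arguments of nonvanishing functions are
    transported in the same way, with S the real line. *)

(** On the quotient by the symmetric group the two points cannot be ordered continuously, so only
    symmetric functions are available: sum, product and discriminant. The difference d must be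
    recovered as a square root, by halving a continuous argument of the discriminant. Such an
    argument exists along maps from a square but not on the whole configuration space, hence all
    lifting is done over squares. Two winding numbers are needed because that of the discriminant
    vanishes on gamma_{2,1} and gamma_{2,2} themselves: its kernel is the image of pi_1(C \ {1,
    -1}), and the product then detects exponents inside that image. In S = K x Z the integer labels
    the coset of a power of y and the first factor accumulates the prescribed values; z_i preserves
    the slice over 0 and multiplies there by its value. Transport replaces covering spaces because S
    then needs no topology: one Lebesgue number argument over a square gives both path lifting and
    homotopy invariance. *)

Section real_continuity.
Variables (R : realType) (D : topologicalType).
Implicit Types u v : D -> R.

Lemma ctsC (k : R) : continuous (fun _ : D => k).
Proof. by move=> t; exact: cvg_cst. Qed.

Lemma ctsD u v : continuous u -> continuous v -> continuous (fun t => u t + v t).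
Proof. by move=> cu cv t; exact: (continuousD (cu t) (cv t)). Qed.

Lemma ctsN u : continuous u -> continuous (fun t => - u t).
Proof. by move=> cu t; exact: (continuousN (cu t)). Qed.

Lemma ctsM u v : continuous u -> continuous v -> continuous (fun t => u t * v t).
Proof. by move=> cu cv t; exact: (continuousM (cu t) (cv t)). Qed.

Lemma ctsV u : (forall t, u t != 0) -> continuous u ->
  continuous (fun t => (u t)^-1).
Proof. by move=> u0 cu t; exact: (@continuousV _ _ u t (u0 t) (cu t)). Qed.

Lemma cts_comp u (f : R -> R) : continuous u -> continuous f ->
  continuous (fun t => f (u t)).
Proof. by move=> cu f_ t; apply: (@continuous_comp _ _ _ u f); [exact: cu|exact: f_]. Qed.

End real_continuity.

Ltac cts := repeat match goal with
  | H : ?P |- ?P => exact H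
  | |- forall _, continuous_at _ (fun _ => ?k) => apply: ctsC
  | |- forall _, continuous_at _ (fun t => Algebra.add _ _) => apply: ctsD
  | |- forall _, continuous_at _ (fun t => Algebra.opp _) => apply: ctsN
  | |- forall _, continuous_at _ (fun t => GRing.mul _ _) => apply: ctsM
  | |- _ => first [assumption | apply: ctsD | apply: ctsN | apply: ctsM]
  end.

(** * Holonomy of local cocycles *)

Section unit_square.
Variable R : realType.
Implicit Types (s t : R) (d e : R * R).

(** Cutting [[0, t]] into [n] equal parts with [t / n < eps] reaches [t] in finitely many admissible
    steps. This takes the place of connectedness arguments. *)
Lemma unit_interval_ind (Q : R -> Prop) :
  (exists2 eps, 0 < eps & forall s t, 0 <= s <= 1 -> 0 <= t <= 1 ->
    `|s - t| < eps -> Q s -> Q t) ->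
  Q 0 -> forall t, 0 <= t <= 1 -> Q t.
Proof.
move=> [eps eps0 step] Q0 t /andP[t0 t1].
have [n n0 tn] : exists2 n, (0 < n)%N & t / n%:R < eps.
  exists (Num.truncn (t / eps)).+1 => //.
  rewrite ltr_pdivrMr ?ltr0n // mulrC -ltr_pdivrMr //.
  exact: truncnS_gt.
have nP : 0 < n%:R :> R by rewrite ltr0n.
have T k : (k <= n)%N -> 0 <= k%:R / n%:R * t <= 1.
  move=> kn; apply/andP; split; first by rewrite !mulr_ge0 // invr_ge0.
  rewrite mulr_ile1 // ?divr_ge0 // ler_pdivrMr // mul1r ler_nat //.
suff H k : (k <= n)%N -> Q (k%:R / n%:R * t).
  by have := H n (leqnn n); rewrite divff ?mul1r // lt0r_neq0.
elim: k => [_|k IH kn]; first by rewrite !mul0r.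
apply: (step _ _ (T _ (ltnW kn)) (T _ kn)); last exact: IH (ltnW kn).
rewrite -mulrBl -mulrBl -natr1 opprD addrA subrr sub0r mulN1r mulNr normrN.
by rewrite mulrC ger0_norm // divr_ge0 // ltW.
Qed.

Lemma set_val_zero : set_val (zero : unit_itv R) = 0 :> R.
Proof. by rewrite clampE ?lexx ?ler01. Qed.

Lemma set_val_one : set_val (one : unit_itv R) = 1 :> R.
Proof. by rewrite clampE ?lexx ?ler01. Qed.

Definition in_square d : bool := (0 <= d.1 <= 1) && (0 <= d.2 <= 1).

Definition sq_close (eps : R) d e : bool :=
  (`|d.1 - e.1| < eps) && (`|d.2 - e.2| < eps).

(** A Lebesgue number for the admissible sets selected by [V]: compactness is applied to the filter
    of small radii, and halving the radius leaves room for both the centre and the point. *)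
Lemma square_lebesgue (X : topologicalType) (f : R * R -> X)
    (V : set X -> Prop) : continuous f ->
  (forall x : X, exists2 N, V N & nbhs x (N : set X)) ->
  exists2 eps, 0 < eps & forall d, in_square d ->
    exists2 N, V N & forall e, sq_close eps d e -> N (f e).
Proof.
move=> cf loc.
have cK : compact ((`[0, 1]%classic : set R) `*` (`[0, 1]%classic : set R)).
  by apply: compact_setX; exact: segment_compact.
have [] := (compact_near_coveringP _).1 cK R (0^'+)
  (fun eps d => exists2 N, V N & forall e, sq_close eps d e -> N (f e)) _.
- move=> d _; have [N VN nN] := loc (f d).
  have /(nbhs_ballP d) [r /= r0 rN] := cf d N nN.
  exists (ball d (r / 2), [set eps | eps < r / 2]).
    split; first by apply: nbhsx_ballx; rewrite divr_gt0.
    by apply: nbhs_right_lt; rewrite divr_gt0.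
  move=> [d' eps] /= [[d1 d2] er]; exists N => // e /andP[e1 e2].
  apply: rN; split; rewrite /ball/=.
    by move: d1; rewrite /ball/= => d1; have := ler_distD d'.1 d.1 e.1; lra.
  by move: d2; rewrite /ball/= => d2; have := ler_distD d'.2 d.2 e.2; lra.
- move=> r /= r0 H.
  have r2 : 0 < r / 2 by rewrite divr_gt0.
  exists (r / 2) => // d /andP[d1 d2].
  apply: (H (r / 2)) => //=; first by rewrite /ball_/= sub0r normrN gtr0_norm //; lra.
Qed.

End unit_square.

Section transport.
Variables (R : realType) (X : topologicalType) (S : Type) (c : X -> X -> S -> S).

Definition cocycle_on (N : set X) : Prop := forall x y z s,
  N x -> N y -> N z -> c y z (c x y s) = c x z s.

Definition local_cocycle : Prop :=
  (forall x s, c x x s = s) /\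
  forall x : X, exists2 N, cocycle_on N & nbhs x (N : set X).

(** Plays the part of a lift of [p] to a covering with fibre [S]. Steps of uniform size replace
    continuity, so [S] carries no topology. *)
Definition parallel (p : R -> X) (h : R -> S) : Prop :=
  exists2 eps, 0 < eps & forall s t, 0 <= s <= 1 -> 0 <= t <= 1 ->
    `|s - t| < eps -> h t = c (p s) (p t) (h s).

Definition parallel2 (f : R * R -> X) (h : R * R -> S) : Prop :=
  exists2 eps, 0 < eps & forall d e, in_square d -> in_square e ->
    sq_close eps d e -> h e = c (f d) (f e) (h d).

Lemma parallel_unique p h h' : parallel p h -> parallel p h' ->
  h 0 = h' 0 -> forall t, 0 <= t <= 1 -> h t = h' t.
Proof.
move=> [e e0 H] [e' e0' H'] h0; apply: unit_interval_ind => //.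
exists (Num.min e e'); first by rewrite lt_min e0.
move=> s t s1 t1; rewrite lt_min => /andP[ste ste'] E.
by rewrite (H s) // (H' s) // E.
Qed.

Hypothesis cc : local_cocycle.

(* [h d] is obtained by multiplying the cocycle over a fine subdivision of the
   segment from the origin to [d]. *)
Lemma parallel2_exists (f : R * R -> X) (s0 : S) : continuous f ->
  exists2 h, parallel2 f h & h (0, 0) = s0.
Proof.
move=> cf; have [cxx loc] := cc.
have [eps eps0 L] := square_lebesgue cf loc.
have [n n0 en] : exists2 n, (0 < n)%N & n%:R^-1 < eps / 2.
  exists (Num.truncn (eps / 2)^-1).+1 => //.
  by rewrite invf_plt ?posrE ?ltr0n ?divr_gt0 // truncnS_gt.
have nP : 0 < n%:R :> R by rewrite ltr0n.
pose sc k (d : R * R) : R * R := (k%:R / n%:R * d.1, k%:R / n%:R * d.2).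
pose h := fix h k d := if k is k'.+1
  then c (f (sc k' d)) (f (sc k d)) (h k' d) else s0.
have sc01 k : (k <= n)%N -> 0 <= (k%:R / n%:R : R) <= 1.
  by move=> kn; rewrite divr_ge0 //= ler_pdivrMr // mul1r ler_nat.
have scsq k d : (k <= n)%N -> in_square d -> in_square (sc k d).
  move=> /sc01 + /andP[/andP[? ?] /andP[? ?]]; rewrite /in_square /=.
  move: (k%:R / n%:R : R) => l /andP[l0 l1].
  by apply/andP; split; apply/andP; split; nra.
have scS (k : nat) (x : R) : k.+1%:R / n%:R * x = k%:R / n%:R * x + n%:R^-1 * x.
  by rewrite -natr1 mulrDl mul1r mulrDl.
have close k (x y : R) : (k < n)%N -> 0 <= x <= 1 -> 0 <= y <= 1 ->
    `|x - y| < eps / 2 ->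
    [/\ `|k%:R / n%:R * x - k%:R / n%:R * x| < eps,
        `|k%:R / n%:R * x - k%:R / n%:R * y| < eps,
        `|k%:R / n%:R * x - k.+1%:R / n%:R * x| < eps &
        `|k%:R / n%:R * x - k.+1%:R / n%:R * y| < eps].
  move=> /ltnW /sc01; rewrite !scS; move: (k%:R / n%:R : R) => l.
  have ni : 0 < n%:R^-1 :> R by rewrite invr_gt0.
  move: (n%:R^-1 : R) ni en => m m0 me /andP[l0 l1] /andP[? ?] /andP[? ?].
  rewrite !ltr_norml => /andP[? ?]; have ? : 0 <= 1 - l by lra.
  by split; apply/andP; split; nra.
(* The four points at levels [k] and [k.+1] on the segments to [d] and [e] lie in one cocycle set,
   so going outward and then across agrees with going across and then outward. *)
have hP k d e : (k <= n)%N -> in_square d -> in_square e ->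
    sq_close (eps / 2) d e -> h k e = c (f (sc k d)) (f (sc k e)) (h k d).
  move=> + dS eS /andP[de1 de2]; elim: k => [|k IH] kn.
    by rewrite /= /sc !mul0r cxx.
  rewrite /= -/(h k) IH ?(ltnW kn) //.
  have [N NV HN] := L (sc k d) (scsq _ _ (ltnW kn) dS).
  have /andP[d1 d2] := dS; have /andP[e1 e2] := eS.
  have [? ? ? ?] := close k _ _ kn d1 e1 de1.
  have [? ? ? ?] := close k _ _ kn d2 e2 de2.
  have N1 : N (f (sc k d)) by apply: HN; apply/andP.
  have N2 : N (f (sc k e)) by apply: HN; apply/andP.
  have N3 : N (f (sc k.+1 d)) by apply: HN; apply/andP.
  have N4 : N (f (sc k.+1 e)) by apply: HN; apply/andP.
  by rewrite !NV.
exists (h n).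
  exists (eps / 2); first by rewrite divr_gt0.
  move=> d e dS eS de; rewrite (hP n d e) // /sc divff ?lt0r_neq0 // !mul1r.
  by case: d e {dS eS de} => [? ?] [? ?].
have h0 k : h k (0, 0) = s0.
  by elim: k => //= k IH; rewrite -/(h k) IH /sc !mulr0 cxx.
exact: h0.
Qed.

End transport.

Section holonomy.
Variables (R : realType) (X : topologicalType) (S : Type) (c : X -> X -> S -> S).
Hypothesis cc : local_cocycle c.
Local Notation I := (unit_itv R).

Lemma parallel_cst (x : X) (s : S) : @parallel R X S c (fun=> x) (fun=> s).
Proof. by have [cxx _] := cc; exists 1. Qed.

(** Inside one cocycle set the small steps telescope, so even a long piece of path acts as a single
    jump. *)
Lemma parallel_piece (p : R -> X) h (N : set X) a b : @parallel R X S c p h ->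
  cocycle_on c N -> 0 <= a -> a <= b -> b <= 1 ->
  (forall t, a <= t <= b -> N (p t)) -> h b = c (p a) (p b) (h a).
Proof.
move=> [eps eps0 H] cN a0 ab b1 Np; have [cxx _] := cc.
have T t : 0 <= t <= 1 -> a <= a + (b - a) * t <= b.
  by move=> /andP[? ?]; apply/andP; split; nra.
have T1 t : 0 <= t <= 1 -> 0 <= a + (b - a) * t <= 1.
  by move=> /T /andP[? ?]; apply/andP; split; lra.
suff : forall t, 0 <= t <= 1 ->
    h (a + (b - a) * t) = c (p a) (p (a + (b - a) * t)) (h a).
  by move/(_ 1); rewrite ler01 lexx mulr1 addrC subrK; exact.
apply: unit_interval_ind; last by rewrite mulr0 addr0 cxx.
exists eps => // s t s1 t1 st Qs.
rewrite (H (a + (b - a) * s)) ?T1 //; last first.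
  have ba : 0 <= b - a <= 1 by apply/andP; split; lra.
  have -> : a + (b - a) * s - (a + (b - a) * t) = (b - a) * (s - t) by ring.
  case/andP: ba => ba0 ba1; rewrite normrM ger0_norm //.
  by apply: le_lt_trans st; rewrite ler_piMl.
by rewrite Qs cN //; apply: Np; rewrite ?T ?lexx.
Qed.

Section path.
Variables x y : X.
Implicit Types p q : {path I from x to y}.

Definition transported p (s s' : S) : Prop :=
  exists h, [/\ parallel c (fun t => p (clamp t)) h, h 0 = s & h 1 = s'].

Lemma transported_exists p s : exists s', transported p s s'.
Proof.
have cf : continuous (fun d : R * R => p (clamp d.1)).
  by apply/path_comp_continuous/clamp_comp_continuous => d; exact: cvg_fst.
have [h [eps eps0 H] h0] := parallel2_exists cc s cf.
exists (h (1, 0)), (fun t => h (t, 0)); split => //.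
exists eps => // t t' t0 t1 tt; apply: (H (t, 0) (t', 0)).
- by rewrite /in_square /= t0 lexx ler01.
- by rewrite /in_square /= t1 lexx ler01.
- by rewrite /sq_close /= tt subrr normr0.
Qed.

Lemma transported_inj p s s1 s2 :
  transported p s s1 -> transported p s s2 -> s1 = s2.
Proof.
move=> [h [hp h0 <-]] [k [kp k0 <-]].
by apply: (parallel_unique hp kp); rewrite ?h0 ?k0 ?ler01 ?lexx.
Qed.

(** Transport over the whole square of the homotopy. Its two lateral sides are constant paths, along
    which nothing changes, so the bottom and the top end with the same value. *)
Lemma transported_homotopic p q s s' :
  homotopic p q -> transported p s s' -> transported q s s'.
Proof.
move=> [H [cH H0 H1 Hx Hy]] ps.
have cf : continuous (fun d : R * R => H (clamp d.1, clamp d.2)).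
  move=> d; apply: (@continuous_comp _ _ _
    (fun d : R * R => (clamp d.1, clamp d.2)) H); last exact: cH.
  apply: pair_continuous; apply: clamp_comp_continuous => e.
    exact: cvg_fst.
  exact: cvg_snd.
have [h [eps eps0 hP] h0] := parallel2_exists cc s cf.
have row u : 0 <= u <= 1 ->
    parallel c (fun t => H (clamp t, clamp u)) (fun t => h (t, u)).
  move=> u1; exists eps => // t t' t0 t1 tt; apply: (hP (t, u) (t', u)).
  - by rewrite /in_square /= t0.
  - by rewrite /in_square /= t1.
  - by rewrite /sq_close /= tt subrr normr0.
have col u : 0 <= u <= 1 ->
    parallel c (fun t => H (clamp u, clamp t)) (fun t => h (u, t)).
  move=> u1; exists eps => // t t' t0 t1 tt; apply: (hP (u, t) (u, t')).
  - by rewrite /in_square /= t0 u1.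
  - by rewrite /in_square /= t1 u1.
  - by rewrite /sq_close /= tt subrr normr0 eps0.
have E0 : (fun t => H (clamp 0, clamp t)) = fun=> x by apply/funext => t; exact: Hx.
have E1 : (fun t => H (clamp 1, clamp t)) = fun=> y by apply/funext => t; exact: Hy.
have F0 : (fun t => H (clamp t, clamp 0)) = fun t => p (clamp t).
  by apply/funext => t; exact: H0.
have F1 : (fun t => H (clamp t, clamp 1)) = fun t => q (clamp t).
  by apply/funext => t; exact: H1.
have I0 : 0 <= (0 : R) <= 1 by rewrite lexx ler01.
have I1 : 0 <= (1 : R) <= 1 by rewrite lexx ler01.
have h01 : h (0, 1) = s.
  have := col 0 I0; rewrite E0 => /parallel_unique /(_ (parallel_cst x s)).
  by move=> U; exact: (U h0 1 I1).
have h11 : h (1, 1) = h (1, 0).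
  have := col 1 I1; rewrite E1 => /parallel_unique.
  by move=> U; exact: (U _ (parallel_cst y (h (1, 0))) erefl 1 I1).
have -> : s' = h (1, 0).
  apply: (transported_inj ps); exists (fun t => h (t, 0)); split=> //.
  by rewrite -F0; exact: row.
exists (fun t => h (t, 1)); split=> //.
by rewrite -F1; exact: row.
Qed.

Definition hol p s : S := projT1 (cid (transported_exists p s)).

Lemma holP p s : transported p s (hol p s).
Proof. by rewrite /hol; case: cid. Qed.

Lemma hol_eq p s s' : transported p s s' -> hol p s = s'.
Proof. exact/transported_inj/holP. Qed.

Lemma hol_homotopic p q s : homotopic p q -> hol p s = hol q s.
Proof. by move=> pq; apply/esym/hol_eq/(transported_homotopic pq)/holP. Qed.

Lemma hol_equivariant (phi : S -> S) p s :
  (forall a b u, c a b (phi u) = phi (c a b u)) -> hol p (phi s) = phi (hol p s).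
Proof.
move=> phic; have [h [[eps eps0 hp] h0 h1]] := holP p s.
apply: hol_eq; exists (phi \o h); split; rewrite /= ?h0 ?h1 //.
by exists eps => // t t' t0 t1 tt /=; rewrite (hp t) // phic.
Qed.

End path.

Lemma hol_concat (x y z : X) (p : {path I from x to y})
    (q : {path I from y to z}) s : hol (concat p q) s = hol q (hol p s).
Proof.
have [h [[eps eps0 hP] h0 h1]] := holP (concat p q) s.
have E1 t : 0 <= t <= 1 -> concat p q (clamp (2^-1 * t)) = p (clamp t).
  move=> /andP[? ?]; rewrite concatE; last by apply/andP; split; lra.
  by rewrite ifT; [congr (p (clamp _)); lra|lra].
have E2 t : 0 <= t <= 1 -> concat p q (clamp (2^-1 + 2^-1 * t)) = q (clamp t).
  move=> /andP[? ?]; rewrite concatE; last by apply/andP; split; lra.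
  (* At [t = 0] the concatenation still evaluates its first branch; both halves agree there on the
     common point [y]. *)
  case: ifPn => t2; last by congr (q (clamp _)); lra.
  have -> : t = 0 by lra.
  have -> : 2 * (2^-1 + 2^-1 * 0) = 1 :> R by lra.
  by rewrite -/zero -/one path_zero path_one.
have hp : hol p s = h 2^-1.
  apply: hol_eq; exists (fun t => h (2^-1 * t)); split; rewrite ?mulr0 ?mulr1 //.
  exists eps => // t t' t0 t1; rewrite ltr_norml => /andP[? ?].
  have /andP[? ?] := t0; have /andP[? ?] := t1.
  rewrite (hP (2^-1 * t)) ?E1 //; try by apply/andP; split; lra.
  by rewrite ltr_norml; apply/andP; split; lra.
rewrite hp; apply/esym/hol_eq; exists (fun t => h (2^-1 + 2^-1 * t)).
split; last by rewrite -h1; congr h; lra.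
  exists eps => // t t' t0 t1; rewrite ltr_norml => /andP[? ?].
  have /andP[? ?] := t0; have /andP[? ?] := t1.
  rewrite (hP (2^-1 + 2^-1 * t)) ?E2 //; try by apply/andP; split; lra.
  by rewrite ltr_norml; apply/andP; split; lra.
by rewrite mulr0 addr0.
Qed.

Section loops.
Variable x : X.
Implicit Types g k : pi1 R x.

Definition monodromy g (s : S) : S := hol (repr g) s.

Lemma monodromyE (p : {path I from x to x}) s :
  monodromy (\pi_(pi1 R x) p) s = hol p s.
Proof. by apply: hol_homotopic; exact: repr_homotopic. Qed.

(** The action is a right action because a product of loops runs through its left factor first. *)
Lemma monodromyM g k s : monodromy (g * k)%g s = monodromy k (monodromy g s).
Proof.
elim/quotP: g => p _; elim/quotP: k => q _.
rewrite (pi1_mulE p q : (\pi_(pi1 R x) p * \pi_(pi1 R x) q)%g = _).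
by rewrite !monodromyE hol_concat.
Qed.

Lemma monodromy_equivariant (phi : S -> S) g s :
  (forall a b u, c a b (phi u) = phi (c a b u)) ->
  monodromy g (phi s) = phi (monodromy g s).
Proof. exact: hol_equivariant. Qed.

End loops.
End holonomy.

(** * Fundamental groupoids *)

Section groupoid.
Variables (R : realType) (X : topologicalType).
Local Notation I := (unit_itv R).

(** With equal end points this unfolds to [pi1], so the groupoid operations are literally the group
    operations there. *)
Definition path_class (x y : X) : Type := {eq_quot (@homotopic_equiv R X x y)}.
HB.instance Definition _ x y := Choice.on (path_class x y).
HB.instance Definition _ x y := Quotient.on (path_class x y).

Definition cls (x y : X) (p : {path I from x to y}) : path_class x y :=
  \pi_(path_class x y) p.

Lemma cls_eqP (x y : X) (p q : {path I from x to y}) :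
  cls p = cls q <-> homotopic p q.
Proof. by split => [/eqmodP/asboolP //|pq]; apply/eqmodP/asboolP. Qed.

Lemma cls_ind (x y : X) (P : path_class x y -> Prop) :
  (forall p, P (cls p)) -> forall a, P a.
Proof. by move=> H; elim/quotP => p _; exact: H. Qed.

Lemma repr_cls (x y : X) (p : {path I from x to y}) : homotopic (repr (cls p)) p.
Proof. by apply/cls_eqP; rewrite /cls reprK. Qed.

Definition cmp (x y z : X) (a : path_class x y) (b : path_class y z) :
  path_class x z := cls (concat (repr a) (repr b)).
Definition cinv (x y : X) (a : path_class x y) : path_class y x :=
  cls (reverse (repr a)).
Definition cid1 (x : X) : path_class x x := cls (const_path R x).

Lemma cmpE (x y z : X) (p : {path I from x to y}) (q : {path I from y to z}) :
  cmp (cls p) (cls q) = cls (concat p q).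
Proof. by apply/cls_eqP; apply: concat_homotopic; exact: repr_cls. Qed.

Lemma cinvE (x y : X) (p : {path I from x to y}) : cinv (cls p) = cls (reverse p).
Proof. by apply/cls_eqP; apply: reverse_homotopic; exact: repr_cls. Qed.

Lemma cmpA (w x y z : X) (a : path_class w x) (b : path_class x y)
    (c : path_class y z) : cmp a (cmp b c) = cmp (cmp a b) c.
Proof.
elim/cls_ind: a => p; elim/cls_ind: b => q; elim/cls_ind: c => r.
by rewrite !cmpE; apply/cls_eqP; exact: concatA_homotopic.
Qed.

Lemma cmp1c (x y : X) (a : path_class x y) : cmp (cid1 x) a = a.
Proof.
by elim/cls_ind: a => p; rewrite cmpE; apply/cls_eqP; exact: concat1p_homotopic.
Qed.

Lemma cmpc1 (x y : X) (a : path_class x y) : cmp a (cid1 y) = a.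
Proof.
by elim/cls_ind: a => p; rewrite cmpE; apply/cls_eqP; exact: concatp1_homotopic.
Qed.

Lemma cmpVc (x y : X) (a : path_class x y) : cmp (cinv a) a = cid1 y.
Proof.
elim/cls_ind: a => p; rewrite cinvE cmpE; apply/cls_eqP.
exact: concatVp_homotopic.
Qed.

Lemma cinvK (x y : X) (a : path_class x y) : cinv (cinv a) = a.
Proof. by elim/cls_ind: a => p; rewrite !cinvE reverseK. Qed.

Lemma cmpcV (x y : X) (a : path_class x y) : cmp a (cinv a) = cid1 x.
Proof. by rewrite -{1}(cinvK a) cmpVc. Qed.

Lemma cmpcK (x y z : X) (a : path_class x y) (b : path_class y z) :
  cmp (cmp a b) (cinv b) = a.
Proof. by rewrite -cmpA cmpcV cmpc1. Qed.

Lemma cmpcVK (x y z : X) (a : path_class x y) (b : path_class z y) :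
  cmp (cmp a (cinv b)) b = a.
Proof. by rewrite -cmpA cmpVc cmpc1. Qed.

Lemma cinv_eq (x y : X) (a : path_class x y) (b : path_class y x) :
  cmp a b = cid1 x -> cinv a = b.
Proof. by move=> ab; rewrite -[LHS]cmpc1 -ab cmpA cmpVc cmp1c. Qed.

Lemma pi1_mulgE (x : X) (a b : pi1 R x) : (a * b)%g = cmp a b.
Proof. by []. Qed.

Lemma pi1_onegE (x : X) : (1 : pi1 R x)%g = cid1 x.
Proof. by []. Qed.

End groupoid.

(** * Induced homomorphisms, free homotopies and convex sets *)

Section functoriality.
Variables (R : realType) (X Y : topologicalType) (f : X -> Y).
Hypothesis cf : continuous f.
Local Notation I := (unit_itv R).

Section map_path.
Variables (x y : X) (x' y' : Y) (fx : f x = x') (fy : f y = y').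

Fact map_path_continuous (p : {path I from x to y}) : continuous (f \o p).
Proof. by move=> t; apply: continuous_comp; [exact: cts_fun|exact: cf]. Qed.

Fact map_path_zero (p : {path I from x to y}) : (f \o p) zero = x'.
Proof. by rewrite /= path_zero. Qed.

Fact map_path_one (p : {path I from x to y}) : (f \o p) one = y'.
Proof. by rewrite /= path_one. Qed.

(** The end points are prescribed through equations, because [f x] is in general only provably equal
    to the wanted base point. *)
Definition map_path (p : {path I from x to y}) : {path I from x' to y'} :=
  mk_path (@map_path_continuous p) (map_path_zero p) (map_path_one p).

Lemma map_path_homotopic (p q : {path I from x to y}) :
  homotopic p q -> homotopic (map_path p) (map_path q).
Proof.
move=> [H [cH H0 H1 Hx Hy]]; exists (f \o H); split => /=.
- by move=> t; apply: continuous_comp; [exact: cH|exact: cf].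
- by move=> t; rewrite H0.
- by move=> t; rewrite H1.
- by move=> s; rewrite Hx.
- by move=> s; rewrite Hy.
Qed.

End map_path.

Lemma map_path_concat (x y z : X) (x' y' z' : Y) (fx : f x = x') (fy : f y = y')
    (fz : f z = z') (p : {path I from x to y}) (q : {path I from y to z}) :
  map_path fx fz (concat p q) = concat (map_path fx fy p) (map_path fy fz q).
Proof.
apply/path_eqP => t; rewrite /= /mk_path /= /mk_path /concat_fun /=.
by case: ifP.
Qed.

Section map_pi1.
Variables (x : X) (x' : Y) (fx : f x = x').

Definition map_pi1 (g : pi1 R x) : pi1 R x' :=
  \pi_(pi1 R x') (map_path fx fx (repr g)).

Lemma map_pi1E (p : {path I from x to x}) :
  map_pi1 (\pi_(pi1 R x) p) = \pi_(pi1 R x') (map_path fx fx p).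
Proof. by apply/pi1_eqP/map_path_homotopic; exact: repr_homotopic. Qed.

Lemma map_pi1M (g k : pi1 R x) : map_pi1 (g * k)%g = (map_pi1 g * map_pi1 k)%g.
Proof.
elim/quotP: g => p _; elim/quotP: k => q _.
rewrite (pi1_mulE p q : (\pi_(pi1 R x) p * \pi_(pi1 R x) q)%g = _).
rewrite !map_pi1E (map_path_concat fx fx fx).
exact/esym/pi1_mulE.
Qed.

End map_pi1.
End functoriality.

Section free_homotopy.
Variables (R : realType) (X : topologicalType).
Local Notation I := (unit_itv R).

(* Interpolate linearly between the two ways around the boundary. *)
Lemma square_homotopic (H : I * I -> X) (x y z w : X)
    (b : {path I from x to y}) (r : {path I from y to z})
    (l : {path I from x to w}) (t : {path I from w to z}) :
  continuous H -> (forall s, H (s, zero) = b s) -> (forall s, H (s, one) = t s) ->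
  (forall s, H (zero, s) = l s) -> (forall s, H (one, s) = r s) ->
  homotopic (concat b r) (concat l t).
Proof.
move=> cH Hb Ht Hl Hr.
have c1 : continuous (fun d : I * I => set_val d.1).
  by move=> d; apply: continuous_comp; [exact: cvg_fst|exact: set_val_continuous].
have c2 : continuous (fun d : I * I => set_val d.2).
  by move=> d; apply: continuous_comp; [exact: cvg_snd|exact: set_val_continuous].
(* [al] and [be] are the coordinates of the way along the bottom and then up the right side;
   exchanging them gives the way up the left side and then along the top. *)
pose al (t : R) : R := set_val (clamp (2 * t)).
pose be (t : R) : R := set_val (clamp (2 * t - 1)).
have ccl (u : I * I -> R) : continuous u ->
    continuous (fun d => set_val (clamp (u d)) : R).
  move=> cu d; apply: (@continuous_comp _ _ _ (fun d => clamp (u d)) set_val).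
    exact: clamp_comp_continuous.
  exact: set_val_continuous.
have cal : continuous (fun d : I * I => al (set_val d.1)).
  by apply: (ccl (fun d : I * I => 2 * set_val d.1)); exact: scale_continuous.
have cbe : continuous (fun d : I * I => be (set_val d.1)).
  apply: (ccl (fun d : I * I => 2 * set_val d.1 - 1)).
  exact/shift_continuous/scale_continuous.
have cmix (u v : I * I -> R) : continuous u -> continuous v ->
    continuous (fun d : I * I => (1 - set_val d.2) * u d + set_val d.2 * v d).
  move=> cu cv d; apply: cvgD; apply: cvgM => //; try exact: cu; try exact: cv.
    by apply: cvgB; [exact: cvg_cst|exact: c2].
  exact: c2.
exists (fun d : I * I => H (clamp ((1 - set_val d.2) * al (set_val d.1) + set_val d.2 * be (set_val d.1)),
                   clamp ((1 - set_val d.2) * be (set_val d.1) + set_val d.2 * al (set_val d.1)))).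
have S0 := set_val_zero R.
have S1 := set_val_one R.
have Al (a : R) : clamp (al a) = clamp (2 * a) by rewrite clampK.
have Be (a : R) : clamp (be a) = clamp (2 * a - 1) by rewrite clampK.
split => /= [|s|s|s|s].
- move=> d; apply: (@continuous_comp _ _ _ _ H); last exact: cH.
  by apply: pair_continuous; apply: clamp_comp_continuous; exact: cmix.
- rewrite S0 subr0 !mul1r !mul0r !addr0 Al Be.
  rewrite -[s in RHS]clampK -/(concat _ _) concatE ?itvP //.
  case: ifP => s2; first by rewrite (@clamp_le0 _ (_ - 1)) ?Hb //; lra.
  by rewrite (@clamp_ge1 _ (2 * _)) ?Hr //; lra.
- rewrite S1 subrr !mul1r !mul0r !add0r Al Be.
  rewrite -[s in RHS]clampK -/(concat _ _) concatE ?itvP //.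
  case: ifP => s2; first by rewrite (@clamp_le0 _ (_ - 1)) ?Hl //; lra.
  by rewrite (@clamp_ge1 _ (2 * _)) ?Ht //; lra.
- rewrite S0 (_ : al 0 = 0); last by rewrite /al mulr0 -/zero S0.
  rewrite (_ : be 0 = 0); last by rewrite /be mulr0 clamp_le0 ?S0 // sub0r oppr_le0.
  by rewrite !mulr0 addr0 -/zero Hb path_zero.
- rewrite S1 (_ : al 1 = 1); last by rewrite /al mulr1 clamp_ge1 ?S1 ?ler1n.
  rewrite (_ : be 1 = 1); last by rewrite /be mulr1 clamp_ge1 ?S1 //; lra.
  by rewrite !mulr1 subrK -/one Hr path_one.
Qed.

End free_homotopy.

Section convex.
Variables (R : realType) (A C : set (R * R)).
Local Notation I := (unit_itv R).

Definition mix (l : R) (a b : R * R) : R * R :=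
  ((1 - l) * a.1 + l * b.1, (1 - l) * a.2 + l * b.2).

Definition convex2 : Prop :=
  forall a b l, C a -> C b -> 0 <= l <= 1 -> C (mix l a b).

Hypotheses (convC : convex2) (CA : C `<=` A).

Lemma set_type_continuous (D : topologicalType) (f : D -> set_type A) :
  continuous (fun d => (set_val (f d)).1) ->
  continuous (fun d => (set_val (f d)).2) -> continuous f.
Proof.
move=> c1 c2; apply: continuous_comp_initial => d.
have -> : (set_val \o f) = fun d => ((set_val (f d)).1, (set_val (f d)).2).
  by apply/funext => e /=; case: (set_val _).
exact: pair_continuous.
Qed.

Lemma set_val_fst_continuous : continuous (fun a : set_type A => (set_val a).1).
Proof.
move=> a; apply: (@continuous_comp _ _ _ set_val fst); last exact: cvg_fst.
exact: initial_continuous.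
Qed.

Lemma set_val_snd_continuous : continuous (fun a : set_type A => (set_val a).2).
Proof.
move=> a; apply: (@continuous_comp _ _ _ set_val snd); last exact: cvg_snd.
exact: initial_continuous.
Qed.

Lemma convex_homotopic (x y : set_type A) (p q : {path I from x to y}) :
  (forall t, C (set_val (p t))) -> (forall t, C (set_val (q t))) ->
  homotopic p q.
Proof.
move=> Cp Cq.
have HA (d : I * I) : mix (set_val d.2) (set_val (p d.1)) (set_val (q d.1)) \in A.
  by apply/mem_set/CA/convC => //; exact: itvP.
exists (fun d => exist (fun a => a \in A) _ (HA d)).
have c2 : continuous (fun d : I * I => set_val d.2).
  by move=> d; apply: continuous_comp; [exact: cvg_snd|exact: set_val_continuous].
have cp (r : {path I from x to y}) : continuous (fun d : I * I => r d.1).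
  by move=> d; apply: continuous_comp; [exact: cvg_fst|exact: cts_fun].
have cp1 (r : {path I from x to y}) :
    continuous (fun d : I * I => (set_val (r d.1)).1).
  move=> d; apply: (@continuous_comp _ _ _ (fun d : I * I => r d.1) (fun a : set_type A => (set_val a).1)).
    exact: cp.
  exact: set_val_fst_continuous.
have cp2 (r : {path I from x to y}) :
    continuous (fun d : I * I => (set_val (r d.1)).2).
  move=> d; apply: (@continuous_comp _ _ _ (fun d : I * I => r d.1) (fun a : set_type A => (set_val a).2)).
    exact: cp.
  exact: set_val_snd_continuous.
have S0 := set_val_zero R.
have S1 := set_val_one R.
split => [|t|t|s|s].
- apply: set_type_continuous; rewrite /= => d; apply: cvgD; apply: cvgM.
  + by apply: cvgB; [exact: cvg_cst|exact: c2].
  + exact: cp1.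
  + exact: c2.
  + exact: cp1.
  + by apply: cvgB; [exact: cvg_cst|exact: c2].
  + exact: cp2.
  + exact: c2.
  + exact: cp2.
- apply: val_inj; rewrite /= /mix S0 subr0 !mul1r !mul0r !addr0.
  by rewrite -surjective_pairing.
- apply: val_inj; rewrite /= /mix S1 subrr !mul1r !mul0r !add0r.
  by rewrite -surjective_pairing.
- apply: val_inj; rewrite /= /mix !path_zero -!mulrDl subrK !mul1r.
  by rewrite -surjective_pairing.
- apply: val_inj; rewrite /= /mix !path_one -!mulrDl subrK !mul1r.
  by rewrite -surjective_pairing.
Qed.

Lemma segment_exists (x y : set_type A) : C (set_val x) -> C (set_val y) ->
  exists p : {path I from x to y}, forall t, C (set_val (p t)).
Proof.
move=> Cx Cy.
have HC (t : I) : C (mix (set_val t) (set_val x) (set_val y)).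
  by apply: convC => //; exact: itvP.
have HA (t : I) := mem_set (CA (HC t)).
pose f (t : I) : set_type A := exist (fun a => a \in A) _ (HA t).
have cf : continuous f.
  have cv : continuous (fun t : I => set_val t : R) by exact: set_val_continuous.
  have cw : continuous (fun t : I => 1 - set_val t : R) by exact: flip_continuous.
  by apply: set_type_continuous; rewrite /=; cts.
have f0 : f zero = x.
  apply: val_inj; rewrite /= /mix clampE ?lexx ?ler01 //.
  by rewrite subr0 !mul1r !mul0r !addr0; rewrite -surjective_pairing.
have f1 : f one = y.
  apply: val_inj; rewrite /= /mix clampE ?lexx ?ler01 //.
  by rewrite subrr !mul1r !mul0r !add0r; rewrite -surjective_pairing.
by exists (mk_path cf f0 f1).
Qed.

End convex.

(** * Winding numbers *)

Section angle.
Variable R : realType.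
Implicit Types h : R.

Definition sqnorm (z : R * R) : R := z.1 ^+ 2 + z.2 ^+ 2.
Definition inner (z w : R * R) : R := z.1 * w.1 + z.2 * w.2.
Definition cross (z w : R * R) : R := z.1 * w.2 - z.2 * w.1.
(** The signed angle from [z] to [w] when [inner z w > 0]; elsewhere the value is meaningless. *)
Definition ang (z w : R * R) : R := atan (cross z w / inner z w).
Definition rho (z : R * R) : R := Num.sqrt (sqnorm z).
Definition polar h (z : R * R) : Prop := z.1 = rho z * cos h /\ z.2 = rho z * sin h.

Lemma sqnorm_gt0 (z : R * R) : z <> 0 -> 0 < sqnorm z.
Proof.
case: z => a b ab; rewrite /sqnorm /= lt0r addr_ge0 ?sqr_ge0 // andbT.
apply/eqP => /eqP; rewrite paddr_eq0 ?sqr_ge0 // !sqrf_eq0.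
by case/andP => /eqP a0 /eqP b0; apply: ab; rewrite a0 b0.
Qed.

Lemma rho_gt0 z : z <> 0 -> 0 < rho z.
Proof. by move=> z0; rewrite sqrtr_gt0 sqnorm_gt0. Qed.

Lemma rho_sqr z : rho z ^+ 2 = sqnorm z.
Proof. by rewrite sqr_sqrtr // addr_ge0 // sqr_ge0. Qed.

Lemma crossxx z : cross z z = 0.
Proof. by rewrite /cross [X in _ - X]mulrC subrr. Qed.

Lemma angxx z : ang z z = 0.
Proof. by rewrite /ang crossxx mul0r atan0. Qed.

Lemma cos_atan_gt0 (x : R) : 0 < cos (atan x).
Proof. by apply: cos_gt0_pihalf; rewrite atan_gtNpi2 atan_ltpi2. Qed.

Lemma sin_atan (x : R) : sin (atan x) = x * cos (atan x).
Proof.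
have c0 := lt0r_neq0 (cos_atan_gt0 x).
by have := atanK x; rewrite /tan => {2}<-; rewrite divfK.
Qed.

(** By Lagrange's identity [inner z w ^+ 2 + cross z w ^+ 2 = (rho z * rho w) ^+ 2], so [inner] and
    [cross] over [rho z * rho w] are the cosine and the sine of the angle. *)
Lemma polar_ang h z w : z <> 0 -> w <> 0 -> 0 < inner z w ->
  polar h z -> polar (h + ang z w) w.
Proof.
move=> z0 w0 zw [z1 z2]; rewrite /polar cosD sinD.
have r0 := rho_gt0 z0; have r1 := rho_gt0 w0.
have K : inner z w ^+ 2 + cross z w ^+ 2 = (rho z * rho w) ^+ 2.
  by rewrite exprMn !rho_sqr /inner /cross /sqnorm; ring.
have cosE : cos (ang z w) = inner z w / (rho z * rho w).
  rewrite /ang cos_atan.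
  have -> : 1 + (cross z w / inner z w) ^+ 2 = ((rho z * rho w) / inner z w) ^+ 2.
    by rewrite !expr_div_n -K; field; exact: lt0r_neq0.
  rewrite sqrtr_sqr ger0_norm ?invf_div // divr_ge0 ?mulr_ge0 //; exact: ltW.
have sinE : sin (ang z w) = cross z w / (rho z * rho w).
  rewrite /ang sin_atan -/(ang z w) cosE; field.
  by rewrite !lt0r_neq0.
have cE : cos h = z.1 / rho z by rewrite z1 mulrAC divff ?mul1r // lt0r_neq0.
have sE : sin h = z.2 / rho z by rewrite z2 mulrAC divff ?mul1r // lt0r_neq0.
rewrite cosE sinE cE sE; have S := rho_sqr z.
split.
  have -> : rho w * (z.1 / rho z * (inner z w / (rho z * rho w)) -
      z.2 / rho z * (cross z w / (rho z * rho w))) =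
      (z.1 * inner z w - z.2 * cross z w) / rho z ^+ 2.
    by field; rewrite !lt0r_neq0.
  rewrite S; have := sqnorm_gt0 z0; rewrite /inner /cross /sqnorm => Z.
  by field; exact: lt0r_neq0.
have -> : rho w * (z.2 / rho z * (inner z w / (rho z * rho w)) +
    z.1 / rho z * (cross z w / (rho z * rho w))) =
    (z.2 * inner z w + z.1 * cross z w) / rho z ^+ 2.
  by field; rewrite !lt0r_neq0.
rewrite S; have := sqnorm_gt0 z0; rewrite /inner /cross /sqnorm => Z.
by field; exact: lt0r_neq0.
Qed.

Lemma ang_polar h k z w : z <> 0 -> w <> 0 -> polar h z -> polar k w ->
  `|k - h| < pi / 2 -> ang z w = k - h.
Proof.
move=> z0 w0 [z1 z2] [w1 w2]; rewrite ltr_norml => kh.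
have r0 := rho_gt0 z0; have r1 := rho_gt0 w0.
have c0 : cos (k - h) != 0 by apply/lt0r_neq0/cos_gt0_pihalf.
rewrite /ang (_ : _ / _ = tan (k - h)) ?tanK ?in_itv //.
rewrite /tan /cross /inner z1 z2 w1 w2 sinB cosB.
move: c0; rewrite cosB => c0; field.
have -> : forall a b c d e f : R, e * c * (f * a) + e * d * (f * b) =
  (e * f) * (a * c + b * d) by move=> *; ring.
by rewrite c0 !mulf_neq0 // lt0r_neq0.
Qed.

Section winding.
Variables (X : topologicalType) (g : X -> R * R).
Hypotheses (cg1 : continuous (fun x => (g x).1)) (cg2 : continuous (fun x => (g x).2)).
Hypothesis g0 : forall x, g x <> 0.
Local Notation I := (unit_itv R).

Definition winding_cocycle (x y : X) (s : R) : R := s + ang (g x) (g y).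

Lemma inner_continuous (x : X) : continuous (fun y => inner (g x) (g y)).
Proof. by rewrite /inner; cts. Qed.

Lemma cross_continuous (x : X) : continuous (fun y => cross (g x) (g y)).
Proof. by rewrite /cross; cts. Qed.

(** Directions within pi / 4 of [g x]: two of them are less than a right angle apart, the range in
    which [ang] is additive. *)
Definition near_direction (x : X) : set X :=
  [set y | `|cross (g x) (g y)| < inner (g x) (g y)].

Lemma near_direction_nbhs (x : X) : nbhs x (near_direction x).
Proof.
have cu : continuous (fun y => inner (g x) (g y) - `|cross (g x) (g y)|).
  apply: ctsD; first exact: inner_continuous.
  apply: ctsN => y; apply: (@continuous_comp _ _ _ (fun y => cross (g x) (g y)) Num.norm).
    exact: cross_continuous.
  exact: norm_continuous.
have u0 : 0 < inner (g x) (g x) - `|cross (g x) (g x)|.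
  by rewrite crossxx normr0 subr0 /inner -!expr2; exact: (sqnorm_gt0 (@g0 x)).
have : \forall y \near x, 0 < inner (g x) (g y) - `|cross (g x) (g y)|.
  exact: (cvgr_gt _ (cu x) _ u0).
by apply: filterS => y; rewrite subr_gt0.
Qed.

Lemma near_direction_inner (x y z : X) :
  near_direction x y -> near_direction x z -> 0 < inner (g y) (g z).
Proof.
rewrite /near_direction /= !ltr_norml => /andP[y1 y2] /andP[z1 z2].
have S := sqnorm_gt0 (@g0 x).
suff : 0 < sqnorm (g x) * inner (g y) (g z) by rewrite pmulr_rgt0.
have -> : sqnorm (g x) * inner (g y) (g z) =
    inner (g x) (g y) * inner (g x) (g z) + cross (g x) (g y) * cross (g x) (g z).
  by rewrite /sqnorm /inner /cross; ring.
move: (inner _ _) (inner _ _) (cross _ _) (cross _ _) y1 y2 z1 z2 => a b c d *.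
nra.
Qed.

(** Within a cone, [ang (g y) (g z)] is the difference of the angles measured from the axis [g x],
    by the addition formula for the tangent; differences telescope. *)
Lemma winding_local_cocycle : local_cocycle winding_cocycle.
Proof.
split=> [x s|x]; first by rewrite /winding_cocycle angxx addr0.
exists (near_direction x); last exact: near_direction_nbhs.
pose tau y := ang (g x) (g y).
suff E y z : near_direction x y -> near_direction x z ->
    ang (g y) (g z) = tau z - tau y.
  by move=> y z w s Ny Nz Nw; rewrite /winding_cocycle !E //; ring.
move=> Ny Nz; have yz := near_direction_inner Ny Nz.
have T u : near_direction x u -> - (pi / 4) < tau u < pi / 4.
  rewrite /near_direction /= => Nu.
  have p0 : 0 < inner (g x) (g u) by exact: le_lt_trans Nu.
  move: Nu; rewrite ltr_norml => /andP[u1 u2].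
  rewrite -atan1 -atanN; apply/andP; split; apply: lt_atan.
    by rewrite ltr_pdivlMr // mulN1r.
  by rewrite ltr_pdivrMr // mul1r.
have px u : near_direction x u -> inner (g x) (g u) != 0.
  by move=> Nu; apply: lt0r_neq0; exact: le_lt_trans Nu.
have := T _ Ny; have := T _ Nz; move=> /andP[? ?] /andP[? ?].
rewrite {1}/ang (_ : _ / _ = tan (tau z - tau y)).
  by rewrite tanK // in_itv /=; apply/andP; split; lra.
rewrite tanD ?cosN ?lt0r_neq0 ?cos_atan_gt0 // tanN !atanK.
have Sx := lt0r_neq0 (sqnorm_gt0 (@g0 x)).
have yz' := lt0r_neq0 yz.
have I1 : inner (g x) (g y) * inner (g x) (g z) + cross (g x) (g y) * cross (g x) (g z)
   = sqnorm (g x) * inner (g y) (g z) by rewrite /sqnorm /inner /cross; ring.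
have I2 : inner (g x) (g y) * cross (g x) (g z) - inner (g x) (g z) * cross (g x) (g y)
   = sqnorm (g x) * cross (g y) (g z) by rewrite /sqnorm /inner /cross; ring.
have P1 := px _ Ny; have P2 := px _ Nz.
move: I1 I2 P1 P2.
move: (inner (g x) (g y)) (inner (g x) (g z)) (cross (g x) (g y)) (cross (g x) (g z)).
move=> a b c d I1 I2 a0 b0.
have -> : (d / b - c / a) / (1 - d / b * - (c / a)) = (a * d - b * c) / (a * b + c * d).
  by field; rewrite I1 mulf_neq0 // a0 b0.
by rewrite I1 I2; field; rewrite Sx yz'.
Qed.

(** Transport produces the function. It is continuous because near [d] it is its value at [d] plus
    the continuous angle [ang], and it remains an argument by propagation along segments from the
    origin. *)
Lemma angle_exists (F : I * I -> X) h0 : continuous F ->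
  polar h0 (g (F (zero, zero))) ->
  exists th : I * I -> R,
    [/\ continuous th, forall d, polar (th d) (g (F d)) & th (zero, zero) = h0].
Proof.
move=> cF ph0.
pose f (d : R * R) := F (clamp d.1, clamp d.2).
have cf : continuous f.
  move=> d; apply: (@continuous_comp _ _ _
    (fun d : R * R => (clamp d.1, clamp d.2)) F); last exact: cF.
  by apply: pair_continuous; apply: clamp_comp_continuous => e;
    [exact: cvg_fst|exact: cvg_snd].
have [h [eps eps0 hP] hh0] := parallel2_exists winding_local_cocycle h0 cf.
have [del del0 dP] := @square_lebesgue R X f
  (fun N => forall y z, N y -> N z -> 0 < inner (g y) (g z)) cf
  (fun x => ex_intro2 _ _ _ (@near_direction_inner x) (near_direction_nbhs x)).
have ip d e : in_square d -> sq_close del d e -> 0 < inner (g (f d)) (g (f e)).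
  move=> dS de; have [N NP HN] := dP d dS; apply: NP; apply: HN => //.
  by rewrite /sq_close !subrr normr0 del0.
have pol d : in_square d -> polar (h d) (g (f d)).
  move=> /andP[d1 d2].
  suff : forall t, 0 <= t <= 1 -> polar (h (t * d.1, t * d.2)) (g (f (t * d.1, t * d.2))).
    by move=> /(_ 1); rewrite ler01 lexx !mul1r -surjective_pairing; exact.
  apply: unit_interval_ind; last by rewrite !mul0r hh0.
  exists (Num.min eps del); first by rewrite lt_min eps0.
  move=> s t s1 t1 st H.
  have sq u : 0 <= u <= 1 -> in_square (u * d.1, u * d.2).
    move: d1 d2 => /andP[? ?] /andP[? ?] /andP[? ?].
    by apply/andP; split; apply/andP; split => /=; nra.
  have lt1 (x : R) : 0 <= x <= 1 -> `|s * x - t * x| < Num.min eps del.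
    move=> /andP[x0 x1]; rewrite -mulrBl normrM (ger0_norm x0).
    by apply: le_lt_trans st; rewrite ler_piMr.
  have := lt1 _ d1; have := lt1 _ d2; rewrite !lt_min => /andP[? ?] /andP[? ?].
  rewrite (hP (s * d.1, s * d.2) (t * d.1, t * d.2)) ?sq //; last exact/andP.
  apply: polar_ang => //; try exact: g0.
  by apply: ip; [exact: sq|exact/andP].
have val2 (d : I * I) : in_square (set_val d.1, set_val d.2).
  by rewrite /in_square /= !itvP.
have fE (d : I * I) : f (set_val d.1, set_val d.2) = F d.
  by rewrite /f /= !clampK -surjective_pairing.
exists (fun d => h (set_val d.1, set_val d.2)); split.
- move=> d; rewrite /continuous_at.
  have c1 : continuous (fun d : I * I => set_val d.1 : R).
    by move=> e; apply: continuous_comp; [exact: cvg_fst|exact: set_val_continuous].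
  have c2 : continuous (fun d : I * I => set_val d.2 : R).
    by move=> e; apply: continuous_comp; [exact: cvg_snd|exact: set_val_continuous].
  have E : \forall e \near d, h (set_val d.1, set_val d.2) + ang (g (F d)) (g (F e))
      = h (set_val e.1, set_val e.2).
    have n1 : \forall e \near d, `|(set_val d.1 : R) - set_val e.1| < eps.
      by have /cvgrPdist_lt /(_ _ eps0) := c1 d.
    have n2 : \forall e \near d, `|(set_val d.2 : R) - set_val e.2| < eps.
      by have /cvgrPdist_lt /(_ _ eps0) := c2 d.
    move: n1 n2; apply: filterS2 => e e1 e2.
    by rewrite (hP (set_val d.1, set_val d.2) (set_val e.1, set_val e.2)) ?val2 // /winding_cocycle ?fE //
      /sq_close /= e1 e2.
  apply: (cvg_trans (near_eq_cvg E)).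
  suff : {for d, continuous (fun e => h (set_val d.1, set_val d.2) +
      ang (g (F d)) (g (F e)))}.
    by rewrite /prop_for /continuous_at angxx addr0.
  have ci : continuous (fun e => inner (g (F d)) (g (F e))).
    by move=> e; apply: (@continuous_comp _ _ _ F (fun y => inner (g (F d)) (g y)));
      [exact: cF|exact: inner_continuous].
  have cc : continuous (fun e => cross (g (F d)) (g (F e))).
    by move=> e; apply: (@continuous_comp _ _ _ F (fun y => cross (g (F d)) (g y)));
      [exact: cF|exact: cross_continuous].
  apply: cvgD; first exact: cvg_cst.
  apply: (@continuous_comp _ _ _ (fun e => cross (g (F d)) (g (F e)) / inner (g (F d)) (g (F e))) (@atan R)); last exact: continuous_atan.
  apply: (continuousM (cc d)); apply: continuousV; last exact: ci.
  by apply: lt0r_neq0; exact: (sqnorm_gt0 (@g0 _)).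
- by move=> d; have := pol _ (val2 d); rewrite fE.
- by rewrite !clampE ?lexx ?ler01.
Qed.

Variable x : X.

(** The total change of argument, in radians. Starting at 0 is harmless because [winding_cocycle]
    commutes with translations. *)
Definition winding (a : pi1 R x) : R := monodromy winding_local_cocycle a 0.

Lemma monodromy_winding a s :
  monodromy winding_local_cocycle a s = winding a + s.
Proof.
rewrite -[X in monodromy _ _ X](add0r s).
by apply: (monodromy_equivariant _ (phi := fun t => t + s)) => y z t;
  rewrite /winding_cocycle addrAC.
Qed.

Lemma windingM a b : winding (a * b)%g = winding a + winding b.
Proof. by rewrite /winding monodromyM monodromy_winding addrC. Qed.

(** Any continuous argument is parallel for [winding_cocycle]: a Lebesgue number makes its small
    steps shorter than a quarter turn, where [ang] measures them exactly. *)
Lemma winding_angle (p : {path I from x to x}) (th : R -> R) : continuous th ->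
  (forall t, polar (th t) (g (p (clamp t)))) ->
  winding (\pi_(pi1 R x) p) = th 1 - th 0.
Proof.
move=> cth pth.
have <- : monodromy winding_local_cocycle (\pi_(pi1 R x) p) (th 0) = th 1.
  rewrite monodromyE; apply: hol_eq; exists th; split => //.
  have cf : continuous (fun d : R * R => th d.1).
    by move=> d; apply: continuous_comp; [exact: cvg_fst|exact: cth].
  have loc (y : R) : exists2 N : set R,
      (forall a b, N a -> N b -> `|b - a| < pi / 2) & nbhs y N.
    exists (ball y (pi / 4)).
      move=> a b; rewrite /ball /= !ltr_norml => /andP[? ?] /andP[? ?].
      by apply/andP; split; lra.
    by apply: nbhsx_ballx; rewrite divr_gt0 // pi_gt0.
  have [eps eps0 H] := square_lebesgue cf loc.
  exists eps => // s t s1 t1 st.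
  rewrite /winding_cocycle (ang_polar _ _ (pth s) (pth t)); try exact: g0.
    by rewrite addrC subrK.
  have [|N NP HN] := H (s, 0); first by rewrite /in_square /= s1 lexx ler01.
  apply: NP; [apply: (HN (s, 0))|apply: (HN (t, 0))].
    by rewrite /sq_close /= !subrr normr0 eps0.
  by rewrite /sq_close /= subrr normr0 eps0 st.
by rewrite monodromy_winding addrK.
Qed.

End winding.
End angle.

(** * The twice-punctured plane *)

Section path_in_set.
Variables (R : realType) (A C : set (R * R)).
Local Notation I := (unit_itv R).

Lemma concat_in (x y z : set_type A) (p : {path I from x to y})
    (q : {path I from y to z}) : (forall t, C (set_val (p t))) ->
  (forall t, C (set_val (q t))) -> forall t, C (set_val (concat p q t)).
Proof.
by move=> Cp Cq t; rewrite -[t]clampK concatE ?itvP //; case: ifP.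
Qed.

Lemma reverse_in (x y : set_type A) (p : {path I from x to y}) :
  (forall t, C (set_val (p t))) -> forall t, C (set_val (reverse p t)).
Proof. by move=> Cp t; exact: Cp. Qed.

Hypotheses (convC : convex2 C) (CA : C `<=` A).

Lemma convex_cls (x y : set_type A) (p q : {path I from x to y}) :
  (forall t, C (set_val (p t))) -> (forall t, C (set_val (q t))) ->
  cls p = cls q.
Proof. by move=> Cp Cq; apply/cls_eqP; exact: (convex_homotopic convC CA). Qed.

Lemma convex_cmp (x y z : set_type A) (p : {path I from x to y})
    (q : {path I from y to z}) (r : {path I from x to z}) :
  (forall t, C (set_val (p t))) -> (forall t, C (set_val (q t))) ->
  (forall t, C (set_val (r t))) -> cmp (cls p) (cls q) = cls r.
Proof.
by move=> Cp Cq Cr; rewrite cmpE; apply: convex_cls => //; exact: concat_in.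
Qed.

End path_in_set.

Section real_line.
Variable R : realType.
Local Notation I := (unit_itv R).

Lemma real_homotopic (x y : R) (p q : {path I from x to y}) : homotopic p q.
Proof.
have c2 : continuous (fun d : I * I => set_val d.2 : R).
  by move=> d; apply: continuous_comp; [exact: cvg_snd|exact: set_val_continuous].
have cp (r : {path I from x to y}) : continuous (fun d : I * I => r d.1).
  by move=> d; apply: continuous_comp; [exact: cvg_fst|exact: cts_fun].
have S0 := set_val_zero R.
have S1 := set_val_one R.
have c1 : continuous (fun d : I * I => 1 - set_val d.2 : R) by cts.
have := cp p; have := cp q => cq_ cp_.
exists (fun d : I * I => (1 - set_val d.2) * p d.1 + set_val d.2 * q d.1).
split => [|t|t|t|t] /=.
- by cts.
- by rewrite S0 subr0 mul1r mul0r addr0.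
- by rewrite S1 subrr mul1r mul0r add0r.
- by rewrite !path_zero; ring.
- by rewrite !path_one; ring.
Qed.

Definition line_fun (x y : R) (t : I) : R := (1 - set_val t) * x + set_val t * y.

Fact line_continuous x y : continuous (line_fun x y).
Proof.
have c : continuous (fun d : I => set_val d : R) by exact: set_val_continuous.
by rewrite /line_fun; cts.
Qed.

Fact line_zero x y : line_fun x y zero = x.
Proof. by rewrite /line_fun clampE ?lexx ?ler01 // subr0 mul1r mul0r addr0. Qed.

Fact line_one x y : line_fun x y one = y.
Proof. by rewrite /line_fun clampE ?lexx ?ler01 // subrr mul1r mul0r add0r. Qed.

Definition line x y : {path I from x to y} :=
  mk_path (@line_continuous x y) (line_zero x y) (line_one x y).

End real_line.

Inductive gap := gapL | gapM | gapR.

Section cuts.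
Variable R : realType.
Implicit Types (a b : R * R) (j : gap).

Definition twice_punctured : set (R * R) :=
  [set a | a <> (1, 0) /\ a <> (-1, 0)].

Definition strip j : set (R * R) := [set a | match j with
  | gapL => a.1 < -1 | gapM => (-1 < a.1) && (a.1 < 1) | gapR => 1 < a.1 end].
(** Only one gap of the real axis is added to the open half plane, which keeps the set convex and
    free of punctures. *)
Definition upper j : set (R * R) := [set a | 0 < a.2 \/ a.2 = 0 /\ strip j a].
Definition lower j : set (R * R) := [set a | a.2 < 0 \/ a.2 = 0 /\ strip j a].
Definition upper0 : set (R * R) := [set a | 0 < a.2].
Definition lower0 : set (R * R) := [set a | a.2 < 0].

Lemma mix0 a b : mix 0 a b = a.
Proof. by rewrite /mix subr0 !mul1r !mul0r !addr0 -surjective_pairing. Qed.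

Lemma mix1 a b : mix 1 a b = b.
Proof. by rewrite /mix subrr !mul1r !mul0r !add0r -surjective_pairing. Qed.

Lemma convex2_open (C : set (R * R)) :
  (forall a b l, C a -> C b -> 0 < l < 1 -> C (mix l a b)) -> convex2 C.
Proof.
move=> H a b l Ca Cb /andP[]; rewrite le_eqVlt => /orP[/eqP <- _|l0].
  by rewrite mix0.
by rewrite le_eqVlt => /orP[/eqP ->|l1]; [rewrite mix1|apply: H => //; rewrite l0].
Qed.

Lemma convex2I (C D : set (R * R)) : convex2 C -> convex2 D -> convex2 (C `&` D).
Proof. by move=> cC cD a b l [? ?] [? ?] l1; split; [exact: cC|exact: cD]. Qed.

Lemma strip_convex j : convex2 (strip j).
Proof.
apply: convex2_open => a b l + + /andP[l0 l1].
by case: j => /=; rewrite /strip /= => *; nra.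
Qed.

Lemma upper0_convex : convex2 upper0.
Proof. by apply: convex2_open => a b l; rewrite /upper0 /= => a0 b0 /andP[? ?]; nra. Qed.

Lemma lower0_convex : convex2 lower0.
Proof. by apply: convex2_open => a b l; rewrite /lower0 /= => a0 b0 /andP[? ?]; nra. Qed.

Lemma closed_upper_convex : convex2 [set a : R * R | 0 <= a.2].
Proof. by apply: convex2_open => a b l /= a0 b0 /andP[? ?]; nra. Qed.

Lemma upper_convex j : convex2 (upper j).
Proof.
apply: convex2_open => a b l + + /andP[l0 l1].
move=> [a0|[a0 aj]] [b0|[b0 bj]]; rewrite /upper /mix /= ?a0 ?b0;
  try (by left; nra).
right; rewrite !mulr0 addr0; split => //.
by have := strip_convex aj bj; apply; apply/andP; split; exact: ltW.
Qed.

Lemma lower_convex j : convex2 (lower j).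
Proof.
apply: convex2_open => a b l + + /andP[l0 l1].
move=> [a0|[a0 aj]] [b0|[b0 bj]]; rewrite /lower /mix /= ?a0 ?b0;
  try (by left; nra).
right; rewrite !mulr0 addr0; split => //.
by have := strip_convex aj bj; apply; apply/andP; split; exact: ltW.
Qed.

Lemma strip_punctured j : strip j `<=` twice_punctured.
Proof.
by move=> [x y] h; split=> -[xE _]; move: h; rewrite xE; case: j => /=;
  rewrite /strip /= => ?; lra.
Qed.

Lemma upper_punctured j : upper j `<=` twice_punctured.
Proof.
move=> [x y] [/= y0|[_ /strip_punctured //]].
by split=> -[_ yE]; move: y0; rewrite yE ltxx.
Qed.

Lemma lower_punctured j : lower j `<=` twice_punctured.
Proof.
move=> [x y] [/= y0|[_ /strip_punctured //]].
by split=> -[_ yE]; move: y0; rewrite yE ltxx.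
Qed.

Lemma upper0_punctured : upper0 `<=` twice_punctured.
Proof. by move=> a a0; apply: (@upper_punctured gapM); left. Qed.

Definition col a : gap :=
  if a.1 < -1 then gapL else if a.1 <= 1 then gapM else gapR.

Lemma col_strip j a : strip j a -> col a = j.
Proof.
rewrite /col; case: j => /=.
- by move=> ->.
- by move=> /andP[a1 a2]; rewrite ltNge (ltW a1) /= (ltW a2).
- by move=> a1; rewrite ltNge (_ : -1 <= a.1) /= ?leNgt ?a1 //; lra.
Qed.

Lemma strip_col a : twice_punctured a -> a.2 = 0 -> strip (col a) a.
Proof.
case: a => x y [/= h1 h2] /= y0; rewrite /col /=; subst y.
case: (ltP x (-1)) => x1 //=; case: (leP x 1) => x2 //=.
apply/andP; split; rewrite lt_neqAle ?x1 ?x2 andbT; apply/eqP => E.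
  by apply: h2; rewrite E.
by apply: h1; rewrite E.
Qed.

Lemma upper_col a : twice_punctured a -> 0 <= a.2 -> upper (col a) a.
Proof.
move=> pa; rewrite le_eqVlt => /orP[/eqP/esym a0|a0]; last by left.
by right; split; [|exact: strip_col].
Qed.

Local Notation E := (set_type twice_punctured).

(** One descent through gap [j] and one return through gap [k]. Consecutive pieces share their
    dividing time, which thus lies in two regions and fixes the side of the axis where a crossing
    starts and ends. *)
Definition dips (x y : E) (p : {path unit_itv R from x to y}) j k : Prop :=
  exists t1 t2 t3 t4, [/\ 0 <= t1 <= t2, t2 <= t3 <= t4 & t4 <= 1] /\
  [/\ forall t, 0 <= t <= t1 -> upper0 (set_val (p (clamp t))),
      forall t, t1 <= t <= t2 -> strip j (set_val (p (clamp t))),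
      forall t, t2 <= t <= t3 -> lower0 (set_val (p (clamp t))),
      forall t, t3 <= t <= t4 -> strip k (set_val (p (clamp t))) &
      forall t, t4 <= t <= 1 -> upper0 (set_val (p (clamp t)))].

Section cut_cocycle.
Variables (S : Type) (g g' : gap -> S -> S).
Hypotheses (gK : forall j, cancel (g j) (g' j)) (g'K : forall j, cancel (g' j) (g j)).

(** The real axis counts as part of the upper side. The gap is read off the starting point [a],
    which is meaningful only for points close together. *)
Definition cut_cocycle (x y : E) (s : S) : S :=
  let a := set_val x in let b := set_val y in
  if 0 <= a.2 then (if 0 <= b.2 then s else g (col a) s)
  else (if 0 <= b.2 then g' (col a) s else s).

Lemma cut_cocycle_upper0 :
  cocycle_on cut_cocycle [set x | upper0 (set_val x)].
Proof.
move=> x y z s /= /ltW x0 /ltW y0 /ltW z0.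
by rewrite /cut_cocycle x0 y0 z0.
Qed.

Lemma cut_cocycle_lower0 :
  cocycle_on cut_cocycle [set x | lower0 (set_val x)].
Proof.
move=> x y z s /= x0 y0 z0.
by rewrite /cut_cocycle !(leNgt 0) x0 y0 z0.
Qed.

Lemma cut_cocycle_strip j :
  cocycle_on cut_cocycle [set x | strip j (set_val x)].
Proof.
move=> x y z s /= x0 y0 z0.
rewrite /cut_cocycle (col_strip x0) (col_strip y0).
by case: (0 <= (set_val x).2); case: (0 <= (set_val y).2);
  case: (0 <= (set_val z).2); rewrite ?gK ?g'K.
Qed.

Lemma cut_local_cocycle : local_cocycle cut_cocycle.
Proof.
split=> [x s|x]; first by rewrite /cut_cocycle; case: (0 <= _).
have c1 := @set_val_fst_continuous R twice_punctured.
have c2 := @set_val_snd_continuous R twice_punctured.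
case: (ltgtP (set_val x).2 0) => x2.
- exists [set x | lower0 (set_val x)]; first exact: cut_cocycle_lower0.
  exact: (cvgr_lt _ (c2 x) _ x2).
- exists [set x | upper0 (set_val x)]; first exact: cut_cocycle_upper0.
  exact: (cvgr_gt _ (c2 x) _ x2).
- have := strip_col (set_mem (valP x)) x2; move: (col _) => j xj.
  exists [set x | strip j (set_val x)]; first exact: cut_cocycle_strip.
  case: j xj => /= xj.
  + exact: (cvgr_lt _ (c1 x) _ xj).
  + case/andP: xj => l r.
    have A1 : \forall y \near x, -1 < (set_val y).1 by exact: (cvgr_gt _ (c1 x) _ l).
    have A2 : \forall y \near x, (set_val y).1 < 1 by exact: (cvgr_lt _ (c1 x) _ r).
    by move: A1 A2; apply: filterS2 => y y1 y2; apply/andP.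
  + exact: (cvgr_gt _ (c1 x) _ xj).
Qed.

(** Each of the five pieces lies in one cocycle set and acts as a single jump; only the two pieces
    in strips change sides of the axis. *)
Lemma hol_dips (x y : E) (p : {path unit_itv R from x to y}) s j k :
  dips p j k -> hol cut_local_cocycle p s = g' k (g j s).
Proof.
move=> [t1 [t2 [t3 [t4 [[/andP[t01 t12] /andP[t23 t34] t45] [U1 S1 L S2 U2]]]]]].
have [h [hp h0 h1]] := holP cut_local_cocycle p s.
have Q := parallel_piece cut_local_cocycle hp.
have t02 := le_trans t01 t12; have t03 := le_trans t02 t23.
have t04 := le_trans t03 t34; have t35 := le_trans t34 t45.
have t25 := le_trans t23 t35; have t15 := le_trans t12 t25.
have e1 := Q _ _ _ cut_cocycle_upper0 (lexx 0) t01 t15 U1.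
have e2 := Q _ _ _ (@cut_cocycle_strip j) t01 t12 t25 S1.
have e3 := Q _ _ _ cut_cocycle_lower0 t02 t23 t35 L.
have e4 := Q _ _ _ (@cut_cocycle_strip k) t03 t34 t45 S2.
have e5 := Q _ _ _ cut_cocycle_upper0 t04 t45 (lexx 1) U2.
have u0 : 0 <= (set_val (p (clamp 0))).2 by apply/ltW/U1; lra.
have u1 : 0 <= (set_val (p (clamp t1))).2 by apply/ltW/U1; lra.
have l2 : (0 <= (set_val (p (clamp t2))).2) = false.
  by rewrite leNgt (L t2) //; lra.
have l3 : (0 <= (set_val (p (clamp t3))).2) = false.
  by rewrite leNgt (L t3) //; lra.
have u4 : 0 <= (set_val (p (clamp t4))).2 by apply/ltW/U2; lra.
have u5 : 0 <= (set_val (p (clamp 1))).2 by apply/ltW/U2; lra.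
have cj : col (set_val (p (clamp t1))) = j by apply/col_strip/S1; lra.
have ck : col (set_val (p (clamp t3))) = k by apply/col_strip/S2; lra.
move: e1 e2 e3 e4 e5; rewrite /cut_cocycle u0 u1 l2 l3 u4 u5 cj ck h0 -h1.
by move=> e1 e2 e3 e4 ->; rewrite e4 e3 e2 e1.
Qed.

End cut_cocycle.
End cuts.

(** * Generators of the fundamental group of the twice-punctured plane *)

Section generation.
Variable R : realType.
Local Notation I := (unit_itv R).
Local Notation E := (set_type (@twice_punctured R)).
Local Notation into C p := (forall t, C (set_val (p t))).

Definition pt (a : R * R) (pa : twice_punctured a) : E :=
  exist (fun a => a \in @twice_punctured R) a (mem_set pa).

Fact orig_punctured : twice_punctured ((0, 0) : R * R).
Proof. by split=> -[] /eqP; rewrite eq_sym ?oppr_eq0 oner_eq0. Qed.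

Fact base_punctured : twice_punctured ((0, 2) : R * R).
Proof. by split=> -[_ /eqP]; rewrite pnatr_eq0. Qed.

Definition orig : E := pt orig_punctured.
Definition base : E := pt base_punctured.

Lemma orig_upperM : upper gapM (set_val orig).
Proof. by right; split => //=; rewrite oppr_lt0 ltr01. Qed.

Lemma orig_lowerM : lower gapM (set_val orig).
Proof. by right; split => //=; rewrite oppr_lt0 ltr01. Qed.

Lemma base_upper j : upper j (set_val base).
Proof. by left; rewrite /= ltr0n. Qed.

Let useg j (x : E) : upper j (set_val x) ->
  exists p : {path I from base to x}, into (upper j) p.
Proof.
exact: (segment_exists (@upper_convex R j) (@upper_punctured R j) (base_upper j)).
Qed.

(** By convexity, all paths inside the allowed region have the same class. The class is packaged
    with this characterisation so that later any convenient path may represent it. *)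
Lemma ray_exists (x : E) : exists k : path_class R base x,
  (0 <= (set_val x).2 -> forall p : {path I from base to x},
     into (upper (col (set_val x))) p -> k = cls p) /\
  ((set_val x).2 < 0 -> forall (p : {path I from base to orig})
     (q : {path I from orig to x}), into (upper gapM) p -> into (lower gapM) q ->
     k = cmp (cls p) (cls q)).
Proof.
have px := set_mem (valP x).
case: (ltP (set_val x).2 0) => x2.
  have [p Hp] := useg orig_upperM.
  have lx : lower gapM (set_val x) by left.
  have [q Hq] := segment_exists (@lower_convex R gapM) (@lower_punctured R gapM)
    orig_lowerM lx.
  exists (cmp (cls p) (cls q)); split=> // _ p' q' Hp' Hq'.
  congr (cmp _ _).
    exact: (convex_cls (@upper_convex R gapM) (@upper_punctured R gapM)).
  exact: (convex_cls (@lower_convex R gapM) (@lower_punctured R gapM)).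
have [p Hp] := useg (upper_col px x2).
exists (cls p); split=> // _ p' Hp'.
exact: (convex_cls (@upper_convex R _) (@upper_punctured R _) Hp Hp').
Qed.

(* The straight path from the base point to a point of the closed upper half
   plane; points below the axis are reached through the origin. *)
Definition ray (x : E) : path_class R base x := projT1 (cid (ray_exists x)).

Lemma ray_upper (x : E) (p : {path I from base to x}) :
  0 <= (set_val x).2 -> into (upper (col (set_val x))) p -> ray x = cls p.
Proof. by move=> x2 Hp; rewrite /ray; case: cid => k [/= + _]; exact. Qed.

Lemma ray_lower (x : E) (p : {path I from base to orig})
    (q : {path I from orig to x}) : (set_val x).2 < 0 ->
  into (upper gapM) p -> into (lower gapM) q -> ray x = cmp (cls p) (cls q).
Proof. by move=> x2 Hp Hq; rewrite /ray; case: cid => k [/= _]; exact. Qed.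

Lemma ray_base : ray base = cid1 R base.
Proof.
apply: ray_upper => [|t]; first by rewrite /= ler0n.
exact: base_upper.
Qed.

Section ray_steps.
Variables x y : E.
Implicit Types r : {path I from x to y}.

Lemma ray_upper0 r : into (@upper0 R) r -> cmp (ray x) (cls r) = ray y.
Proof.
move=> Hr.
have x0 : upper0 (set_val x) by have := Hr zero; rewrite path_zero.
have y0 : upper0 (set_val y) by have := Hr one; rewrite path_one.
have b0 : upper0 (set_val base) by rewrite /upper0 /= ltr0n.
have seg := segment_exists (@upper0_convex R) (@upper0_punctured R) b0.
have [p Hp] := seg x x0; have [q Hq] := seg y y0.
rewrite (ray_upper (ltW x0) (p := p)); last by move=> t; left; exact: Hp.
rewrite (ray_upper (ltW y0) (p := q)); last by move=> t; left; exact: Hq.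
exact: (convex_cmp (@upper0_convex R) (@upper0_punctured R)).
Qed.

Lemma ray_lower0 r : into (@lower0 R) r -> cmp (ray x) (cls r) = ray y.
Proof.
move=> Hr.
have x0 : lower0 (set_val x) by have := Hr zero; rewrite path_zero.
have y0 : lower0 (set_val y) by have := Hr one; rewrite path_one.
have [p Hp] := useg orig_upperM.
have seg := segment_exists (@lower_convex R gapM) (@lower_punctured R gapM) orig_lowerM.
have [q Hq] := seg x (or_introl x0); have [q' Hq'] := seg y (or_introl y0).
rewrite (ray_lower x0 Hp Hq) (ray_lower y0 Hp Hq') -cmpA; congr (cmp _ _).
apply: (convex_cmp (@lower_convex R gapM) (@lower_punctured R gapM)) => // t.
by left; exact: Hr.
Qed.

Lemma ray_strip_upper j r : into (strip j) r -> 0 <= (set_val x).2 ->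
  0 <= (set_val y).2 -> cmp (ray x) (cls r) = ray y.
Proof.
move=> Hr x2 y2.
have xj : strip j (set_val x) by have := Hr zero; rewrite path_zero.
have yj : strip j (set_val y) by have := Hr one; rewrite path_one.
pose C := strip j `&` [set a : R * R | 0 <= a.2].
have CC : convex2 C by apply: convex2I; [exact: strip_convex|exact: closed_upper_convex].
have CP : C `<=` @twice_punctured R by move=> a [/strip_punctured].
have [s Hs] : exists s : {path I from x to y}, into C s by exact: segment_exists.
have CU : C `<=` upper j.
  by move=> a [aj]; rewrite /= le_eqVlt => /orP[/eqP a0|a0]; [right|left].
have px := set_mem (valP x); have py := set_mem (valP y).
have [p Hp] := useg (upper_col px x2); have [q Hq] := useg (upper_col py y2).
rewrite (ray_upper x2 Hp) (ray_upper y2 Hq).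
rewrite (col_strip xj) in Hp; rewrite (col_strip yj) in Hq.
have -> : cls r = cls s.
  apply: (convex_cls (@strip_convex R j) (@strip_punctured R j)) => // t.
  by have [] := Hs t.
by apply: (convex_cmp (@upper_convex R j) (@upper_punctured R j)) => // t; exact: CU.
Qed.

Lemma ray_strip_lower j r : into (strip j) r -> (set_val x).2 < 0 ->
  (set_val y).2 < 0 -> cmp (ray x) (cls r) = ray y.
Proof.
move=> Hr x2 y2.
have xj : strip j (set_val x) by have := Hr zero; rewrite path_zero.
have yj : strip j (set_val y) by have := Hr one; rewrite path_one.
pose C := strip j `&` @lower0 R.
have CC : convex2 C by apply: convex2I; [exact: strip_convex|exact: lower0_convex].
have CP : C `<=` @twice_punctured R by move=> a [/strip_punctured].
have [s Hs] : exists s : {path I from x to y}, into C s by exact: segment_exists.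
have -> : cls r = cls s.
  apply: (convex_cls (@strip_convex R j) (@strip_punctured R j)) => // t.
  by have [] := Hs t.
by apply: ray_lower0 => t; have [] := Hs t.
Qed.

End ray_steps.

Definition mid j : R :=
  match j with gapL => - 2 | gapM => 0 | gapR => 2 end.

Lemma mid_strip j (y : R) : strip j (mid j, y).
Proof. by case: j => /=; rewrite ?ltr1n ?ltrN2 ?ltr1n // oppr_lt0 ltr01. Qed.

Definition midpt j (y : R) : E := pt (@strip_punctured R j _ (mid_strip j y)).

Lemma crossing_exists j : exists s : {path I from midpt j 0 to midpt j (-1)},
  into (strip j `&` lower j) s.
Proof.
apply: segment_exists.
- by apply: convex2I; [exact: strip_convex|exact: lower_convex].
- by move=> a [/strip_punctured].
- by split; [exact: mid_strip|right; split => //; exact: mid_strip].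
- by split; [exact: mid_strip|left; rewrite /= oppr_lt0 ltr01].
Qed.

Definition crossing j := projT1 (cid (crossing_exists j)).

Lemma crossingP j : into (strip j `&` lower j) (crossing j).
Proof. by rewrite /crossing; case: cid. Qed.

(* Down through the gap [j], back to the base point through the middle gap. *)
Definition gap_loop j : pi1 R base :=
  cmp (cmp (ray (midpt j 0)) (cls (crossing j))) (cinv (ray (midpt j (-1)))).

(** [midpt gapM 0] is the origin, through which all points below the axis are reached, so the ray
    followed by the descent through the middle gap is itself a ray. *)
Lemma gap_loopM : gap_loop gapM = 1%g.
Proof.
have E0 : midpt gapM 0 = orig by exact: val_inj.
rewrite /gap_loop.
have [p Hp] := useg orig_upperM.
have l : (set_val (midpt gapM (-1))).2 < 0 by rewrite /= oppr_lt0 ltr01.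
have -> : ray (midpt gapM (-1)) =
    cmp (ray (midpt gapM 0)) (cls (crossing gapM)); last by rewrite cmpcV.
have Hs := @crossingP gapM.
move: (crossing gapM) Hs; rewrite E0 => s Hs.
rewrite (ray_lower l Hp (q := s)); last by move=> t; have [] := Hs t.
congr (cmp _ _); rewrite (ray_upper (p := p)) //=.
by rewrite (@col_strip R gapM) //; have := mid_strip gapM 0.
Qed.

(** Inside a convex strip the descent may be rerouted along the standard crossing of that gap; what
    precedes and follows the crossing is absorbed in the rays. *)
Lemma ray_strip_down j (x y : E) (r : {path I from x to y}) :
  into (strip j) r -> 0 <= (set_val x).2 -> (set_val y).2 < 0 ->
  cmp (ray x) (cls r) = cmp (gap_loop j) (ray y).
Proof.
move=> Hr x2 y2.
have xj : strip j (set_val x) by have := Hr zero; rewrite path_zero.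
have yj : strip j (set_val y) by have := Hr one; rewrite path_one.
have seg := segment_exists (@strip_convex R j) (@strip_punctured R j).
have [s Hs] := seg _ (midpt j 0) xj (mid_strip j 0).
have [s' Hs'] := seg (midpt j (-1)) _ (mid_strip j (-1)) yj.
have Hc : into (strip j) (crossing j) by move=> t; have [] := crossingP j t.
have -> : cls r = cmp (cmp (cls s) (cls (crossing j))) (cls s').
  rewrite !cmpE; apply: (convex_cls (@strip_convex R j) (@strip_punctured R j)) => //.
  by apply: concat_in => //; exact: concat_in.
rewrite !cmpA (ray_strip_upper Hs) //.
have l1 : (set_val (midpt j (-1))).2 < 0 by rewrite /= oppr_lt0 ltr01.
rewrite -(ray_strip_lower Hs' l1 y2).
by rewrite cmpA /gap_loop cmpcVK.
Qed.

Lemma ray_strip_up j (x y : E) (r : {path I from x to y}) :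
  into (strip j) r -> (set_val x).2 < 0 -> 0 <= (set_val y).2 ->
  cmp (ray x) (cls r) = cmp (cinv (gap_loop j)) (ray y).
Proof.
move=> Hr x2 y2; have Hr' := reverse_in Hr.
have := ray_strip_down Hr' y2 x2; rewrite -cinvE => H.
by rewrite -[ray x](cmp1c) -(cmpVc (gap_loop j)) -(cmpA (cinv _)) -H -cmpA cmpcVK.
Qed.

Section words.
Implicit Types v : {path I from base to base}.

Definition word_step (x y : E) : pi1 R base :=
  let a := set_val x in let b := set_val y in
  if 0 <= a.2 then (if 0 <= b.2 then 1%g else gap_loop (col a))
  else (if 0 <= b.2 then (gap_loop (col a))^-1%g else 1%g).

Lemma word_stepE (x y : E) (r : {path I from x to y}) :
  [\/ into (@upper0 R) r, into (@lower0 R) r | exists j, into (strip j) r] ->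
  cmp (ray x) (cls r) = cmp (word_step x y) (ray y).
Proof.
move=> [Hr|Hr|[j Hr]].
- have x0 : upper0 (set_val x) by have := Hr zero; rewrite path_zero.
  have y0 : upper0 (set_val y) by have := Hr one; rewrite path_one.
  by rewrite /word_step !ltW // pi1_onegE cmp1c; exact: ray_upper0.
- have x0 : lower0 (set_val x) by have := Hr zero; rewrite path_zero.
  have y0 : lower0 (set_val y) by have := Hr one; rewrite path_one.
  by rewrite /word_step !(leNgt 0) x0 y0 /= pi1_onegE cmp1c; exact: ray_lower0.
- have xj : strip j (set_val x) by have := Hr zero; rewrite path_zero.
  have yj : strip j (set_val y) by have := Hr one; rewrite path_one.
  rewrite /word_step (col_strip xj).
  case: (leP 0 (set_val x).2) => x2; case: (leP 0 (set_val y).2) => y2.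
  + by rewrite pi1_onegE cmp1c; exact: ray_strip_upper Hr _ _.
  + exact: ray_strip_down Hr _ _.
  + exact: ray_strip_up Hr _ _.
  + by rewrite pi1_onegE cmp1c; exact: ray_strip_lower Hr _ _.
Qed.

Let G (j : gap) (s : pi1 R base) : pi1 R base := (s * gap_loop j)%g.
Let G' (j : gap) (s : pi1 R base) : pi1 R base := (s * (gap_loop j)^-1)%g.
Fact gap_mulK j : cancel (G j) (G' j). Proof. by move=> s; exact: mulgK. Qed.
Fact gap_mulVK j : cancel (G' j) (G j). Proof. by move=> s; exact: mulgVK. Qed.

Lemma word_cocycleE x y s : cut_cocycle G G' x y s = (s * word_step x y)%g.
Proof.
rewrite /cut_cocycle /word_step.
by case: (0 <= _); case: (0 <= _); rewrite ?mulg1.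
Qed.

(* The crossings of [v], read as a product of gap loops; it equals the class of
   [v] because [t |-> (v up to time t, then back along the ray)] is parallel. *)
Definition word v : pi1 R base :=
  hol (cut_local_cocycle R gap_mulK gap_mulVK) v 1%g.

Lemma wordE v : word v = \pi_(pi1 R base) v.
Proof.
pose V (t : R) := v (clamp t).
have cV : continuous V by apply/path_comp_continuous/clamp_continuous.
have V0 : V 0 = base by exact: path_zero.
have V1 : V 1 = base by exact: path_one.
(* End points are recorded through equations, since [V 0] and [base] are only provably equal and the
   type of a path class depends on its end points. *)
pose arc s t x y (hx : V s = x) (hy : V t = y) : path_class R x y :=
  cls (map_path cV hx hy (line s t)).
pose K t x (hx : V t = x) : pi1 R base := cmp (arc _ _ _ _ V0 hx) (cinv (ray x)).
have Kirr t x y (hx : V t = x) (hy : V t = y) : K _ _ hx = K _ _ hy.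
  by case: _ / hx in hy *; case: _ / hy.
have arcM r s t x y z (hx : V r = x) (hy : V s = y) (hz : V t = z) :
    cmp (arc _ _ _ _ hx hy) (arc _ _ _ _ hy hz) = arc _ _ _ _ hx hz.
  rewrite /arc cmpE -(map_path_concat cV hx hy hz); apply/cls_eqP.
  exact/map_path_homotopic/real_homotopic.
pose k t := K t (V t) erefl.
have kpar : parallel (cut_cocycle G G') V k.
  have cf : continuous (fun d : R * R => V d.1).
    by move=> d; apply: continuous_comp; [exact: cvg_fst|exact: cV].
  (* These are the regions behind the local cocycle; here the kind of region must be known, because
     [word_stepE] reroutes the arc inside it. *)
  pose good (N : set E) := [\/ N `<=` [set x | upper0 (set_val x)],
    N `<=` [set x | lower0 (set_val x)] |
    exists j, N `<=` [set x | strip j (set_val x)]].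
  have loc (x : E) : exists2 N, good N & nbhs x N.
    have c1 := @set_val_fst_continuous R (@twice_punctured R).
    have c2 := @set_val_snd_continuous R (@twice_punctured R).
    case: (ltgtP (set_val x).2 0) => x2.
    - exists [set x | lower0 (set_val x)]; first by constructor 2.
      exact: (cvgr_lt _ (c2 x) _ x2).
    - exists [set x | upper0 (set_val x)]; first by constructor 1.
      exact: (cvgr_gt _ (c2 x) _ x2).
    - have := strip_col (set_mem (valP x)) x2; move: (col _) => j xj.
      exists [set x | strip j (set_val x)]; first by constructor 3; exists j.
      case: j xj => /= xj.
      + exact: (cvgr_lt _ (c1 x) _ xj).
      + case/andP: xj => l r.
        have A1 : \forall y \near x, -1 < (set_val y).1 by exact: (cvgr_gt _ (c1 x) _ l).
        have A2 : \forall y \near x, (set_val y).1 < 1 by exact: (cvgr_lt _ (c1 x) _ r).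
        by move: A1 A2; apply: filterS2 => y y1 y2; apply/andP.
      + exact: (cvgr_gt _ (c1 x) _ xj).
  have [eps eps0 L] := square_lebesgue cf loc.
  exists eps => // s t s1 t1 st; rewrite word_cocycleE.
  have [|N gN HN] := L (s, 0); first by rewrite /in_square /= s1 lexx ler01.
  have Ha u : N (map_path cV (erefl (V s)) (erefl (V t)) (line s t) u).
    apply: (HN (line s t u, 0)); rewrite /sq_close /= subrr normr0 eps0 andbT.
    rewrite /mk_path /line_fun.
    have -> : s - ((1 - set_val u) * s + set_val u * t) = set_val u * (s - t) by ring.
    have /andP[u0 u1] := itvP u.
    by rewrite normrM ger0_norm //; apply: le_lt_trans st; rewrite ler_piMl.
  have step : cmp (ray (V s)) (arc _ _ _ _ erefl erefl) =
      cmp (word_step (V s) (V t)) (ray (V t)).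
    apply: word_stepE; case: gN => [HU|HL|[j HS]].
    - by constructor 1 => u; exact/HU/Ha.
    - by constructor 2 => u; exact/HL/Ha.
    - by constructor 3; exists j => u; exact/HS/Ha.
  rewrite /k /K -(arcM _ _ _ _ _ _ V0 (erefl (V s)) (erefl (V t))).
  rewrite pi1_mulgE -!cmpA; congr (cmp _ _).
  have -> : arc s t _ _ erefl erefl =
      cmp (cinv (ray (V s))) (cmp (word_step (V s) (V t)) (ray (V t))).
    by rewrite -step cmpA cmpVc cmp1c.
  by rewrite cmpA cmpcK.
have k0 : k 0 = 1%g.
  rewrite /k (Kirr _ _ _ _ V0) /K ray_base pi1_onegE.
  have -> : arc _ _ _ _ V0 V0 = cid1 R base.
    congr cls; apply/path_eqP => u; rewrite /= /mk_path /= /mk_path /line_fun.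
    by rewrite !mulr0 addr0 V0.
  by rewrite cmpcV.
have k1 : k 1 = \pi_(pi1 R base) v.
  rewrite /k (Kirr _ _ _ _ V1) /K ray_base.
  have -> : arc _ _ _ _ V0 V1 = cls v.
    congr cls; apply/path_eqP => u; rewrite /= /mk_path /= /mk_path /line_fun.
    by rewrite mulr0 add0r mulr1 /V clampK.
  by rewrite (cinv_eq (cmp1c (cid1 R base))) cmpc1.
by apply: hol_eq; exists k.
Qed.

(** By [wordE] a loop is the end value of a transport that starts at 1 and multiplies, at each small
    step, by a gap loop, its inverse or 1. Generation is stated as an induction principle. *)
Lemma pi1_gen (P : pi1 R base -> Prop) : P 1%g ->
  (forall a b, P a -> P b -> P (a * b)%g) -> (forall a, P a -> P a^-1%g) ->
  P (gap_loop gapL) -> P (gap_loop gapR) -> forall a, P a.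
Proof.
move=> P1 PM PV PL PR; elim/quotP => v _; rewrite -wordE /word.
have Pg j : P (gap_loop j) by case: j => //; rewrite gap_loopM.
have [h [[eps eps0 hP] h0 <-]] := holP (cut_local_cocycle R gap_mulK gap_mulVK) v 1%g.
suff : forall t, 0 <= t <= 1 -> P (h t) by apply; rewrite ler01 lexx.
apply: unit_interval_ind; last by rewrite h0.
exists eps => // s t s1 t1 st Ps; rewrite (hP s) // word_cocycleE.
apply: PM => //; rewrite /word_step.
by case: (0 <= _); case: (0 <= _) => //; apply: PV.
Qed.

Lemma pi1_dips (v : {path I from base to base}) j k : dips v j k ->
  \pi_(pi1 R base) v = (gap_loop j * (gap_loop k)^-1)%g.
Proof. by move=> vd; rewrite -wordE /word (hol_dips _ _ _ vd) /G /G' mul1g. Qed.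

End words.
End generation.

(** * Configurations of two points *)

Section complex_pairs.
Variable R : realType.
Implicit Types a b d z w : R * R.

Definition cmul a b : R * R := (a.1 * b.1 - a.2 * b.2, a.1 * b.2 + a.2 * b.1).
Definition cdiv z w : R * R := (inner w z / sqnorm w, cross w z / sqnorm w).

Lemma pairP a b : a.1 = b.1 -> a.2 = b.2 -> a = b.
Proof. by case: a b => [? ?] [? ?] /= -> ->. Qed.

Lemma cmul_div z w : w <> 0 -> cmul w (cdiv z w) = z.
Proof.
move=> /sqnorm_gt0 /lt0r_neq0; rewrite /sqnorm => w0.
by apply: pairP; rewrite /cmul /cdiv /inner /cross /sqnorm /=; field.
Qed.

Lemma cdiv_mul z w : w <> 0 -> cdiv (cmul w z) w = z.
Proof.
move=> /sqnorm_gt0 /lt0r_neq0; rewrite /sqnorm => w0.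
by apply: pairP; rewrite /cmul /cdiv /inner /cross /sqnorm /=; field.
Qed.

Lemma sqnormM a b : sqnorm (cmul a b) = sqnorm a * sqnorm b.
Proof. by rewrite /sqnorm /cmul /=; ring. Qed.

Lemma sqnorm0 : sqnorm (0 : R * R) = 0.
Proof. by rewrite /sqnorm /= expr0n /= addr0. Qed.

Lemma cmul_neq0 a b : a <> 0 -> b <> 0 -> cmul a b <> 0.
Proof.
move=> /sqnorm_gt0 a0 /sqnorm_gt0 b0 /(congr1 (@sqnorm R)).
by rewrite sqnormM sqnorm0 => /eqP; rewrite gt_eqF // mulr_gt0.
Qed.

Lemma cmul_eq0 a b : cmul a b = 0 -> a = 0 \/ b = 0.
Proof.
move=> ab; case: (pselect (a = 0)) => a0; [by left|right].
by apply: contrapT => b0; exact: (cmul_neq0 a0 b0).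
Qed.

Lemma csqr_eq a b : cmul a a = cmul b b -> a = b \/ a = - b.
Proof.
move=> E; have : cmul (a - b) (a + b) = 0.
  have E1 := congr1 fst E; have E2 := congr1 snd E.
  by apply: pairP; move: E1 E2; rewrite /cmul /= => E1 E2; lra.
by case/cmul_eq0 => /eqP; rewrite ?subr_eq0 ?addr_eq0 => /eqP; [left|right].
Qed.

(* The configuration [{a, b}] is recorded by [d = a - b] and [u = (a + b) / (a - b)]. *)
Definition fst_pt d (u : R * R) : R * R :=
  ((d.1 * (u.1 + 1) - d.2 * u.2) / 2, (d.1 * u.2 + d.2 * (u.1 + 1)) / 2).
Definition snd_pt d (u : R * R) : R * R :=
  ((d.1 * (u.1 - 1) - d.2 * u.2) / 2, (d.1 * u.2 + d.2 * (u.1 - 1)) / 2).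

Lemma pts_sub d u : fst_pt d u - snd_pt d u = d.
Proof. by apply: pairP; rewrite /fst_pt /snd_pt /=; field. Qed.

Lemma pts_add d u : fst_pt d u + snd_pt d u = cmul d u.
Proof. by apply: pairP; rewrite /fst_pt /snd_pt /cmul /=; field. Qed.

Definition valid : set ((R * R) * (R * R)) :=
  [set y | [/\ y.1 <> 0, y.2 <> 0 & y.1 <> y.2]].

Lemma valid_pts d u : d <> 0 -> twice_punctured u -> valid (fst_pt d u, snd_pt d u).
Proof.
move=> d0 [u1 u2]; split => /=.
- have -> : fst_pt d u = cmul d ((u.1 + 1) / 2, u.2 / 2).
    by apply: pairP; rewrite /cmul /fst_pt /=; field.
  apply: cmul_neq0 => // E; apply: u2; apply: pairP => /=.
    by have /= := congr1 fst E; lra.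
  by have /= := congr1 snd E; lra.
- have -> : snd_pt d u = cmul d ((u.1 - 1) / 2, u.2 / 2).
    by apply: pairP; rewrite /cmul /snd_pt /=; field.
  apply: cmul_neq0 => // E; apply: u1; apply: pairP => /=.
    by have /= := congr1 fst E; lra.
  by have /= := congr1 snd E; lra.
- by move=> E; apply: d0; rewrite -(pts_sub d u) E subrr.
Qed.

(** Both [d] and [a - b] are square roots of the discriminant, so they agree up to sign; the
    opposite sign exchanges the two points. *)
Lemma punctured_quotient a b d : valid (a, b) -> cmul d d = cmul (a - b) (a - b) ->
  twice_punctured (cdiv (a + b) d) /\
  (fst_pt d (cdiv (a + b) d), snd_pt d (cdiv (a + b) d)) = (a, b) \/
  twice_punctured (cdiv (a + b) d) /\
  (fst_pt d (cdiv (a + b) d), snd_pt d (cdiv (a + b) d)) = (b, a).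
Proof.
move=> [/= a0 b0 ab] E.
have d0 : d <> 0.
  move=> d0; move: E; rewrite d0 => E.
  have : cmul (a - b) (a - b) = 0 by rewrite -E; apply: pairP; rewrite /cmul /=; ring.
  by case/cmul_eq0 => /eqP; rewrite subr_eq0 => /eqP.
have add := cmul_div (a + b) d0; move: (cdiv _ _) add => u add.
have gen f s : f + s = a + b -> f - s = d -> f + f = (a + b) + d /\ s + s = (a + b) - d.
  by move=> <- <-; split; apply: pairP => /=; ring.
have [|f2 s2] := gen _ _ _ (pts_sub d u); first by rewrite pts_add.
have pu : fst_pt d u <> 0 -> snd_pt d u <> 0 -> twice_punctured u.
  move=> f0 s0; split=> uE.
    by apply: s0; rewrite uE; apply: pairP; rewrite /snd_pt /=; ring.
  by apply: f0; rewrite uE; apply: pairP; rewrite /fst_pt /=; ring.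
have half x y : x + x = y + y -> x = y :> R * R.
  move=> xy; have /= := congr1 fst xy; have /= := congr1 snd xy.
  by move=> ? ?; apply: pairP; lra.
case: (csqr_eq E) => dE; [left|right].
- have fa : fst_pt d u = a by apply: half; rewrite f2 dE; apply: pairP => /=; ring.
  have sb : snd_pt d u = b by apply: half; rewrite s2 dE; apply: pairP => /=; ring.
  by rewrite fa sb; split => //; apply: pu; rewrite ?fa ?sb.
- have fa : fst_pt d u = b by apply: half; rewrite f2 dE; apply: pairP => /=; ring.
  have sb : snd_pt d u = a by apply: half; rewrite s2 dE; apply: pairP => /=; ring.
  by rewrite fa sb; split => //; apply: pu; rewrite ?fa ?sb.
Qed.

End complex_pairs.

(** * Planar coordinates and symmetric functions on the configuration space *)

Section coordinates.
Variables (R : realType) (x1 x2 e1 e2 : 'rV[R]_3).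
Hypotheses (x1_sphere : sphere2 x1) (x2_sphere : sphere2 x2) (x1x2 : x1 <> x2).
Hypothesis on : orthonormal3 e1 e2 x1.
Local Notation M := (punctured_sphere x1 x2).

(** The rows of [B] are orthonormal, and a one-sided inverse of a square matrix is two-sided; the
    expansion is [v *m B^T *m B = v]. *)
Lemma frame_expand (v : 'rV[R]_3) :
  v = dot v e1 *: e1 + dot v e2 *: e2 + dot v x1 *: x1.
Proof.
pose B : 'M[R]_3 := \matrix_(i < 3, j < 3) (nth 0 [:: e1; e2; x1] i) 0 j.
have dotE u i : (u *m B^T) 0 i = dot u (nth 0 [:: e1; e2; x1] i).
  by rewrite !mxE; apply: eq_bigr => k _; rewrite !mxE.
have BB : B *m B^T = 1%:M.
  apply/matrixP => i j.
  have -> : (B *m B^T) i j = dot (nth 0 [:: e1; e2; x1] i) (nth 0 [:: e1; e2; x1] j).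
    by rewrite !mxE; apply: eq_bigr => k _; rewrite !mxE.
  rewrite mxE; case: on => -[d11 d22 dxx] [d12 d1x d2x].
  by case: i => [[|[|[|//]]] ?]; case: j => [[|[|[|//]]] ?] //=;
    rewrite -?val_eqE /= ?d11 ?d22 ?dxx ?d12 ?d1x ?d2x // dotC ?d12 ?d1x ?d2x.
have : v *m B^T *m B = v by rewrite -mulmxA (mulmx1C BB) mulmx1.
move=> {1}<-; apply/rowP => j; rewrite mxE !big_ord_recl big_ord0 !dotE !mxE /=.
by rewrite addr0 addrA.
Qed.

Lemma dot_frame (v : 'rV[R]_3) :
  dot v v = dot v e1 ^+ 2 + dot v e2 ^+ 2 + dot v x1 ^+ 2.
Proof.
rewrite {1}(frame_expand v) !(dotDl, dotZl) !expr2.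
by rewrite (dotC e1 v) (dotC e2 v) (dotC x1 v).
Qed.

Lemma sphere_height (v : 'rV[R]_3) : sphere2 v -> v <> x1 -> 1 - dot v x1 != 0.
Proof.
move=> Sv vx; apply/eqP => E; have c1 : dot v x1 = 1 by lra.
have := dot_frame v; rewrite (Sv : dot v v = 1) c1 => F; apply: vx.
rewrite (frame_expand v) c1.
have -> : dot v e1 = 0 by nra.
have -> : dot v e2 = 0 by nra.
by rewrite !scale0r scale1r !add0r.
Qed.

Lemma stereoK (v : 'rV[R]_3) : sphere2 v -> v <> x1 ->
  stereo_inv x1 e1 e2 (stereo x1 e1 e2 v) = v.
Proof.
move=> Sv vx; have h := sphere_height Sv vx.
have F := dot_frame v; rewrite (Sv : dot v v = 1) in F.
rewrite [RHS](frame_expand v) /stereo_inv /stereo /=.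
move: (dot v e1) (dot v e2) (dot v x1) h F => A B C h F.
have C0 : (A / (1 - C)) ^+ 2 + (B / (1 - C)) ^+ 2 + 1 = 2 / (1 - C).
  have F' : A ^+ 2 + B ^+ 2 = 1 - C ^+ 2 by rewrite F; ring.
  have -> : (A / (1 - C)) ^+ 2 + (B / (1 - C)) ^+ 2 + 1 =
      (A ^+ 2 + B ^+ 2 + (1 - C) ^+ 2) / (1 - C) ^+ 2 by field.
  by rewrite F'; field.
have C1 : (A / (1 - C)) ^+ 2 + (B / (1 - C)) ^+ 2 - 1 = 2 * C / (1 - C).
  have -> : 2 * C / (1 - C) = 2 / (1 - C) - 2 by field.
  by rewrite -C0; ring.
rewrite C0 C1 !scalerDr !scalerA.
by congr (_ *: _ + _ *: _ + _ *: _); field.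
Qed.

Lemma x2_neq1 : x2 <> x1. Proof. by move=> E; apply: x1x2. Qed.

Definition crd (v : M) : R * R :=
  stereo x1 e1 e2 (set_val v) - stereo x1 e1 e2 x2.

Lemma memM (v : M) : [/\ sphere2 (set_val v), set_val v <> x1 & set_val v <> x2].
Proof.
have [S N] := set_mem (valP v); split => // E; apply: N; [left|right] => //.
Qed.

Lemma crd_neq0 (v : M) : crd v <> 0.
Proof.
move=> /eqP; rewrite subr_eq0 => /eqP E; have [S1 N1 N2] := memM v.
by apply: N2; rewrite -(stereoK S1 N1) E stereoK //; exact: x2_neq1.
Qed.

Lemma crd_chart w (w0 : w <> 0) : crd (chart x2 on w0) = w.
Proof. by rewrite /crd set_valE /= stereo_invK // addrC addKr. Qed.

Lemma chart_crd (v : M) (v0 : crd v <> 0) : chart x2 on v0 = v.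
Proof.
apply: val_inj => /=; rewrite /crd addrC subrK.
by have [S1 N1 N2] := memM v; exact: stereoK.
Qed.

Lemma dot_continuous (u : 'rV[R]_3) : continuous (fun v => dot v u).
Proof.
rewrite /dot; under eq_fun do rewrite !big_ord_recl big_ord0.
have cc (i : 'I_3) : continuous (fun v : 'rV[R]_3 => v 0 i) by exact: coord_continuous.
by cts; exact: cc.
Qed.

Lemma crd_continuous : continuous (fun v => (crd v).1) /\ continuous (fun v => (crd v).2).
Proof.
have cd (u : 'rV[R]_3) : continuous (fun v : M => dot (set_val v) u).
  move=> v; apply: (@continuous_comp _ _ _ (set_val : M -> _) (fun v => dot v u)).
    exact: initial_continuous.
  exact: dot_continuous.
have ci : continuous (fun v : M => (1 - dot (set_val v) x1)^-1).
  apply: ctsV => [v|]; first by have [S1 N1 _] := memM v; exact: sphere_height.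
  by cts; exact: cd.
by split; rewrite /crd /stereo /=; cts; exact: cd.
Qed.

End coordinates.

Section two_points.
Variables (R : realType) (x1 x2 e1 e2 : 'rV[R]_3).
Hypotheses (x1_sphere : sphere2 x1) (x2_sphere : sphere2 x2) (x1x2 : x1 <> x2).
Hypothesis on : orthonormal3 e1 e2 x1.
Local Notation M := (punctured_sphere x1 x2).
Local Notation crd := (@crd R x1 x2 e1 e2).
Local Notation Y := (set_type (@valid R)).

Definition pair_fun (y : (R * R) * (R * R)) (k : 'I_2) : R * R :=
  if k == 0 then y.1 else y.2.

Lemma pair_fun_neq0 y : valid y -> forall k, pair_fun y k <> 0.
Proof. by move=> [y1 y2 _] k; rewrite /pair_fun; case: ifP. Qed.

Lemma pair_fun_inj y : valid y -> injective (pair_fun y).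
Proof.
move=> [_ _ y12] [[|[|//]] ki] [[|[|//]] li]; rewrite /pair_fun /= => E;
  by [apply: val_inj | case: y12 | case: y12; rewrite E].
Qed.

Definition mk_conf y (vy : valid y) : conf 2 M :=
  chart_conf x2 on (pair_fun_neq0 vy) (pair_fun_inj vy).

Definition psi (y : Y) : uconf 2 M := \pi_(uconf 2 M) (mk_conf (set_mem (valP y))).

Lemma psi_eq (y y' : Y) : set_val y = set_val y' -> psi y = psi y'.
Proof. by move=> /val_inj ->. Qed.

Lemma psi_chart_conf (w : 'I_2 -> R * R) w0 w_inj (y : Y) :
  w =1 pair_fun (set_val y) ->
  \pi_(uconf 2 M) (@chart_conf R x1 x2 e1 e2 on 2 w w0 w_inj) = psi y.
Proof. by move=> wy; congr (\pi_(uconf 2 M) _); exact: chart_conf_eq. Qed.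

Lemma psi_continuous : continuous psi.
Proof.
pose cf (y : Y) := mk_conf (set_mem (valP y)).
have ccf : continuous cf.
  apply: conf_continuous => k; apply: continuous_comp_initial.
  pose p := stereo x1 e1 e2 x2.
  have -> : set_val \o (fun y => set_val (cf y) k) =
      fun y => stereo_inv x1 e1 e2 (p.1 + (pair_fun (set_val y) k).1,
                                    p.2 + (pair_fun (set_val y) k).2) by [].
  have c0 : continuous (fun y : Y => set_val y) by exact: initial_continuous.
  have c1 : continuous (fun y : Y => (set_val y).1).
    by move=> y; apply: (@continuous_comp _ _ _ (fun y : Y => set_val y) fst);
      [exact: c0|exact: cvg_fst].
  have c2 : continuous (fun y : Y => (set_val y).2).
    by move=> y; apply: (@continuous_comp _ _ _ (fun y : Y => set_val y) snd);
      [exact: c0|exact: cvg_snd].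
  have cp : continuous (fun y : Y => pair_fun (set_val y) k).
    by rewrite /pair_fun; case: (k == 0).
  have cp1 : continuous (fun y : Y => (pair_fun (set_val y) k).1).
    by move=> y; apply: (@continuous_comp _ _ _ (fun y : Y => pair_fun (set_val y) k) fst);
      [exact: cp|exact: cvg_fst].
  have cp2 : continuous (fun y : Y => (pair_fun (set_val y) k).2).
    by move=> y; apply: (@continuous_comp _ _ _ (fun y : Y => pair_fun (set_val y) k) snd);
      [exact: cp|exact: cvg_snd].
  by apply: stereo_inv_continuous; cts.
move=> y; apply: (@continuous_comp _ _ _ cf (\pi_(uconf 2 M))); first exact: ccf.
exact: pi_uconf_continuous.
Qed.

Definition crds (y : conf 2 M) (k : 'I_2) : R * R := crd (set_val y k).

Lemma crds_valid (y : conf 2 M) : valid (crds y 0, crds y 1).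
Proof.
split=> /=; try exact: crd_neq0.
move=> E; have := set_mem (valP y) => /(_ 0 1) /=.
have v0 := @crd_neq0 R x1 x2 e1 e2 x2_sphere x1x2 on (set_val y 0).
have v1 := @crd_neq0 R x1 x2 e1 e2 x2_sphere x1x2 on (set_val y 1).
have : set_val y 0 = set_val y 1.
  rewrite -(chart_crd on v0) -(chart_crd on v1).
  by apply: val_inj => /=; rewrite [crd _]E.
by move=> + H; move=> /H /(congr1 val).
Qed.

Definition mkY y (vy : valid y) : Y := exist (fun y => y \in @valid R) y (mem_set vy).

Lemma psi_surj (y : uconf 2 M) :
  psi (mkY (crds_valid (repr y))) = y.
Proof.
rewrite -[RHS]reprK; congr (\pi_(uconf 2 M) _); apply: val_inj.
apply/funext => k.
have v0 k := @crd_neq0 R x1 x2 e1 e2 x2_sphere x1x2 on (set_val (repr y) k).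
rewrite -[RHS](chart_crd on (v0 k)); apply: val_inj => /=.
congr (stereo_inv _ _ _ (_ + _)).
by rewrite /pair_fun /crds; case: k => [[|[|//]] i] /=; congr (crd (set_val _ _)); exact: val_inj.
Qed.

Lemma psi_swap a b (vab : valid (a, b)) (vba : valid (b, a)) :
  psi (mkY vab) = psi (mkY vba).
Proof.
apply/eqmodP/asboolP; exists (tperm 0 1) => k; apply: val_inj => /=.
congr (stereo_inv _ _ _ (_ + _)); rewrite /pair_fun /=.
have [->|->] : k = 0 \/ k = 1; last 2 first.
- by rewrite tpermL.
- by rewrite tpermR.
by case: k => [[|[|//]] i]; [left|right]; exact: val_inj.
Qed.

Section symmetric.
Variable f : (R * R) * (R * R) -> R.
Hypothesis f_sym : forall a b, f (a, b) = f (b, a).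

(** The representative orders the two points arbitrarily; the symmetry of [f] makes the value
    independent of that choice. *)
Definition sym_fun (y : uconf 2 M) : R := f (crds (repr y) 0, crds (repr y) 1).

Lemma sym_fun_pi (y : conf 2 M) :
  sym_fun (\pi_(uconf 2 M) y) = f (crds y 0, crds y 1).
Proof.
have : \pi_(uconf 2 M) (repr (\pi_(uconf 2 M) y)) = \pi_(uconf 2 M) y by rewrite reprK.
move=> /eqmodP/asboolP[s Es]; rewrite /sym_fun.
have [s0|s0] : s 0 = 0 /\ s 1 = 1 \/ s 0 = 1 /\ s 1 = 0.
  have : s 0 != s 1 by apply/eqP => /perm_inj /(congr1 val).
  by case: (s 0) (s 1) => [[|[|//]] i] [[|[|//]] j] // _; [left|right];
    split; exact: val_inj.
- by rewrite /crds !Es; case: s0 => -> ->.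
- by rewrite f_sym /crds !Es; case: s0 => -> ->.
Qed.

Lemma sym_fun_psi (y : Y) : sym_fun (psi y) = f (set_val y).
Proof.
rewrite sym_fun_pi /crds /= !crd_chart /pair_fun /=.
by rewrite -surjective_pairing.
Qed.

Lemma sym_fun_continuous :
  (forall (D : topologicalType) (a b : D -> R * R),
    continuous (fun d => (a d).1) -> continuous (fun d => (a d).2) ->
    continuous (fun d => (b d).1) -> continuous (fun d => (b d).2) ->
    continuous (fun d => f (a d, b d))) -> continuous sym_fun.
Proof.
move=> cf.
have [c1 c2] := @crd_continuous R x1 x2 e1 e2 on.
have ck (k : 'I_2) : continuous (fun y : conf 2 M => set_val y k).
  move=> y; apply: (@continuous_comp _ _ _ (set_val : conf 2 M -> {ptws 'I_2 -> M}) (fun g => g k)).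
    exact: initial_continuous.
  exact: proj_continuous.
apply/(@quotient_continuous (conf 2 M) _ R sym_fun).
have -> : sym_fun \o \pi_(uconf 2 M) = fun y => f (crds y 0, crds y 1).
  by apply/funext => y; exact: sym_fun_pi.
by apply: cf => y; rewrite /crds;
  apply: (@continuous_comp _ _ _ (fun y : conf 2 M => set_val y _)
    (fun v => _ (crd v))); by [exact: ck|exact: c1|exact: c2].
Qed.

End symmetric.
End two_points.

(** The only square roots are [d] and [- d], so the inner product with [d] takes at most two
    opposite nonzero values; by the intermediate value theorem it cannot change sign. *)
Lemma root_constant (R : realType) (d : R * R) (del : unit_itv R -> R * R) :
  continuous (fun t => (del t).1) -> continuous (fun t => (del t).2) ->
  (forall t, cmul (del t) (del t) = cmul d d) -> d <> 0 -> del zero = d ->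
  forall t, del t = d.
Proof.
move=> c1 c2 sq d0 del0 t; case: (csqr_eq (sq t)) => // dN.
have S := sqnorm_gt0 d0.
pose f (s : R) := inner d (del (clamp s)).
have cf : continuous f.
  have k1 : continuous (fun s : R => (del (clamp s)).1).
    move=> s; apply: (@continuous_comp _ _ _ (@clamp R) (fun t => (del t).1)).
      exact: clamp_continuous.
    exact: c1.
  have k2 : continuous (fun s : R => (del (clamp s)).2).
    move=> s; apply: (@continuous_comp _ _ _ (@clamp R) (fun t => (del t).2)).
      exact: clamp_continuous.
    exact: c2.
  by rewrite /f /inner; cts.
have f0 : f 0 = sqnorm d by rewrite /f -/zero del0 /inner -!expr2.
have ft : f (set_val t) = - sqnorm d.
  by rewrite /f clampK dN /inner /sqnorm /=; ring.
have /andP[t0 t1] := itvP t.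
have [c _ fc] : exists2 c, c \in `[0, set_val t] & f c = 0.
  apply: IVT => //; first exact: continuous_subspaceT.
  by rewrite f0 ft minElt maxElt; case: ltP => ?; case: ltP => ?; lra.
have : f c ^+ 2 = sqnorm d ^+ 2.
  case: (csqr_eq (sq (clamp c))) => E; rewrite /f E /inner /sqnorm /=; ring.
by rewrite fc expr0n /= => /esym/eqP; rewrite expf_eq0 /= gt_eqF.
Qed.

(** * The double covering by pairs (d, u) *)

Section fibration.
Variables (R : realType) (x1 x2 e1 e2 : 'rV[R]_3).
Hypotheses (x2_sphere : sphere2 x2) (x1x2 : x1 <> x2).
Hypothesis on : orthonormal3 e1 e2 x1.
Local Notation I := (unit_itv R).
Local Notation M := (punctured_sphere x1 x2).
Local Notation U := (uconf 2 M).
Local Notation Y := (set_type (@valid R)).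
Local Notation E := (set_type (@twice_punctured R)).
Local Notation sym_fun := (@sym_fun R x1 x2 e1 e2).
Local Notation psi := (@psi R x1 x2 e1 e2 on).

Definition nonzero : set (R * R) := [set d | d <> 0].
Local Notation Dl := (set_type nonzero).

Lemma memE (u : E) : twice_punctured (set_val u). Proof. exact: set_mem (valP u). Qed.
Lemma memD (d : Dl) : set_val d <> 0. Proof. exact: set_mem (valP d). Qed.
Definition mkE (u : R * R) (hu : twice_punctured u) : E :=
  exist (fun u => u \in @twice_punctured R) u (mem_set hu).
Definition mkD (d : R * R) (hd : d <> 0) : Dl :=
  exist (fun u => u \in nonzero) d (mem_set (hd : nonzero d)).

Definition ssum (y : U) : R * R :=
  (sym_fun (fun ab => ab.1.1 + ab.2.1) y, sym_fun (fun ab => ab.1.2 + ab.2.2) y).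
Definition sdisc (y : U) : R * R :=
  (sym_fun (fun ab => (cmul (ab.1 - ab.2) (ab.1 - ab.2)).1) y,
   sym_fun (fun ab => (cmul (ab.1 - ab.2) (ab.1 - ab.2)).2) y).
Definition sprod (y : U) : R * R :=
  (sym_fun (fun ab => (cmul ab.1 ab.2).1) y, sym_fun (fun ab => (cmul ab.1 ab.2).2) y).

Lemma ssum_psi (y : Y) : ssum (psi y) = (set_val y).1 + (set_val y).2.
Proof. by rewrite /ssum !sym_fun_psi // => *; rewrite /= addrC. Qed.

Lemma sdisc_psi (y : Y) : sdisc (psi y) =
  cmul ((set_val y).1 - (set_val y).2) ((set_val y).1 - (set_val y).2).
Proof.
by rewrite /sdisc !sym_fun_psi // => *; rewrite /cmul /=; ring.
Qed.

Lemma sprod_psi (y : Y) : sprod (psi y) = cmul (set_val y).1 (set_val y).2.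
Proof.
by rewrite /sprod !sym_fun_psi // => *; rewrite /cmul /=; ring.
Qed.

Lemma ssum_continuous : continuous (fun y => (ssum y).1) /\ continuous (fun y => (ssum y).2).
Proof.
split; [refine (sym_fun_continuous on (f := fun ab => ab.1.1 + ab.2.1) _ _)|
        refine (sym_fun_continuous on (f := fun ab => ab.1.2 + ab.2.2) _ _)];
  try (by move=> a b; exact: addrC); by move=> D a b a1 a2 b1 b2; rewrite /cmul /=; cts.
Qed.

Lemma sdisc_continuous : continuous (fun y => (sdisc y).1) /\ continuous (fun y => (sdisc y).2).
Proof.
split; [refine (sym_fun_continuous on (f := fun ab => (cmul (ab.1 - ab.2) (ab.1 - ab.2)).1) _ _)|
        refine (sym_fun_continuous on (f := fun ab => (cmul (ab.1 - ab.2) (ab.1 - ab.2)).2) _ _)];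
  try (by move=> a b; rewrite /cmul /=; ring); by move=> D a b a1 a2 b1 b2; rewrite /cmul /=; cts.
Qed.

Lemma sprod_continuous : continuous (fun y => (sprod y).1) /\ continuous (fun y => (sprod y).2).
Proof.
split; [refine (sym_fun_continuous on (f := fun ab => (cmul ab.1 ab.2).1) _ _)|
        refine (sym_fun_continuous on (f := fun ab => (cmul ab.1 ab.2).2) _ _)];
  try (by move=> a b; rewrite /cmul /=; ring); by move=> D a b a1 a2 b1 b2; rewrite /cmul /=; cts.
Qed.

Lemma sdisc_neq0 y : sdisc y <> 0.
Proof.
rewrite -(psi_surj x2_sphere x1x2 on y) sdisc_psi.
have [_ _ /= ab] := crds_valid x2_sphere x1x2 on (repr y).
by apply: cmul_neq0; rewrite /= => /eqP; rewrite subr_eq0 => /eqP.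
Qed.

Lemma sprod_neq0 y : sprod y <> 0.
Proof.
rewrite -(psi_surj x2_sphere x1x2 on y) sprod_psi.
have [/= a b _] := crds_valid x2_sphere x1x2 on (repr y).
exact: cmul_neq0.
Qed.

Definition Psi (l : Dl * E) : U := psi (mkY (valid_pts (@memD l.1) (memE l.2))).

Lemma ssum_Psi l : ssum (Psi l) = cmul (set_val l.1) (set_val l.2).
Proof. by rewrite ssum_psi /= pts_add. Qed.

Lemma sdisc_Psi l : sdisc (Psi l) = cmul (set_val l.1) (set_val l.1).
Proof. by rewrite sdisc_psi /= pts_sub. Qed.

(** Either square root of the discriminant recovers the configuration: the two choices give the
    points (d, u) and (-d, -u) of one fibre. *)
Lemma Psi_rec (y : U) (d : R * R) : cmul d d = sdisc y ->
  exists (d0 : d <> 0) (hu : twice_punctured (cdiv (ssum y) d)),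
    Psi (mkD d0, mkE hu) = y.
Proof.
move=> E.
have d0 : d <> 0.
  by move=> d0; apply: (@sdisc_neq0 y); rewrite -E d0; apply: pairP; rewrite /cmul /=; ring.
have [a [b [V Y0]]] : exists a b (V : valid (a, b)), psi (mkY V) = y.
  by exists _, _, (crds_valid x2_sphere x1x2 on (repr y)); exact: psi_surj.
have S : ssum y = a + b by rewrite -Y0 ssum_psi.
have E' : cmul d d = cmul (a - b) (a - b) by rewrite E -Y0 sdisc_psi.
exists d0; rewrite S; case: (punctured_quotient V E') => -[hu ab]; exists hu.
  by rewrite -Y0; apply: psi_eq.
have V' : valid (b, a) by have [/= ? ? ab'] := V; split => //= /esym.
by rewrite -Y0 (psi_swap x2 on V V'); apply: psi_eq.
Qed.

Lemma Psi_continuous (D : topologicalType) (del : D -> Dl) (u : D -> E) :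
  continuous del -> continuous u -> continuous (fun d => Psi (del d, u d)).
Proof.
move=> cd cu.
have d1 : continuous (fun t => (set_val (del t)).1).
  move=> t; apply: (@continuous_comp _ _ _ del (fun a : Dl => (set_val a).1)).
    exact: cd.
  exact: set_val_fst_continuous.
have d2 : continuous (fun t => (set_val (del t)).2).
  move=> t; apply: (@continuous_comp _ _ _ del (fun a : Dl => (set_val a).2)).
    exact: cd.
  exact: set_val_snd_continuous.
have u1 : continuous (fun t => (set_val (u t)).1).
  move=> t; apply: (@continuous_comp _ _ _ u (fun a : E => (set_val a).1)).
    exact: cu.
  exact: set_val_fst_continuous.
have u2 : continuous (fun t => (set_val (u t)).2).
  move=> t; apply: (@continuous_comp _ _ _ u (fun a : E => (set_val a).2)).
    exact: cu.
  exact: set_val_snd_continuous.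
pose y (t : D) : Y := mkY (valid_pts (@memD (del t)) (memE (u t))).
have cy : continuous y.
  apply: continuous_comp_initial.
  have -> : set_val \o y = fun t =>
    (((((set_val (del t)).1 * ((set_val (u t)).1 + 1) - (set_val (del t)).2 * (set_val (u t)).2) / 2),
      (((set_val (del t)).1 * (set_val (u t)).2 + (set_val (del t)).2 * ((set_val (u t)).1 + 1)) / 2)),
     ((((set_val (del t)).1 * ((set_val (u t)).1 - 1) - (set_val (del t)).2 * (set_val (u t)).2) / 2),
      (((set_val (del t)).1 * (set_val (u t)).2 + (set_val (del t)).2 * ((set_val (u t)).1 - 1)) / 2))) by [].
  by apply: pair_continuous; apply: pair_continuous; cts.
move=> t; apply: (@continuous_comp _ _ _ y psi); first exact: cy.
exact: psi_continuous.
Qed.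

End fibration.

(** * Lifting to the double covering and the embedding of the slice *)

Section lifting.
Variables (R : realType) (x1 x2 e1 e2 : 'rV[R]_3).
Hypotheses (x2_sphere : sphere2 x2) (x1x2 : x1 <> x2).
Hypothesis on : orthonormal3 e1 e2 x1.
Local Notation I := (unit_itv R).
Local Notation M := (punctured_sphere x1 x2).
Local Notation U := (uconf 2 M).
Local Notation Y := (set_type (@valid R)).
Local Notation E := (set_type (@twice_punctured R)).
Local Notation sym_fun := (@sym_fun R x1 x2 e1 e2).
Local Notation psi := (@psi R x1 x2 e1 e2 on).

Local Notation Dl := (set_type (@nonzero R)).
Local Notation ssum := (@ssum R x1 x2 e1 e2).
Local Notation sdisc := (@sdisc R x1 x2 e1 e2).
Local Notation Psi := (@Psi R x1 x2 e1 e2 on).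
Local Notation sdisc_neq0 := (@sdisc_neq0 R x1 x2 e1 e2 x2_sphere x1x2 on).
Local Notation sdisc_continuous := (@sdisc_continuous R x1 x2 e1 e2 on).
Local Notation ssum_continuous := (@ssum_continuous R x1 x2 e1 e2 on).
(** The difference of the base points (2, -1) and (2, 1). Their sum (4, 0) divided by it is (0, 2),
    whence the choice of [base]. *)
Definition del0 : R * R := (0, - 2).
Fact del0_neq0 : del0 <> 0.
Proof. by move=> /(congr1 snd) /= /eqP; rewrite oppr_eq0 pnatr_eq0. Qed.

Local Notation B0 := (\pi_U (base_conf x2 on)).

(** The slice [d = del0] of the double covering, a copy of C \ {1, -1} mapped to the configuration
    space. *)
Definition iota (u : E) : U := Psi (mkD del0_neq0, u).

Lemma iota_continuous : continuous iota.
Proof.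
have c1 : continuous (fun _ : E => mkD del0_neq0) by exact: cst_continuous.
have c2 : continuous (fun u : E => u) by move=> t; exact: cvg_id.
exact: (@Psi_continuous R x1 x2 e1 e2 on _ _ _ c1 c2).
Qed.

Lemma iota_base : iota (base R) = B0.
Proof.
apply/esym/psi_chart_conf => k.
by rewrite /base_pt /pair_fun /=; case: (k == 0); apply: pairP => /=; field.
Qed.

Lemma sdisc_base : sdisc B0 = cmul del0 del0.
Proof. by rewrite -iota_base sdisc_Psi. Qed.

Lemma ssum_base : ssum B0 = cmul del0 (0, 2).
Proof. by rewrite -iota_base ssum_Psi. Qed.

Definition iotas : pi1 R (base R) -> pi1 R B0 := map_pi1 iota_continuous iota_base.

Lemma iotasM a b : iotas (a * b)%g = (iotas a * iotas b)%g.
Proof. exact: map_pi1M. Qed.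

(** While the loop [del] is contracted, [u] is left unchanged; at the end the configuration runs
    inside the slice. *)
Lemma iotas_contract (p : {path I from B0 to B0}) (u : {path I from base R to base R})
    (del : {path I from mkD del0_neq0 to mkD del0_neq0}) :
  homotopic del (const_path R (mkD del0_neq0)) ->
  (forall t, Psi (del t, u t) = p t) ->
  \pi_(pi1 R B0) p = iotas (\pi_(pi1 R (base R)) u).
Proof.
move=> [H [cH H0 H1 Hx Hy]] pE; rewrite /iotas map_pi1E; apply/pi1_eqP.
exists (fun d => Psi (H d, u d.1)); split => [|t|t|s|s].
- apply: (@Psi_continuous R x1 x2 e1 e2 on _ H (fun d => u d.1)) => // d.
  by apply: continuous_comp; [exact: cvg_fst|exact: cts_fun].
- by rewrite H0 pE.
- by rewrite H1.
- by rewrite Hx path_zero; exact: iota_base.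
- by rewrite Hy path_one; exact: iota_base.
Qed.

Definition rad (y : U) : R := Num.sqrt (rho (sdisc y)).

Lemma rad_gt0 y : 0 < rad y.
Proof. by rewrite sqrtr_gt0 rho_gt0 //; exact: sdisc_neq0. Qed.

Lemma rad_sqr y : rad y * rad y = rho (sdisc y).
Proof. by rewrite -expr2 sqr_sqrtr // ltW // rho_gt0 //; exact: sdisc_neq0. Qed.

Lemma rad_continuous : continuous rad.
Proof.
have [c1 c2] := sdisc_continuous.
rewrite /rad /rho /sqnorm; do 2 (apply: cts_comp; last exact: sqrt_continuous).
by under eq_fun do rewrite !expr2; cts.
Qed.

(** A square root of the number with modulus [r * r] and argument [th]; it is continuous in [th],
    though not in the number itself. *)
Definition root (r th : R) : R * R := (r * cos (th / 2), r * sin (th / 2)).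

Lemma root_neq0 r th : 0 < r -> root r th <> 0.
Proof.
move=> r0 E; have := cos2Dsin2 (th / 2).
have /eqP := congr1 fst E; have /eqP := congr1 snd E.
rewrite /= !mulf_eq0 (gt_eqF r0) /= => /eqP -> /eqP ->.
by rewrite expr0n /= addr0 => /eqP; rewrite eq_sym oner_eq0.
Qed.

Lemma root_sqr r th : cmul (root r th) (root r th) = (r * r * cos th, r * r * sin th).
Proof.
have -> : th = th / 2 + th / 2 by field.
by rewrite cosD sinD -splitr; apply: pairP; rewrite /cmul /=; ring.
Qed.

Lemma root_base : root 2 (- pi) = del0.
Proof.
by rewrite /root mulNr cosN sinN cos_pihalf sin_pihalf mulr0 mulrN mulr1.
Qed.

Lemma rad_base : rad B0 = 2.
Proof.
rewrite /rad /rho sdisc_base (_ : sqnorm _ = (2 ^+ 2) ^+ 2).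
  by rewrite sqrtr_sqr (ger0_norm (sqr_ge0 _)) sqrtr_sqr ger0_norm.
by rewrite /sqnorm /cmul /=; ring.
Qed.

Lemma root_continuous (D : topologicalType) (r th : D -> R) :
  continuous r -> continuous th ->
  continuous (fun d => (root (r d) (th d)).1) /\
  continuous (fun d => (root (r d) (th d)).2).
Proof.
move=> cr ct.
have c2 : continuous (fun d => th d / 2) by cts.
have cc : continuous (fun d => cos (th d / 2)).
  exact: (cts_comp (f := cos) c2 (@continuous_cos R)).
have cs : continuous (fun d => sin (th d / 2)).
  exact: (cts_comp (f := sin) c2 (@continuous_sin R)).
by split; rewrite /root /=; cts.
Qed.

(** The argument starts at - pi because the base discriminant is the square of [del0], namely -4,
    and half of - pi is the argument of [del0]. *)
Lemma lift_exists (F : I * I -> U) : continuous F -> F (zero, zero) = B0 ->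
  exists (th : I * I -> R) (del : I * I -> Dl) (u : I * I -> E),
  [/\ continuous th, continuous del, continuous u, th (zero, zero) = - pi &
    forall d, [/\ polar (th d) (sdisc (F d)), set_val (del d) = root (rad (F d)) (th d),
      set_val (u d) = cdiv (ssum (F d)) (set_val (del d)) & Psi (del d, u d) = F d]].
Proof.
move=> cF F0; have [d1 d2] := sdisc_continuous; have [s1 s2] := ssum_continuous.
have pol0 : polar (- pi) (sdisc (F (zero, zero))).
  rewrite F0 /polar -rad_sqr rad_base sdisc_base cosN sinN cospi sinpi oppr0 /cmul /=.
  by split; ring.
have [th [cth pth th0]] := angle_exists d1 d2 sdisc_neq0 cF pol0.
have sq d : cmul (root (rad (F d)) (th d)) (root (rad (F d)) (th d)) = sdisc (F d).
  by rewrite root_sqr rad_sqr; have [p1 p2] := pth d; apply: pairP.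
have hu d : twice_punctured (cdiv (ssum (F d)) (root (rad (F d)) (th d))).
  by have [? []] := Psi_rec x2_sphere x1x2 on (sq d).
pose del d : Dl := mkD (@root_neq0 _ (th d) (rad_gt0 (F d))).
pose u d : E := mkE (hu d).
have crd_ : continuous (fun d => rad (F d)).
  by move=> d; apply: (@continuous_comp _ _ _ F rad); [exact: cF|exact: rad_continuous].
have [r1 r2] := root_continuous crd_ cth.
have cS1 : continuous (fun d => (ssum (F d)).1).
  by move=> d; apply: (@continuous_comp _ _ _ F (fun y => (ssum y).1)); [exact: cF|exact: s1].
have cS2 : continuous (fun d => (ssum (F d)).2).
  by move=> d; apply: (@continuous_comp _ _ _ F (fun y => (ssum y).2)); [exact: cF|exact: s2].
exists th, del, u; split=> //.
- exact: set_type_continuous.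
- have ci : continuous (fun d => (sqnorm (root (rad (F d)) (th d)))^-1).
    apply: ctsV => [d|]; first by apply/lt0r_neq0/sqnorm_gt0/root_neq0; exact: rad_gt0.
    by rewrite /sqnorm; under eq_fun do rewrite !expr2; cts.
  by apply: set_type_continuous; rewrite /= /cdiv /inner /cross /=; cts.
- move=> d; split => //; have [d0 [hu' <-]] := Psi_rec x2_sphere x1x2 on (sq d).
  exact: psi_eq.
Qed.

Definition disc_winding (a : pi1 R B0) : R :=
  winding sdisc_continuous.1 sdisc_continuous.2 sdisc_neq0 a.

Lemma disc_windingM a b : disc_winding (a * b)%g = disc_winding a + disc_winding b.
Proof. exact: windingM. Qed.

Let S0 := set_val_zero R.
Let S1 := set_val_one R.

Lemma row_continuous (T : topologicalType) (h : I * I -> T) (s : I) :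
  continuous h -> continuous (fun t => h (t, s)).
Proof.
move=> ch t; apply: (@continuous_comp _ _ _ (fun t => (t, s)) h); last exact: ch.
by apply: pair_continuous; [move=> ?; exact: cvg_id|exact: cst_continuous].
Qed.

Lemma col_continuous (T : topologicalType) (h : I * I -> T) (s : I) :
  continuous h -> continuous (fun t => h (s, t)).
Proof.
move=> ch t; apply: (@continuous_comp _ _ _ (fun t => (s, t)) h); last exact: ch.
by apply: pair_continuous; [exact: cst_continuous|move=> ?; exact: cvg_id].
Qed.

(** Vanishing winding brings the argument of the discriminant back to - pi, so the lifted difference
    closes up and has a closed argument; it can then be contracted. *)
Lemma iotas_surj (a : pi1 R B0) : disc_winding a = 0 -> exists b, iotas b = a.
Proof.
elim/quotP: a => p _ wp.
have pz : p zero = B0 by exact: path_zero.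
have po : p one = B0 by exact: path_one.
have cF : continuous (fun d : I * I => p d.1).
  by move=> d; apply: continuous_comp; [exact: cvg_fst|exact: cts_fun].
have [th [del [u [cth cdel cu th0 H]]]] := lift_exists cF pz.
pose h (t : R) := th (clamp t, zero).
have h1 : h 1 = - pi.
  have ch : continuous h.
    move=> t; apply: (@continuous_comp _ _ _ (@clamp R) (fun t => th (t, zero))).
      exact: clamp_continuous.
    exact: row_continuous.
  have hp t : polar (h t) (sdisc (p (clamp t))) by have [] := H (clamp t, zero).
  have := winding_angle sdisc_continuous.1 sdisc_continuous.2 sdisc_neq0 ch hp.
  rewrite -/(disc_winding _) wp => /esym/eqP; rewrite subr_eq0 => /eqP ->.
  exact: th0.
have hz : set_val (del (zero, zero)) = del0.
  by have [_ -> _ _] := H (zero, zero); rewrite /= path_zero th0 rad_base root_base.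
have ho : set_val (del (one, zero)) = del0.
  by have [_ -> _ _] := H (one, zero); rewrite /= path_one -/(h 1) h1 rad_base root_base.
have d0 : del (zero, zero) = mkD del0_neq0 by exact: val_inj.
have d1 : del (one, zero) = mkD del0_neq0 by exact: val_inj.
have ub t : p t = B0 -> set_val (del (t, zero)) = del0 -> u (t, zero) = base R.
  move=> pt dt; apply: val_inj; have [_ _ + _] := H (t, zero).
  by rewrite /= dt pt ssum_base cdiv_mul //; exact: del0_neq0.
have u0 := ub _ pz hz; have u1 := ub _ po ho.
pose dp := mk_path (row_continuous cdel) d0 d1.
pose up := mk_path (row_continuous cu) u0 u1.
exists (\pi_(pi1 R (base R)) up); apply/esym/(@iotas_contract p up dp); last first.
  by move=> t; have [_ _ _] := H (t, zero).
have cr : continuous (fun d : I * I => rad (p d.1)).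
  by move=> d; apply: (@continuous_comp _ _ _ (fun d : I * I => p d.1) rad);
    [exact: cF|exact: rad_continuous].
have c1 : continuous (fun d : I * I => th (d.1, zero)).
  move=> d; apply: (@continuous_comp _ _ _ fst (fun t => th (t, zero))).
    exact: cvg_fst.
  exact: row_continuous.
have c2 : continuous (fun d : I * I => set_val d.2 : R).
  by move=> d; apply: continuous_comp; [exact: cvg_snd|exact: set_val_continuous].
(* Modulus and argument are moved separately towards 2 and - pi; interpolating the points themselves
   could pass through 0. *)
pose r (d : I * I) := (1 - set_val d.2) * rad (p d.1) + set_val d.2 * 2.
pose k (d : I * I) := (1 - set_val d.2) * th (d.1, zero) + set_val d.2 * - pi.
have cc : continuous r by rewrite /r; cts.
have ck : continuous k by rewrite /k; cts.
have r0 d : 0 < r d.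
  by rewrite /r; have := rad_gt0 (p d.1); have /andP[? ?] := itvP d.2; nra.
have [k1 k2] := root_continuous cc ck.
exists (fun d => mkD (@root_neq0 _ (k d) (r0 d))); split => [|t|t|s|s].
- exact: set_type_continuous.
- apply: val_inj; have [_ dE _ _] := H (t, zero).
  rewrite -[RHS]/(set_val (del (t, zero))) dE /=.
  have -> : r (t, zero) = rad (p t) by rewrite /r /= S0; ring.
  by have -> : k (t, zero) = th (t, zero) by rewrite /k /= S0; ring.
- have rE : r (t, one) = 2 by rewrite /r /= S1; ring.
  have kE : k (t, one) = - pi by rewrite /k /= S1; ring.
  by apply: val_inj; rewrite /= rE kE root_base.
- have rE : r (zero, s) = 2 by rewrite /r /= pz rad_base; ring.
  have kE : k (zero, s) = - pi by rewrite /k /= th0; ring.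
  by apply: val_inj; rewrite /= rE kE root_base.
- have rE : r (one, s) = 2 by rewrite /r /= po rad_base; ring.
  have kE : k (one, s) = - pi by rewrite /k /= (h1 : th (one, zero) = - pi); ring.
  by apply: val_inj; rewrite /= rE kE root_base.
Qed.

(** A homotopy between two loops of the slice lifts. On the boundary of the square the discriminant
    is constant, hence so is [del], and [u] runs there through the given loops; the component [u] is
    the wanted homotopy. *)
Lemma iotas_inj : injective iotas.
Proof.
move=> a b; elim/quotP: a => p _; elim/quotP: b => q _; rewrite /iotas !map_pi1E.
move=> /pi1_eqP[H [cH H0 H1 Hx Hy]].
have [th [del [u [cth cdel cu th0 HP]]]] := lift_exists cH (Hx zero).
have sq d y : H d = iota y -> cmul (set_val (del d)) (set_val (del d)) = cmul del0 del0.
  by have [_ _ _ PE] := HP d; move=> Hd;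
    transitivity (sdisc (Psi (del d, u d))); [rewrite sdisc_Psi|rewrite PE Hd sdisc_Psi].
have dv1 : continuous (fun d => (set_val (del d)).1).
  by move=> d; apply: (@continuous_comp _ _ _ del (fun a : Dl => (set_val a).1));
    [exact: cdel|exact: set_val_fst_continuous].
have dv2 : continuous (fun d => (set_val (del d)).2).
  by move=> d; apply: (@continuous_comp _ _ _ del (fun a : Dl => (set_val a).2));
    [exact: cdel|exact: set_val_snd_continuous].
have d00 : set_val (del (zero, zero)) = del0.
  by have [_ -> _ _] := HP (zero, zero); rewrite Hx th0 rad_base root_base.
have row0 t : set_val (del (t, zero)) = del0.
  apply: (root_constant (del := fun t => set_val (del (t, zero)))) => //.
  - exact: (@row_continuous _ _ zero dv1).
  - exact: (@row_continuous _ _ zero dv2).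
  - by move=> s; apply: (sq _ (p s)); rewrite H0.
  - exact: del0_neq0.
have col0 t : set_val (del (zero, t)) = del0.
  apply: (root_constant (del := fun t => set_val (del (zero, t)))) => //.
  - exact: (@col_continuous _ _ zero dv1).
  - exact: (@col_continuous _ _ zero dv2).
  - by move=> s; apply: (sq _ (base R)); rewrite Hx iota_base.
  - exact: del0_neq0.
have col1 t : set_val (del (one, t)) = del0.
  apply: (root_constant (del := fun t => set_val (del (one, t)))) => //.
  - exact: (@col_continuous _ _ one dv1).
  - exact: (@col_continuous _ _ one dv2).
  - by move=> s; apply: (sq _ (base R)); rewrite Hy iota_base.
  - exact: del0_neq0.
have row1 t : set_val (del (t, one)) = del0.
  apply: (root_constant (del := fun t => set_val (del (t, one)))) => //.
  - exact: (@row_continuous _ _ one dv1).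
  - exact: (@row_continuous _ _ one dv2).
  - by move=> s; apply: (sq _ (q s)); rewrite H1.
  - exact: del0_neq0.
have uE d y : H d = iota y -> set_val (del d) = del0 -> u d = y.
  move=> Hd dd; apply: val_inj; have [_ _ uE _] := HP d.
  by rewrite -[LHS]/(set_val (u d)) uE Hd dd ssum_Psi cdiv_mul //; exact: del0_neq0.
apply/pi1_eqP; exists u; split => // [t|t|s|s].
- by apply: uE; rewrite ?row0 // H0.
- by apply: uE; rewrite ?row1 // H1.
- by apply: uE; rewrite ?col0 // Hx iota_base.
- by apply: uE; rewrite ?col1 // Hy iota_base.
Qed.

End lifting.

(** * The loops gamma *)

Section explicit_loops.
Variables (R : realType) (x1 x2 e1 e2 : 'rV[R]_3).
Hypotheses (x2_sphere : sphere2 x2) (x1x2 : x1 <> x2).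
Hypothesis on : orthonormal3 e1 e2 x1.
Local Notation I := (unit_itv R).
Local Notation M := (punctured_sphere x1 x2).
Local Notation U := (uconf 2 M).
Local Notation E := (set_type (@twice_punctured R)).
Local Notation Dl := (set_type (@nonzero R)).
Local Notation psi := (@psi R x1 x2 e1 e2 on).
Local Notation Psi := (@Psi R x1 x2 e1 e2 on).
Local Notation B0 := (\pi_U (base_conf x2 on)).
Local Notation iotas := (@iotas R x1 x2 e1 e2 on).
Local Notation del0 := (@del0 R).

(** The imaginary part of [(a + b) / (a - b)] has the sign of the determinant of [a] and [b]. *)
Lemma cdiv_upper0 (a b : R * R) : a <> b -> 0 < a.1 * b.2 - a.2 * b.1 ->
  upper0 (cdiv (a + b) (a - b)).
Proof.
move=> ab ab0; have S : 0 < sqnorm (a - b).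
  by apply: sqnorm_gt0 => /eqP; rewrite subr_eq0 => /eqP.
rewrite /upper0 /cdiv /cross /= divr_gt0 //.
have -> : (a.1 - b.1) * (a.2 + b.2) - (a.2 - b.2) * (a.1 + b.1) =
  2 * (a.1 * b.2 - a.2 * b.1) by ring.
by rewrite mulr_gt0.
Qed.

Lemma cdiv_lower0 (a b : R * R) : a <> b -> a.1 * b.2 - a.2 * b.1 < 0 ->
  lower0 (cdiv (a + b) (a - b)).
Proof.
move=> ab ab0; have S : 0 < sqnorm (a - b).
  by apply: sqnorm_gt0 => /eqP; rewrite subr_eq0 => /eqP.
rewrite /lower0 /cdiv /cross /= ltr_pdivrMr // mul0r.
have -> : (a.1 - b.1) * (a.2 + b.2) - (a.2 - b.2) * (a.1 + b.1) =
  2 * (a.1 * b.2 - a.2 * b.1) by ring.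
by lra.
Qed.

(** The real part of [(a + b) / (a - b)] is [(|a|^2 - |b|^2) / |a - b|^2]; comparing it with -1 and
    1 amounts to comparing [inner a b] with [|a|^2] and [|b|^2]. *)
Lemma cdiv_stripL (a b : R * R) : a <> b -> sqnorm a < inner a b ->
  strip gapL (cdiv (a + b) (a - b)).
Proof.
move=> ab; have S : 0 < sqnorm (a - b).
  by apply: sqnorm_gt0 => /eqP; rewrite subr_eq0 => /eqP.
rewrite /strip /cdiv /= ltr_pdivrMr // /sqnorm /inner /=.
by rewrite !expr2 => H; lra.
Qed.

Lemma cdiv_stripR (a b : R * R) : a <> b -> sqnorm b < inner a b ->
  strip gapR (cdiv (a + b) (a - b)).
Proof.
move=> ab; have S : 0 < sqnorm (a - b).
  by apply: sqnorm_gt0 => /eqP; rewrite subr_eq0 => /eqP.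
rewrite /strip /cdiv /= ltr_pdivlMr // /sqnorm /inner /=.
by rewrite !expr2 => H; lra.
Qed.

Lemma cdiv_stripM (a b : R * R) : a <> b -> inner a b < sqnorm a ->
  inner a b < sqnorm b -> strip gapM (cdiv (a + b) (a - b)).
Proof.
move=> ab; have S : 0 < sqnorm (a - b).
  by apply: sqnorm_gt0 => /eqP; rewrite subr_eq0 => /eqP.
rewrite /strip /cdiv /= ltr_pdivlMr // ltr_pdivrMr // /sqnorm /inner /=.
by rewrite !expr2 => H1 H2; apply/andP; split; lra.
Qed.

(** When the differences stay in a convex set avoiding 0, their loop is contractible and only the
    loop of quotients survives. *)
Lemma explicit_loop (p : {path I from B0 to B0}) (a b : I -> R * R)
    (V : forall t, valid (a t, b t)) (C : set (R * R)) :
  continuous (fun t => (a t).1) -> continuous (fun t => (a t).2) ->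
  continuous (fun t => (b t).1) -> continuous (fun t => (b t).2) ->
  (forall t, p t = psi (mkY (V t))) -> convex2 C -> C `<=` @nonzero R ->
  (forall t, C (a t - b t)) -> a zero - b zero = del0 -> a one - b one = del0 ->
  exists up : {path I from base R to base R},
    (forall t, set_val (up t) = cdiv (a t + b t) (a t - b t)) /\
    \pi_(pi1 R B0) p = iotas (\pi_(pi1 R (base R)) up).
Proof.
move=> ca1 ca2 cb1 cb2 pE cC CN Cab d0 d1.
have dn t : a t - b t <> 0 by exact/CN/Cab.
have hu t : twice_punctured (cdiv (a t + b t) (a t - b t)).
  by case: (punctured_quotient (V t) erefl) => -[].
pose del t : Dl := mkD (@dn t).
pose u t : E := mkE (hu t).
have cd : continuous del by apply: set_type_continuous; rewrite /=; cts.
have cu : continuous u.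
  have ci : continuous (fun t => (sqnorm (a t - b t))^-1).
    apply: ctsV => [t|]; first exact/lt0r_neq0/sqnorm_gt0/dn.
    by rewrite /sqnorm; under eq_fun do rewrite !expr2; rewrite /=; cts.
  by apply: set_type_continuous; rewrite /= /cdiv /inner /cross /=; cts.
have ss t : ssum e1 e2 (p t) = a t + b t by rewrite pE ssum_psi.
have ub t : p t = B0 -> a t - b t = del0 -> u t = base R.
  move=> pt dt; apply: val_inj; rewrite /= -ss dt pt ssum_base cdiv_mul //.
  exact: del0_neq0.
have u0 : u zero = base R by apply: ub => //; exact: path_zero.
have u1 : u one = base R by apply: ub => //; exact: path_one.
have e0 : del zero = mkD (@del0_neq0 R) by exact: val_inj.
have e1' : del one = mkD (@del0_neq0 R) by exact: val_inj.
pose up := mk_path cu u0 u1; pose dp := mk_path cd e0 e1'.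
exists up; split=> //; apply: (@iotas_contract _ _ _ _ _ on p up dp) => [|t].
  apply: (convex_homotopic cC CN) => t; first exact: Cab.
  have : C del0 by rewrite -d0.
  exact.
rewrite pE; case: (punctured_quotient (V t) erefl) => -[_ ab].
  exact: psi_eq.
have V' : valid (b t, a t) by have [/= ? ? ab'] := V t; split => //= /esym.
by rewrite (psi_swap x2 on (V t) V'); exact: psi_eq.
Qed.

End explicit_loops.

(** * The two generators as explicit loops in the twice-punctured plane *)

Section angles.
Variable R : realType.
Implicit Types t : R.
Local Notation c t := (cos (pi *+ 2 * t)).
Local Notation s t := (sin (pi *+ 2 * t)).

Lemma cs1 t : c t * c t + s t * s t = 1.
Proof. by rewrite -!expr2 cos2Dsin2. Qed.

(* [t] is measured in full turns. *)
Lemma quadrant1 t : 0 <= t <= 4^-1 -> 0 <= c t /\ 0 <= s t.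
Proof.
move=> /andP[t0 t1]; have pp := pi_gt0 R; have p2 := mulr2n (pi : R).
split.
  by apply: cos_ge0_pihalf; rewrite p2; apply/andP; split; nra.
by apply: sin_ge0_pi; rewrite p2; apply/andP; split; nra.
Qed.

Lemma half_turn t : c t = - c (t - 2^-1) /\ s t = - s (t - 2^-1).
Proof.
have -> : pi *+ 2 * t = pi *+ 2 * (t - 2^-1) + pi.
  by rewrite mulr2n; field.
by rewrite cosDpi sinDpi.
Qed.

Lemma full_turn t : c t = c (1 - t) /\ s t = - s (1 - t).
Proof.
have -> : pi *+ 2 * t = - (pi *+ 2 * (1 - t)) + pi *+ 2 by ring.
by rewrite cosD2pi sinD2pi cosN sinN.
Qed.

Lemma quadrant4 t : 4^-1 * 3 <= t <= 1 -> 0 <= c t /\ s t <= 0.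
Proof.
move=> /andP[t0 t1]; have [-> ->] := full_turn t.
have [|? ?] := @quadrant1 (1 - t); first by apply/andP; split; lra.
by rewrite oppr_le0.
Qed.

Lemma quadrant3 t : 2^-1 <= t <= 4^-1 * 3 -> c t <= 0 /\ s t <= 0.
Proof.
move=> /andP[t0 t1]; have [-> ->] := half_turn t.
have [|? ?] := @quadrant1 (t - 2^-1); first by apply/andP; split; lra.
by rewrite !oppr_le0.
Qed.

Lemma quadrant2 t : 4^-1 <= t <= 2^-1 -> c t <= 0 /\ 0 <= s t.
Proof.
move=> /andP[t0 t1]; have [-> ->] := full_turn t.
have [|? ?] := @quadrant3 (1 - t); first by apply/andP; split; lra.
by rewrite oppr_ge0.
Qed.

(* From this time until a quarter turn, [gamma_{2,1}] stays in the left strip. *)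
Definition t345 : R := acos (3 / 5) / (pi *+ 2).

Let b35 : -1 <= (3 / 5 : R) <= 1. Proof. by apply/andP; split; lra. Qed.

Lemma t345_itv : 0 <= t345 <= 4^-1.
Proof.
have pp := pi_gt0 R; have p2 := mulr2n (pi : R).
have a0 := acos_ge0 b35.
have a1 : acos (3 / 5) <= pi / 2 :> R.
  rewrite leNgt; apply/negP => h.
  have : cos (acos (3 / 5)) < cos (pi / 2 : R).
    rewrite ltr_cos // in_itv /=; last by rewrite a0 acos_lepi.
    by apply/andP; split; lra.
  by rewrite acosK ?in_itv //= cos_pihalf; lra.
rewrite /t345; apply/andP; split; first by rewrite divr_ge0 // p2; lra.
by rewrite ler_pdivrMr; rewrite p2; lra.
Qed.

Lemma before345 t : 0 <= t <= t345 -> 3 / 5 <= c t /\ 0 <= s t.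
Proof.
move=> /andP[t0 t1]; have /andP[k0 k1] := t345_itv.
have [|c0 s0] := @quadrant1 t; first by apply/andP; split; lra.
split=> //.
have pp := pi_gt0 R; have p2 := mulr2n (pi : R).
have le : pi *+ 2 * t <= acos (3 / 5).
  by rewrite [_ * t]mulrC -ler_pdivlMr // p2 addr_gt0.
have <- : cos (acos (3 / 5)) = 3 / 5 :> R by rewrite acosK // in_itv.
rewrite leNgt; apply/negP; rewrite ltr_cos ?in_itv /= ?acos_ge0 ?acos_lepi //.
  by rewrite ltNge le.
by rewrite p2; apply/andP; split; nra.
Qed.

Lemma after345 t : t345 <= t <= 4^-1 -> [/\ 0 <= c t, c t <= 3 / 5 & 0 <= s t].
Proof.
move=> /andP[t0 t1]; have /andP[k0 k1] := t345_itv.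
have [|c0 s0] := @quadrant1 t; first by apply/andP; split; lra.
split=> //.
have pp := pi_gt0 R; have p2 := mulr2n (pi : R).
have le : acos (3 / 5) <= pi *+ 2 * t.
  by rewrite [_ * t]mulrC -ler_pdivrMr // p2 addr_gt0.
have <- : cos (acos (3 / 5)) = 3 / 5 :> R by rewrite acosK // in_itv.
rewrite leNgt; apply/negP; rewrite ltr_cos ?in_itv /= ?acos_ge0 ?acos_lepi //.
  by rewrite ltNge le.
by rewrite p2; apply/andP; split; nra.
Qed.

End angles.

Section gammas.
Variables (R : realType) (x1 x2 e1 e2 : 'rV[R]_3).
Hypotheses (x2_sphere : sphere2 x2) (x1x2 : x1 <> x2).
Hypothesis on : orthonormal3 e1 e2 x1.
Local Notation I := (unit_itv R).
Local Notation M := (punctured_sphere x1 x2).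
Local Notation U := (uconf 2 M).
Local Notation psi := (@psi R x1 x2 e1 e2 on).
Local Notation B0 := (\pi_U (base_conf x2 on)).
Local Notation iotas := (@iotas R x1 x2 e1 e2 on).
Local Notation gamma := (gamma_x2 x2 on).
Local Notation c t := (cos (pi *+ 2 * t)).
Local Notation s t := (sin (pi *+ 2 * t)).

Lemma strands_valid j (t : R) : valid (strands j t 0, strands j t 1).
Proof.
split; try exact: strands_neq0.
by move=> /strands_inj /(congr1 val).
Qed.

Lemma gamma_path j : exists2 p : {path I from B0 to B0}, gamma j = \pi_(pi1 R B0) p &
  forall t, p t = psi (mkY (strands_valid j (set_val t))).
Proof.
eexists; first by [].
move=> t; apply: psi_chart_conf => k; rewrite /pair_fun /=.
by have [->|->] : k = 0 \/ k = 1
  by case: k => [[|[|//]] i]; [left|right]; exact: val_inj.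
Qed.

Lemma strands00 (t : R) : strands ord0 t 0 =
  ((2 + 3 * (2 * c t + s t)) / 4, (- 1 + 3 * (2 * s t - c t)) / 4).
Proof. by apply: pairP; rewrite /strands /circle /=; field. Qed.

Lemma strands01 (t : R) : strands ord0 t 1 = (2, 1).
Proof. by []. Qed.

Lemma strands10 (t : R) : strands ord_max t 0 = (2, - 1).
Proof. by []. Qed.

Lemma strands11 (t : R) : strands ord_max t 1 =
  ((2 + 3 * (2 * c t - s t)) / 4, (1 + 3 * (2 * s t + c t)) / 4).
Proof. by apply: pairP; rewrite /strands /circle /=; field. Qed.

Let strand_continuous j k :
  continuous (fun t : I => (strands j (set_val t : R) k).1) /\
  continuous (fun t : I => (strands j (set_val t : R) k).2).
Proof.
have [c1 c2] := @strands_continuous R j k.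
split=> t; [apply: (@continuous_comp _ _ _ set_val (fun t => (strands j t k).1))|
  apply: (@continuous_comp _ _ _ set_val (fun t => (strands j t k).2))];
  by [exact: set_val_continuous|exact: c1|exact: c2].
Qed.

Let S0 := set_val_zero R.
Let S1 := set_val_one R.

Let base_diff : base_pt R 0 - base_pt R 1 = @del0 R.
Proof. by apply: pairP; rewrite /base_pt /del0 /=; ring. Qed.

Lemma gamma_loop j (C : set (R * R)) : convex2 C -> C `<=` @nonzero R ->
  (forall t, C (strands j t 0 - strands j t 1)) ->
  exists up : {path I from base R to base R},
    (forall t, 0 <= t <= 1 -> set_val (up (clamp t)) =
      cdiv (strands j t 0 + strands j t 1) (strands j t 0 - strands j t 1)) /\
    gamma j = iotas (\pi_(pi1 R (base R)) up).
Proof.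
move=> cC CN Cs; have [p -> pE] := gamma_path j.
have [a1 a2] := strand_continuous j 0; have [b1 b2] := strand_continuous j 1.
have [|||up [upE ->]] := explicit_loop a1 a2 b1 b2 pE cC CN.
- by move=> t; exact: Cs.
- by rewrite S0 !strands0 base_diff.
- by rewrite S1 !strands1 base_diff.
by exists up; split=> // t t01; rewrite upE clampE.
Qed.

(** During the turn the quotient goes down to the left of -1 and comes back up between -1 and 1, so
    it encircles -1 once; the sign conditions are checked quadrant by quadrant. *)
Lemma gamma21_dips : exists2 v : {path I from base R to base R},
  gamma ord0 = iotas (\pi_(pi1 R (base R)) v) & dips v gapL gapM.
Proof.
(* The differences run on the circle with centre (-6, -5) / 4 and radius sqrt 45 / 4. Its centre is
   at distance sqrt 61 / 4 from 0, so the half plane with the centre as normal direction contains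
   it. *)
pose C : set (R * R) := [set v | 6 * v.1 + 5 * v.2 < 0].
have [|||up [upE ->]] := @gamma_loop ord0 C.
- by apply: convex2_open => a b l; rewrite /C /= => a0 b0 /andP[? ?]; nra.
- by move=> v + v0; rewrite /C /= v0 /= !mulr0 addr0 ltxx.
- move=> t; rewrite strands00 strands01 /C /=; have := cs1 t.
  move: (c t) (s t) => x y xy.
  (* The bound needed is [21 * x + 48 * y < 61] on the unit circle. The maximum is sqrt 2745, about
     52.4, attained near (21, 48) / 52. *)
  by have := sqr_ge0 (52 * x - 21); have := sqr_ge0 (52 * y - 48); rewrite !expr2; lra.
have ne t : strands ord0 t 0 <> strands ord0 t 1 :> R * R.
  by have [] := strands_valid ord0 t.
have /andP[k0 k1] := t345_itv R.
(* With [(x, y)] the cosine and sine, lying above the axis means [0 < 4 + 12 * x - 9 * y], and lying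
   left of -1 means [38 < 6 * x + 48 * y]. The rational point (3 / 5, 4 / 5) satisfies both; at a
   quarter turn only the second still holds. *)
exists up => //; exists (t345 R), (4^-1), (2^-1), (4^-1 * 3).
split; first by split; try (apply/andP; split); lra.
split.
- move=> t /andP[t0 t1]; rewrite upE; last by apply/andP; split; lra.
  apply: cdiv_upper0 => //; rewrite strands00 strands01 /=.
  have [|H1 H2] := @before345 R t; first by rewrite t0.
  move: (cs1 t) H1 H2; move: (c t) (s t) => x y *.
  have ? : y <= 4 / 5 by nra.
  by lra.
- move=> t /andP[t0 t1]; rewrite upE; last by apply/andP; split; lra.
  apply: cdiv_stripL => //; rewrite strands00 strands01 /sqnorm /inner /=.
  have [|H1 H2 H3] := @after345 R t; first by rewrite t0.
  move: (cs1 t) H1 H2 H3; move: (c t) (s t) => x y *.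
  have ? : 4 / 5 <= y by nra.
  by nra.
- move=> t /andP[t0 t1]; rewrite upE; last by apply/andP; split; lra.
  apply: cdiv_lower0 => //; rewrite strands00 strands01 /=.
  have [|H1 H2] := @quadrant2 R t; first by rewrite t0.
  move: (cs1 t) H1 H2; move: (c t) (s t) => x y *.
  (* In the second quadrant the arc lies above its chord from (0, 1) to (-1, 0). *)
  have ? : 1 + x <= y by nra.
  by nra.
- move=> t /andP[t0 t1]; rewrite upE; last by apply/andP; split; lra.
  have [|H1 H2] := @quadrant3 R t; first by rewrite t0.
  have := cs1 t => xy.
  by apply: cdiv_stripM => //; rewrite strands00 strands01 /sqnorm /inner /=;
    move: (c t) (s t) xy H1 H2 => x y *; nra.
- move=> t /andP[t0 t1]; rewrite upE; last by apply/andP; split; lra.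
  apply: cdiv_upper0 => //; rewrite strands00 strands01 /=.
  have [|H1 H2] := @quadrant4 R t; first by rewrite t0.
  by move: (cs1 t) H1 H2; move: (c t) (s t) => x y *; nra.
Qed.

(** This loop is that of [gamma21_dips] reflected in the imaginary axis and run backwards, so the
    same constants serve with time [1 - t]. *)
Lemma gamma22_dips : exists2 v : {path I from base R to base R},
  gamma ord_max = iotas (\pi_(pi1 R (base R)) v) & dips v gapM gapR.
Proof.
pose C : set (R * R) := [set v | 0 < 6 * v.1 - 5 * v.2].
have [|||up [upE ->]] := @gamma_loop ord_max C.
- by apply: convex2_open => a b l; rewrite /C /= => a0 b0 /andP[? ?]; nra.
- by move=> v + v0; rewrite /C /= v0 /= !mulr0 subr0 ltxx.
- move=> t; rewrite strands10 strands11 /C /=; have := cs1 t.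
  move: (c t) (s t) => x y xy.
  by have := sqr_ge0 (52 * x - 21); have := sqr_ge0 (52 * y + 48); rewrite !expr2; lra.
have ne t : strands ord_max t 0 <> strands ord_max t 1 :> R * R.
  by have [] := strands_valid ord_max t.
have /andP[k0 k1] := t345_itv R.
exists up => //; exists (4^-1), (2^-1), (4^-1 * 3), (1 - t345 R).
split; first by split; try (apply/andP; split); lra.
split.
- move=> t /andP[t0 t1]; rewrite upE; last by apply/andP; split; lra.
  apply: cdiv_upper0 => //; rewrite strands10 strands11 /=.
  have [|H1 H2] := @quadrant1 R t; first by rewrite t0.
  by move: (cs1 t) H1 H2; move: (c t) (s t) => x y *; nra.
- move=> t /andP[t0 t1]; rewrite upE; last by apply/andP; split; lra.
  have [|H1 H2] := @quadrant2 R t; first by rewrite t0.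
  have := cs1 t => xy.
  by apply: cdiv_stripM => //; rewrite strands10 strands11 /sqnorm /inner /=;
    move: (c t) (s t) xy H1 H2 => x y *; nra.
- move=> t /andP[t0 t1]; rewrite upE; last by apply/andP; split; lra.
  apply: cdiv_lower0 => //; rewrite strands10 strands11 /=.
  have [|H1 H2] := @quadrant3 R t; first by rewrite t0.
  move: (cs1 t) H1 H2; move: (c t) (s t) => x y *.
  have ? : 1 + x <= - y by nra.
  by nra.
- move=> t /andP[t0 t1]; rewrite upE; last by apply/andP; split; lra.
  apply: cdiv_stripR => //; rewrite strands10 strands11 /sqnorm /inner /=.
  have [-> ->] := full_turn t.
  have [|H1 H2 H3] := @after345 R (1 - t); first by apply/andP; split; lra.
  move: (cs1 (1 - t)) H1 H2 H3; move: (c (1 - t)) (s (1 - t)) => x y *.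
  have ? : 4 / 5 <= y by nra.
  by nra.
- move=> t /andP[t0 t1]; rewrite upE; last by apply/andP; split; lra.
  apply: cdiv_upper0 => //; rewrite strands10 strands11 /=.
  have [-> ->] := full_turn t.
  have [|H1 H2] := @before345 R (1 - t); first by apply/andP; split; lra.
  move: (cs1 (1 - t)) H1 H2; move: (c (1 - t)) (s (1 - t)) => x y *.
  have ? : y <= 4 / 5 by nra.
  by lra.
Qed.

End gammas.

(** * Conjugacy of the generators and winding of the product *)

Section conjugation.
Variables (R : realType) (x1 x2 e1 e2 : 'rV[R]_3).
Hypotheses (x2_sphere : sphere2 x2) (x1x2 : x1 <> x2).
Hypothesis on : orthonormal3 e1 e2 x1.
Local Notation I := (unit_itv R).
Local Notation M := (punctured_sphere x1 x2).
Local Notation U := (uconf 2 M).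
Local Notation psi := (@psi R x1 x2 e1 e2 on).
Local Notation B0 := (\pi_U (base_conf x2 on)).
Local Notation gamma := (gamma_x2 x2 on).

(* During a half turn about the point 2, the first string stays the closer one
   to the origin, so its circle never meets the second string. *)
Definition inner_pt (s : R) : R * R := (2 - sin (pi * s), - cos (pi * s)).
Definition outer_pt (s : R) : R * R := (2 + sin (pi * s), cos (pi * s)).

(** As a complex number [circle w a] is [w] times (1 + 3 e^{ia}) / 4. *)
Lemma sqnorm_circle (w : R * R) a :
  sqnorm (circle w a) = sqnorm w * (10 + 6 * cos a) / 16.
Proof.
have h := cos2Dsin2 a; rewrite !expr2 in h.
have -> : 10 + 6 * cos a = 1 + 6 * cos a + 9 * (cos a * cos a + sin a * sin a).
  by rewrite h; ring.
by rewrite /sqnorm /circle /=; field.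
Qed.

(** The inner point has squared norm [5 - 4 * sin (pi * s)], which [circle] multiplies by a factor
    at most 1, and the outer one [5 + 4 * sin (pi * s)]. Equality forces [sin (pi * s) = 0] and
    [cos t = 1], where the two points are the distinct base points. *)
Lemma swap_valid (t s : R) : 0 <= s <= 1 ->
  valid (circle (inner_pt s) t, outer_pt s).
Proof.
move=> /andP[s0 s1]; have pp := pi_gt0 R.
have S0 : 0 <= sin (pi * s) by apply: sin_ge0_pi; apply/andP; split; nra.
have := cos2Dsin2 (pi * s); have := cos2Dsin2 t; rewrite !expr2 => ct cs.
have nI : sqnorm (inner_pt s) = 5 - 4 * sin (pi * s).
  by rewrite /sqnorm /inner_pt /= !expr2; move: cs; move: (sin _) (cos _) => x y ?; lra.
have nO : sqnorm (outer_pt s) = 5 + 4 * sin (pi * s).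
  by rewrite /sqnorm /outer_pt /= !expr2; move: cs; move: (sin _) (cos _) => x y ?; lra.
have S1 : sin (pi * s) <= 1 by exact: sin_le1.
have C1 : -1 <= cos t <= 1 by rewrite cos_geN1 cos_le1.
case/andP: C1 => C0 C1.
split=> /=.
- move=> /(congr1 (@sqnorm R)); rewrite sqnorm_circle sqnorm0 nI; nra.
- by move=> /(congr1 (@sqnorm R)); rewrite nO sqnorm0; lra.
- move=> E; have := congr1 (@sqnorm R) E; rewrite sqnorm_circle nI nO => H.
  have x0 : sin (pi * s) = 0 by nra.
  have c1 : cos t = 1 by rewrite x0 in H; lra.
  have t0 : sin t = 0 by move: ct; rewrite c1; nra.
  have := congr1 snd E; rewrite /circle /inner_pt /outer_pt /= c1 t0 => E2.
  by move: cs; rewrite x0 (_ : cos (pi * s) = 0); lra.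
Qed.

(** A half turn carries the circling string along: a free homotopy from gamma_{2,1} to gamma_{2,2}
    whose left and right sides are both [tau]. The turn is clockwise, so [tau^-1] is the half-twist
    sigma. *)
Lemma gamma_conj : exists tau : pi1 R B0, gamma ord_max = (tau^-1 * gamma ord0 * tau)%g.
Proof.
pose F (d : I * I) : U := psi (mkY (swap_valid (pi *+ 2 * set_val d.1) (itvP d.2))).
have c1 : continuous (fun d : I * I => set_val d.1 : R).
  by move=> e; apply: continuous_comp; [exact: cvg_fst|exact: set_val_continuous].
have c2 : continuous (fun d : I * I => set_val d.2 : R).
  by move=> e; apply: continuous_comp; [exact: cvg_snd|exact: set_val_continuous].
have cF : continuous F.
  pose y (d : I * I) := mkY (swap_valid (pi *+ 2 * set_val d.1) (itvP d.2)).
  suff cy : continuous y.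
    move=> d; apply: (@continuous_comp _ _ _ y psi); first exact: cy.
    exact: psi_continuous.
  have k1 : continuous (fun d : I * I => pi *+ 2 * set_val d.1 : R) by cts.
  have k2 : continuous (fun d : I * I => pi * set_val d.2 : R) by cts.
  have cc1 := cts_comp (f := cos) k1 (@continuous_cos R).
  have cs1 := cts_comp (f := sin) k1 (@continuous_sin R).
  have cc2 := cts_comp (f := cos) k2 (@continuous_cos R).
  have cs2 := cts_comp (f := sin) k2 (@continuous_sin R).
  apply: continuous_comp_initial.
  have -> : set_val \o y = fun d => (circle (inner_pt (set_val d.2)) (pi *+ 2 * set_val d.1),
    outer_pt (set_val d.2)) by [].
  rewrite /circle /inner_pt /outer_pt /=.
  by apply: pair_continuous; apply: pair_continuous; cts.
have S0 := set_val_zero R.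
have S1 := set_val_one R.
have i0 : inner_pt 0 = base_pt R 0 by rewrite /inner_pt mulr0 sin0 cos0 subr0.
have o0 : outer_pt 0 = base_pt R 1 by rewrite /outer_pt mulr0 sin0 cos0 addr0.
have i1 : inner_pt 1 = base_pt R 1 by rewrite /inner_pt mulr1 sinpi cospi subr0 opprK.
have o1 : outer_pt 1 = base_pt R 0 by rewrite /outer_pt mulr1 sinpi cospi addr0.
have circ0 w : circle w 0 = w :> R * R.
  by apply: pairP; rewrite /circle cos0 sin0 /=; field.
have circ1 w : circle w (pi *+ 2) = w :> R * R.
  by apply: pairP; rewrite /circle cos2pi sin2pi /=; field.
have [p0 p0E p0P] := @gamma_path R x1 x2 e1 e2 on ord0.
have [p1 p1E p1P] := @gamma_path R x1 x2 e1 e2 on ord_max.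
have FP t s (y : set_type (@valid R)) :
    (circle (inner_pt (set_val s)) (pi *+ 2 * set_val t), outer_pt (set_val s)) =
      set_val y -> F (t, s) = psi y by move=> E; exact: psi_eq.
have bot t : F (t, zero) = p0 t by rewrite p0P; apply: FP; rewrite S0 i0 o0.
(* After the half turn the circling point starts at (2, 1): the pair comes in the opposite order,
   which [psi] does not see. *)
have top t : F (t, one) = p1 t.
  rewrite p1P; have V := strands_valid ord_max (set_val t : R).
  have V' : valid (strands ord_max (set_val t : R) 1, strands ord_max (set_val t) 0).
    by have [/= a b ab] := V; split => //= /esym.
  rewrite (@psi_eq R x1 x2 e1 e2 on _ (mkY V)) // (psi_swap x2 on V V').
  by apply: FP; rewrite S1 i1 o1.
have sides s : F (zero, s) = F (one, s).
  apply: FP; rewrite S0 mulr0 circ0; transitivity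
    (circle (inner_pt (set_val s)) (pi *+ 2 * set_val (one : I)), outer_pt (set_val s)).
    by rewrite S1 mulr1 circ1.
  by [].
have t0 : F (zero, zero) = B0 by rewrite bot path_zero.
have t1 : F (zero, one) = B0 by rewrite top path_zero.
pose tau := mk_path (@col_continuous _ _ _ zero cF) t0 t1.
exists (\pi_(pi1 R B0) tau).
have := square_homotopic (b := p0) (r := tau) (l := tau) (t := p1) cF bot top
  (fun=> erefl) (fun s => esym (sides s)).
move=> /pi1_eqP; rewrite -!pi1_mulE -p0E -p1E => E.
rewrite -mulgA.
rewrite (E : (gamma ord0 * \pi_(pi1 R B0) tau = \pi_(pi1 R B0) tau * gamma ord_max)%g).
by rewrite mulKg.
Qed.

Definition prod_winding (a : pi1 R B0) : R :=
  winding (sprod_continuous x2 on).1 (sprod_continuous x2 on).2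
    (sprod_neq0 x2_sphere x1x2 on) a.

Lemma prod_windingM a b : prod_winding (a * b)%g = prod_winding a + prod_winding b.
Proof. exact: windingM. Qed.

(* The product of the coordinates is (5/4)(1 + 3 e^{i phi}), which has argument
   [phi] up to a correction less than a quarter turn. *)
Lemma prod_winding_gamma : prod_winding (gamma ord0) = pi *+ 2.
Proof.
have [p -> pE] := @gamma_path R x1 x2 e1 e2 on ord0.
pose T (t : R) : R := set_val (clamp t).
have cT : continuous T.
  by move=> t; apply: (@continuous_comp _ _ _ (@clamp R) set_val);
    [exact: clamp_continuous|exact: set_val_continuous].
pose phi t := pi *+ 2 * T t.
have cphi : continuous phi by rewrite /phi; cts.
have cc := cts_comp (f := cos) cphi (@continuous_cos R).
have cs := cts_comp (f := sin) cphi (@continuous_sin R).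
pose z t : R * R := (cos (phi t), sin (phi t)).
pose w t : R * R := (5 / 4 * (1 + 3 * cos (phi t)), 5 / 4 * (3 * sin (phi t))).
have h t : cos (phi t) * cos (phi t) + sin (phi t) * sin (phi t) = 1.
  by rewrite -!expr2 cos2Dsin2.
have i0 t : 0 < inner (z t) (w t).
  have -> : inner (z t) (w t) = 5 / 4 * (cos (phi t) +
      3 * (cos (phi t) * cos (phi t) + sin (phi t) * sin (phi t))).
    by rewrite /inner /=; ring.
  by rewrite h; have := cos_geN1 (phi t); lra.
have wE t : sprod e1 e2 (p (clamp t)) = w t.
  rewrite pE sprod_psi /= strands00 strands01 -/(T t) -/(phi t).
  by apply: pairP; rewrite /cmul /w /=; field.
have z0 t : z t <> 0.
  move=> zt; have := h t; have /= -> := congr1 fst zt; have /= -> := congr1 snd zt.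
  by rewrite mulr0 addr0 => /eqP; rewrite eq_sym oner_eq0.
have w0 t : w t <> 0 by rewrite -wE; exact: sprod_neq0.
have pz t : polar (phi t) (z t).
  by rewrite /polar /rho (_ : sqnorm _ = 1) ?sqrtr1 ?mul1r // /sqnorm !expr2 h.
have pw t : polar (phi t + ang (z t) (w t)) (w t) by exact: polar_ang.
have ca : continuous (fun t => ang (z t) (w t)).
  have ci : continuous (fun t => (inner (z t) (w t))^-1).
    apply: ctsV => [t|]; first exact/lt0r_neq0/i0.
    by rewrite /inner /=; cts.
  apply: (cts_comp (f := @atan R)); last by move=> ?; exact: continuous_atan.
  by rewrite /cross /=; cts.
have cth : continuous (fun t => phi t + ang (z t) (w t)) by cts.
have pol t : polar (phi t + ang (z t) (w t)) (sprod e1 e2 (p (clamp t))).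
  by rewrite wE.
rewrite /prod_winding (winding_angle _ _ _ cth pol) /phi /z /w /phi.
have -> : T 0 = 0 by rewrite /T clampE ?lexx ?ler01.
have -> : T 1 = 1 by rewrite /T clampE ?lexx ?ler01.
by rewrite mulr0 mulr1 cos2pi sin2pi cos0 sin0; ring.
Qed.

End conjugation.

(** * The Schreier basis *)

Section int_powers.
Local Open Scope group_scope.
Variables (G : groupType) (a : G).

Lemma expgzS (n : int) : expgz a (n + 1)%R = expgz a n * a.
Proof.
case: n => [k|[|k]].
- have -> : (k%:Z + 1)%R = k.+1%:Z by lia.
  by rewrite /= expgSr.
- by rewrite mulVg.
- have -> : (Negz k.+1 + 1)%R = Negz k by rewrite !NegzE; lia.
  by rewrite /= [a ^+ k.+2]expgS invgM mulgVK.
Qed.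

Lemma expgzB1 (n : int) : expgz a (n - 1)%R = expgz a n * a^-1.
Proof. by rewrite -{2}(subrK 1%R n) expgzS mulgK. Qed.

Lemma int_ind_pm (P : int -> Prop) : P 0%R ->
  (forall n, P n -> P (n + 1)%R) -> (forall n, P n -> P (n - 1)%R) -> forall n, P n.
Proof.
move=> P0 PS PB; case=> [k|k].
  by elim: k => // k IH; rewrite -addn1 PoszD; exact: PS.
rewrite NegzE; elim: k => [|k IH]; first by rewrite -[(- _)%R]add0r; exact: PB.
have -> : (- k.+2%:Z = - k.+1%:Z - 1)%R by lia.
exact: PB.
Qed.

Lemma expgzD (m n : int) : expgz a (m + n)%R = expgz a m * expgz a n.
Proof.
elim/int_ind_pm: n => [|n IH|n IH]; first by rewrite addr0 mulg1.
  by rewrite addrA !expgzS IH mulgA.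
by rewrite addrA !expgzB1 IH mulgA.
Qed.

Lemma expgzN (n : int) : expgz a (- n)%R = (expgz a n)^-1.
Proof. by apply: (mulgI (expgz a n)); rewrite -expgzD subrr mulgV. Qed.

End int_powers.

Section power_morphism.
Local Open Scope group_scope.

Lemma expgz_morph (G H : groupType) (f : G -> H) (a : G) (n : int) :
  (forall b c, f (b * c) = f b * f c) -> f (expgz a n) = expgz (f a) n.
Proof.
move=> fM; have f1 : f 1 = 1 by apply: (mulgI (f 1)); rewrite -fM !mulg1.
have fV b : f b^-1 = (f b)^-1 by apply: (mulgI (f b)); rewrite -fM !mulgV.
elim/int_ind_pm: n => [|n IH|n IH]; first exact: f1.
  by rewrite !expgzS fM IH.
by rewrite !expgzB1 fM fV IH.
Qed.

End power_morphism.

Section derived_subgroup.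
Local Open Scope group_scope.
Variable G : groupType.

Lemma subgroupV (H : set G) a : subgroup H -> H a -> H a^-1.
Proof. by move=> [H1 HB] Ha; rewrite -[a^-1]mul1g; exact: HB. Qed.

Lemma subgroupM (H : set G) a b : subgroup H -> H a -> H b -> H (a * b).
Proof. by move=> sH Ha Hb; rewrite -[b]invgK; apply: sH.2 => //; exact: subgroupV. Qed.

Lemma smallest_subgroup (C : set G) : subgroup (smallest (@subgroup G) C).
Proof.
split; first by move=> H [[]].
move=> a b Ha Hb H [sH CH].
by apply: sH.2; [exact: (Ha H (conj sH CH))|exact: (Hb H (conj sH CH))].
Qed.

Lemma Gamma2_subgroup : subgroup (Gamma2 G). Proof. exact: smallest_subgroup. Qed.

Lemma Gamma2_commg a b : Gamma2 G (commg a b).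
Proof. by move=> H [_ HC]; apply: HC; exists a, b. Qed.

Lemma Gamma2_conj a c : Gamma2 G c -> Gamma2 G (a * c * a^-1).
Proof.
move=> Gc; have -> : a * c * a^-1 = c * commg c a^-1.
  by rewrite /commg /conjg invgK mulKVg mulgA.
exact: (subgroupM Gamma2_subgroup Gc (Gamma2_commg _ _)).
Qed.

(** The kernel of a homomorphism to an abelian group is a subgroup containing all commutators. *)
Lemma Gamma2_additive (V : zmodType) (w : G -> V) c :
  (forall a b, w (a * b) = (w a + w b)%R) -> Gamma2 G c -> w c = 0%R.
Proof.
move=> wM; have w1 : w 1 = 0%R.
  by apply: (addrI (w 1)); rewrite -wM mulg1 addr0.
have wV a : w a^-1 = (- w a)%R.
  by apply: (addrI (w a)); rewrite -wM mulgV subrr w1.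
move=> Gc; apply: (Gc [set u | w u = 0%R]); split.
  by split=> // a b /= wa wb; rewrite wM wV wa wb subr0.
by move=> _ [a [b ->]] /=; rewrite /commg /conjg !wM !wV (addrC (w a) (w b)) addKr addNr.
Qed.

End derived_subgroup.

Section schreier.
Local Open Scope group_scope.
Variables (B F : groupType) (iota : F -> B) (x y : F) (V : zmodType).
Hypotheses (iotaM : forall a b, iota (a * b) = iota a * iota b) (iota_inj : injective iota).
Hypothesis gen : forall P : F -> Prop, P 1 -> (forall a b, P a -> P b -> P (a * b)) ->
  (forall a, P a -> P a^-1) -> P x -> P y -> forall a, P a.
Variable t : B.
Hypothesis xy_conj : iota x = t^-1 * iota y * t.
Variables wD wP : B -> V.
Hypotheses (wDM : forall a b, wD (a * b) = (wD a + wD b)%R).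
Hypotheses (wPM : forall a b, wP (a * b) = (wP a + wP b)%R).
Hypothesis wD_ker : forall a, wD a = 0%R -> exists b, iota b = a.
Hypothesis wPy : forall n : int, (wP (iota y) *~ n = 0)%R -> n = 0%R.
(** A right action: the integer stands for the coset of a power of [y], and left multiplication by
    [K] commutes with the action. *)
Hypothesis act : forall (K : groupType) (f : int -> K),
  exists A : F -> K * int -> K * int,
  [/\ forall a b s, A (a * b) s = A b (A a s),
      forall s, A y s = (s.1, (s.2 + 1)%R),
      forall s, A x s = (s.1 * f s.2, (s.2 + 1)%R) &
      forall a k s, A a (k * s.1, s.2) = (k * (A a s).1, (A a s).2)].

Definition schreier_gen (i : int) : F := expgz y i * x * expgz y (- (i + 1))%R.
Definition basis_elt (i : int) : B :=
  expgz (iota y) i * iota x * expgz (iota y) (- (i + 1))%R.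

Lemma iota_schreier i : iota (schreier_gen i) = basis_elt i.
Proof. by rewrite /schreier_gen !iotaM !(expgz_morph _ _ iotaM). Qed.

(** In [B], [x * y^-1] is the commutator of [t] and [y^-1], because [x] is the conjugate of [y] by
    [t]; [basis_elt i] is its conjugate by [y^i]. *)
Lemma Gamma2_basis_elt i : Gamma2 B (basis_elt i).
Proof.
have -> : basis_elt i = expgz (iota y) i * commg t (iota y)^-1 * (expgz (iota y) i)^-1.
  rewrite /basis_elt xy_conj expgzN expgzS invgM /commg /conjg invgK !mulgA.
  by [].
by apply: Gamma2_conj; exact: Gamma2_commg.
Qed.

Definition schreier_group : set F :=
  smallest (@subgroup F) (range schreier_gen).

Lemma schreier_group_subgroup : subgroup schreier_group.
Proof. exact: smallest_subgroup. Qed.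

Lemma schreier_group_gen i : schreier_group (schreier_gen i).
Proof. by move=> H [_ HC]; apply: HC; exists i. Qed.

(** Conjugation by [y^n] only shifts indices: it sends [schreier_gen i] to
    [schreier_gen (n + i)]. *)
Lemma schreier_group_conj (n : int) a :
  schreier_group a -> schreier_group (expgz y n * a * expgz y (- n)%R).
Proof.
move=> Sa.
pose H : set F := [set a | schreier_group (expgz y n * a * expgz y (- n)%R)].
have [S1 SB] := schreier_group_subgroup.
apply: (Sa H); split.
  split; first by rewrite /H /= mulg1 -expgzD subrr.
  move=> b c; rewrite /H /= => Hb Hc.
  have -> : expgz y n * (b * c^-1) * expgz y (- n)%R =
    (expgz y n * b * expgz y (- n)%R) * (expgz y n * c * expgz y (- n)%R)^-1.
    by rewrite !expgzN !invgM !invgK !mulgA mulgVK.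
  exact: SB.
move=> _ [i _ <-]; rewrite /H /=.
have -> : expgz y n * schreier_gen i * expgz y (- n)%R = schreier_gen (n + i)%R.
  rewrite /schreier_gen !mulgA -(expgzD y n i) -[LHS]mulgA -expgzD.
  by congr (_ * _ * expgz y _); ring.
exact: schreier_group_gen.
Qed.

(** The subgroup is normalised by [y], and [x] is [schreier_gen 0] times [y], so powers of [y] can
    be collected on the right of any word. *)
Lemma schreier_decomp a : exists n, schreier_group (a * expgz y n).
Proof.
have [S1 SB] := schreier_group_subgroup.
apply: (gen (P := fun a => exists n, schreier_group (a * expgz y n))).
- by exists 0%R; rewrite mulg1.
- move=> b c [m Sb] [n Sc]; exists (m + n)%R.
  have -> : b * c * expgz y (m + n)%R =
      (b * expgz y m) * (expgz y (- m)%R * (c * expgz y n) * expgz y (- - m)%R).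
    by rewrite opprK expgzN addrC expgzD !mulgA mulgK.
  exact: (subgroupM schreier_group_subgroup Sb (schreier_group_conj _ Sc)).
- move=> b [m Sb]; exists (- m)%R.
  have -> : b^-1 * expgz y (- m)%R =
      expgz y m * (b * expgz y m)^-1 * expgz y (- m)%R by rewrite invgM !mulgA mulgV mul1g.
  exact: (schreier_group_conj m (subgroupV schreier_group_subgroup Sb)).
- by exists (- (0 + 1))%R; have := schreier_group_gen 0; rewrite /schreier_gen /= mul1g.
- by exists (- 1)%R; rewrite expgzN /= mulgV.
Qed.

Lemma wP_expgz n : wP (iota (expgz y n)) = (wP (iota y) *~ n)%R.
Proof.
have w1 : wP 1 = 0%R by apply: (addrI (wP 1)); rewrite -wPM mulg1 addr0.
have wV a : wP a^-1 = (- wP a)%R.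
  by apply: (addrI (wP a)); rewrite -wPM mulgV subrr w1.
rewrite (expgz_morph _ _ iotaM).
elim/int_ind_pm: n => [|n IH|n IH]; first by rewrite mulr0z.
  by rewrite expgzS wPM IH mulrzDr.
by rewrite expgzB1 wPM wV IH mulrzBr.
Qed.

(** Vanishing of [wD] lifts [g] to some [a], and [a * y^n] lies in the Schreier subgroup for some
    [n]. As [wP] kills both [g] and the image of that subgroup, it kills [y^n], which forces
    [n = 0]. *)
Lemma Gamma2_schreier g : Gamma2 B g -> exists2 a, iota a = g & schreier_group a.
Proof.
move=> Gg; have [a ag] := wD_ker (Gamma2_additive wDM Gg).
exists a => //; have [n Sn] := schreier_decomp a.
have : wP (iota (a * expgz y n)) = 0%R.
  suff : Gamma2 B (iota (a * expgz y n)) by exact: Gamma2_additive.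
  have [G1 GB] := Gamma2_subgroup B.
  have i1 : iota 1 = 1 by apply: (mulgI (iota 1)); rewrite -iotaM !mulg1.
  have iV b : iota b^-1 = (iota b)^-1.
    by apply: (mulgI (iota b)); rewrite -iotaM !mulgV.
  apply: (Sn [set b | Gamma2 B (iota b)]); split.
    split; rewrite /= ?i1 // => b c Gb Gc; rewrite iotaM iV; exact: GB.
  by move=> _ [i _ <-] /=; rewrite iota_schreier; exact: Gamma2_basis_elt.
rewrite iotaM wPM ag (Gamma2_additive wPM Gg) add0r wP_expgz => /wPy n0.
by rewrite n0 mulg1 in Sn.
Qed.

(** [schreier_gen i] moves [(k, 0)] to [(k, i)], then to [(k * f i, i + 1)], then to [(k * f i, 0)];
    the homomorphism is read off the orbit of [(1, 0)]. *)
Lemma act_hom (K : groupType) (f : int -> K) : exists phi : B -> K,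
  (forall u v, Gamma2 B u -> Gamma2 B v -> phi (u * v) = phi u * phi v) /\
  (forall j, phi (basis_elt j) = f j).
Proof.
have [A [AM Ay Ax Aequi]] := act f.
(* That 1 acts trivially follows from [A y (A 1 s) = A y s] and the injectivity of [A y]. *)
have A1 s : A 1 s = s.
  have Ayinj u v : A y u = A y v -> u = v.
    by rewrite !Ay; case: u v => [u1 u2] [v1 v2] /= [-> /addIr ->].
  by apply: Ayinj; rewrite -AM mul1g.
have Aexp n s : A (expgz y n) s = (s.1, (s.2 + n)%R).
  elim/int_ind_pm: n s => [|n IH|n IH] s.
  - by rewrite A1 addr0 -surjective_pairing.
  - by rewrite expgzS AM IH Ay addrA.
  - rewrite expgzB1 AM IH.
    have -> : (s.1, (s.2 + n)%R) = A y (s.1, (s.2 + (n - 1))%R).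
      by rewrite Ay /= addrA subrK.
    by rewrite -AM mulgV A1.
have Az i k : A (schreier_gen i) (k, 0%R) = (k * f i, 0%R).
  by rewrite /schreier_gen !AM Aexp Ax Aexp /= add0r subrr.
have Aeq a k : A a (k, 0%R) = (k * (A a (1, 0%R)).1, (A a (1, 0%R)).2).
  by rewrite -(Aequi a k (1, 0%R)) /= mulg1.
(* The Schreier subgroup preserves the slice over 0. For an inverse, each point of the slice is
   exhibited as the image under [c] of a point of the slice. *)
have S0 a : schreier_group a -> forall k, (A a (k, 0%R)).2 = 0%R.
  move=> Sa; apply: (Sa [set b | forall k, (A b (k, 0%R)).2 = 0%R]); split.
    split=> [k|b c Hb Hc k] /=; first by rewrite A1.
    rewrite AM.
    have -> : A b (k, 0%R) = ((A b (k, 0%R)).1, 0%R) by rewrite [LHS]surjective_pairing Hb.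
    move: (A b _).1 => k'.
    have -> : (k', 0%R) = A c (k' * (A c (1, 0%R)).1^-1, 0%R).
      by rewrite Aeq mulgVK Hc.
    by rewrite -AM mulgV A1.
  by move=> _ [i _ <-] k /=; rewrite Az.
(* Outside the image of [iota] the value 1 is a mere default. *)
pose phi u := match pselect (exists a, iota a = u) with
  | left h => (A (projT1 (cid h)) (1, 0%R)).1 | right _ => 1 end.
have phiE a : phi (iota a) = (A a (1, 0%R)).1.
  rewrite /phi; case: pselect => [h|[]]; last by exists a.
  by case: cid => b /= /iota_inj ->.
exists phi; split=> [u v Gu Gv|j].
  have [a <- Sa] := Gamma2_schreier Gu; have [b <- Sb] := Gamma2_schreier Gv.
  rewrite -iotaM !phiE AM.
  (* Equivariance under [K] pulls the value of [a] out on the left, so a right action yields the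
     factors in the correct order. *)
  have -> : A a (1, 0%R) = ((A a (1, 0%R)).1, 0%R).
    by rewrite [LHS]surjective_pairing S0.
  by rewrite Aeq.
by rewrite -iota_schreier phiE Az mul1g.
Qed.

(** Membership in Gamma_2 is carried along the induction, since the two maps are multiplicative only
    there. *)
Lemma Gamma2_hom_unique (K : groupType) (phi psi : B -> K) :
  (forall u v, Gamma2 B u -> Gamma2 B v -> phi (u * v) = phi u * phi v) ->
  (forall u v, Gamma2 B u -> Gamma2 B v -> psi (u * v) = psi u * psi v) ->
  (forall j, psi (basis_elt j) = phi (basis_elt j)) -> forall u, Gamma2 B u -> psi u = phi u.
Proof.
have [G1 GB] := Gamma2_subgroup B; have sG := Gamma2_subgroup B.
have V1 (h : B -> K) : (forall u v, Gamma2 B u -> Gamma2 B v -> h (u * v) = h u * h v) ->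
    h 1 = 1 /\ forall u, Gamma2 B u -> h u^-1 = (h u)^-1.
  move=> hM; have h1 : h 1 = 1 by apply: (mulgI (h 1)); rewrite -hM // !mulg1.
  split=> // u Gu; apply: (mulgI (h u)).
  by rewrite -hM ?mulgV //; exact: (subgroupV sG Gu).
move=> phiM psiM E u Gu; have [a <- Sa] := Gamma2_schreier Gu.
have [p1 pV] := V1 _ phiM; have [q1 qV] := V1 _ psiM.
have i1 : iota 1 = 1 by apply: (mulgI (iota 1)); rewrite -iotaM !mulg1.
have iV b : iota b^-1 = (iota b)^-1.
  by apply: (mulgI (iota b)); rewrite -iotaM !mulgV.
suff [] : Gamma2 B (iota a) /\ psi (iota a) = phi (iota a) by [].
apply: (Sa [set a | Gamma2 B (iota a) /\ psi (iota a) = phi (iota a)]); split.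
  split=> [|b c [Gb Eb] [Gc Ec]] /=; first by rewrite i1 p1 q1.
  have Gc' := subgroupV sG Gc.
  by rewrite iotaM iV psiM // phiM // qV // pV // Eb Ec; split=> //; exact: (GB _ _ Gb Gc).
move=> _ [i _ <-] /=; rewrite iota_schreier; split => //; exact: Gamma2_basis_elt.
Qed.

Lemma basis_elt_free : free_basis (Gamma2 B) basis_elt.
Proof.
split; [exact: Gamma2_subgroup|exact: Gamma2_basis_elt|move=> K f].
have [phi [phiM phiz]] := act_hom f; exists phi; split=> // psi psiM psiz u Gu.
by apply: Gamma2_hom_unique => // j; rewrite psiz phiz.
Qed.

(** Prescribed values separate the indices: send [basis_elt i] to [iota y] and the others to 1. The
    target [B] serves because [wP] does not vanish on [iota y]. *)
Lemma basis_elt_inj : injective basis_elt.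
Proof.
move=> i j zij; apply: contrapT => ij.
have [phi [_ phiz]] := act_hom (fun k => if k == i then iota y else 1).
have := phiz j; rewrite -zij phiz eqxx (negbTE (introN eqP (fun e => ij (esym e)))) => y1.
have w1 : wP 1 = 0%R by apply: (addrI (wP 1)); rewrite -wPM mulg1 addr0.
by have := @wPy 1%R; rewrite y1 w1 mul0rz => /(_ erefl).
Qed.

Lemma basis_elt_infinite : infinite_set (range basis_elt).
Proof.
move=> fz; apply: infinite_nat.
have : finite_set ((fun n : nat => basis_elt n%:Z) @^-1` range basis_elt).
  by apply: finite_preimage => // m n _ _ /basis_elt_inj [].
by apply: sub_finite_set => n _; exists n%:Z.
Qed.

End schreier.

(** * The monodromy action with prescribed values *)

Section representation.
Variables (R : realType) (K : groupType) (f : int -> K).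
Local Notation S := (K * int)%type.
Local Notation F := (pi1 R (base R)).

(* Going around [-1] shifts the integer, going around [1] also multiplies by the
   prescribed value. *)
Definition gap_down (j : gap) (s : S) : S := match j with
  | gapL => (s.1, s.2 + 1)
  | gapM => s
  | gapR => ((s.1 * (f (s.2 - 1))^-1)%g, s.2 - 1) end.
Definition gap_up (j : gap) (s : S) : S := match j with
  | gapL => (s.1, s.2 - 1)
  | gapM => s
  | gapR => ((s.1 * f s.2)%g, s.2 + 1) end.

Lemma gap_downK j : cancel (gap_down j) (gap_up j).
Proof. by case: j => -[k n] //=; rewrite ?addrK ?subrK ?mulgVK. Qed.

Lemma gap_upK j : cancel (gap_up j) (gap_down j).
Proof. by case: j => -[k n] //=; rewrite ?addrK ?subrK ?mulgK. Qed.

Definition gap_action : F -> S -> S :=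
  monodromy (cut_local_cocycle R gap_downK gap_upK) (x := base R).

Lemma gap_action_dips (v : {path unit_itv R from base R to base R}) j k s :
  dips v j k -> gap_action (\pi_(pi1 R (base R)) v) s = gap_up k (gap_down j s).
Proof. by move=> vd; rewrite /gap_action monodromyE (hol_dips _ _ _ vd). Qed.

Lemma gap_action_equivariant (a : F) k s :
  gap_action a ((k * s.1)%g, s.2) = ((k * (gap_action a s).1)%g, (gap_action a s).2).
Proof.
apply: (monodromy_equivariant _ (phi := fun s : S => ((k * s.1)%g, s.2))) => x y u.
rewrite /cut_cocycle; case: (0 <= _); case: (0 <= _) => //;
  by case: (col _) => //=; rewrite mulgA.
Qed.

End representation.

Theorem corollary47 (R : realType) (x1 x2 : 'rV[R]_3)
    (x1_sphere : sphere2 x1) (x2_sphere : sphere2 x2) (x1x2 : x1 <> x2)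
    (e1 e2 : 'rV[R]_3) (frame : orthonormal3 e1 e2 x1) :
  let B : groupType := braid_group R (base_conf x2 frame) in
  let gamma_21 : B := gamma_x2 x2 frame ord0 in
  let gamma_22 : B := gamma_x2 x2 frame ord_max in
  let z (i : int) : B :=
    (expgz gamma_21 i * gamma_22 * expgz gamma_21 (- (i + 1))%R)%g in
  free_basis (Gamma2 B) z /\
  infinite_set (range z).
Proof.
move=> B g1 g2 z.
have [v1 g1E d1] := gamma21_dips x2 frame.
have [v2 g2E d2] := gamma22_dips x2 frame.
pose y := \pi_(pi1 R (base R)) v1; pose x := \pi_(pi1 R (base R)) v2.
have [tau conj] := gamma_conj x2 frame.
have iM := @iotasM R x1 x2 e1 e2 frame.
have gen (P : pi1 R (base R) -> Prop) : P 1%g ->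
    (forall a b, P a -> P b -> P (a * b)%g) -> (forall a, P a -> P a^-1%g) ->
    P x -> P y -> forall a, P a.
  (* The middle gap loop is trivial, so [y] is the left gap loop and [x] the inverse of the right
     one. *)
  move=> P1 PM PV Px Py; apply: pi1_gen => //.
    by move: Py; rewrite /y (pi1_dips d1) gap_loopM invg1 mulg1.
  by move: (PV _ Px); rewrite /x (pi1_dips d2) gap_loopM mul1g invgK.
have act (K : groupType) (f : int -> K) := And4
  (fun a b s => @monodromyM R _ _ _ (cut_local_cocycle R (gap_downK f) (gap_upK f)) (base R) a b s)
  (fun s => gap_action_dips f s d1) (fun s => gap_action_dips f s d2)
  (@gap_action_equivariant R K f).
have xyc : iotas x2 frame x = (tau^-1 * iotas x2 frame y * tau)%g.
  by rewrite /x /y -g1E -g2E.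
have ker := @iotas_surj R x1 x2 e1 e2 x2_sphere x1x2 frame.
have wPy (n : int) : prod_winding x2_sphere x1x2 (iotas x2 frame y) *~ n = 0 -> n = 0.
  rewrite /y -g1E prod_winding_gamma => /eqP.
  have p0 : 0 < pi *+ 2 :> R by rewrite mulr2n addr_gt0 // pi_gt0.
  by rewrite mulrz_eq0 (gt_eqF p0) orbF => /eqP.
have zE : z = basis_elt (iotas x2 frame) x y.
  by apply/funext => i; rewrite /z /basis_elt /x /y -g1E -g2E.
rewrite zE; split.
  apply: basis_elt_free; [exact: iM|exact: iotas_inj|exact: gen|exact: xyc|
    exact: disc_windingM|exact: prod_windingM|exact: ker|exact: wPy|].
  by move=> K f; exists (@gap_action R K f); exact: act.
apply: basis_elt_infinite; [exact: iM|exact: iotas_inj|exact: gen|exact: xyc|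
  exact: disc_windingM|exact: prod_windingM|exact: ker|exact: wPy|].
by move=> K f; exists (@gap_action R K f); exact: act.
Qed.
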